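(* Let $A$ be a $\mathbb{Z}$-graded unital associative $\mathbb{C}$-algebra, and let $(A^\pm,\delta)$ be either a commutative or a noncommutative triangular structure on $A$. Then the following conditions on a two-sided ideal $I\subsetneq A$ are equivalent: (i) $I$ is a primitive ideal; (ii) $I$ is a prime ideal; (iii) $I$ is the left annihilator of a simple object of the category ${}^{\uparrow}\mathscr{O}$. In addition, the algebra $A$ has finite length as an $A\otimes A^{\mathrm{op}}$-module.
   Context: Algebras are associative over $\mathbb{C}$, $\otimes=\otimes_{\mathbb{C}}$. Let $A=\bigoplus_{m\in\mathbb{Z}}A(m)$ be a $\mathbb{Z}$-graded unital algebra, $A^\pm=\bigoplus_{m}A^\pm(m)\subset A$ graded unital subalgebras, $\delta\in A$. Conditions: (T0) $A$ is finitely generated as an $A^+\otimes(A^-)^{\mathrm{op}}$-module. (T1) $[\delta,a]=m\cdot a$ for all $m\in\mathbb{Z}$, $a\in A(m)$. (T2) $A^\pm$ are finitely generated algebras; $A^+(m)=0$ for $m<0$, $A^-(m)=0$ for $m>0$; $A^+(0)=\mathbb{C}=A^-(0)$. A commutative triangular structure on $A$ is data $(A^\pm,\delta)$ such that (T0)–(T2) hold and both $A^+$ and $A^-$ are commutative. A noncommutative triangular structure: $A$ is in addition equipped with a multiplicative increasing filtration $0=A_{-1}\subset A_0\subset A_1\subset\cdots$ ($A_iA_j\subset A_{i+j}$, $\bigcup_jA_j=A$, $1\in A_0$); $\mathrm{gr}\,A$ is the associated graded algebra (not assumed commutative), $A^\pm$ carry the induced filtrations, and besides (T0)–(T2) the following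 hold: (T0') $\mathrm{gr}\,A$ is a finitely generated $(\mathrm{gr}\,A^+\text{-}\mathrm{gr}\,A^-)$-bimodule. (T1') $\delta\in A_1$, and the image of $\delta$ in $A_1/A_0$ is a central element of $\mathrm{gr}\,A$. (T3) The algebras $\mathrm{gr}\,A^\pm$ are commutative. (T4) The algebras $\mathrm{gr}\,A^\pm$ are generated by $\mathrm{gr}_0A^\pm\oplus\mathrm{gr}_1A^\pm$, their components of degree $\le 1$; moreover $\dim(\mathrm{gr}_iA^\pm)<\infty$ for all $i\ge 0$. Put $\bar A^-:=\bigoplus_{m>0}A^-(-m)$. ${}^{\uparrow}\mathscr{O}$ is the category of finitely generated left $A$-modules $M$ on which $\bar A^-$ acts locally nilpotently: for every $m\in M$ there is $n>0$ with $a_1\cdots a_nm=0$ for all $a_1,\dots,a_n\in\bar A^-$. A two-sided ideal $I\subsetneq A$ is primitive if it is the annihilator of a simple left $A$-module, and prime if $J_1J_2\subset I$ implies $J_1\subset I$ or $J_2\subset I$ for two-sided ideals $J_1,J_2\subset A$. *)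

(* Defs.v *)
From HB Require Import structures.
From mathcomp Require Import all_boot all_algebra.
From mathcomp Require Import boolp classical_sets reals.
From mathcomp Require Import complex.

Set Implicit Arguments.
Unset Strict Implicit.
Unset Printing Implicit Defensive.

Import GRing.Theory.
Local Open Scope classical_set_scope.
Local Open Scope ring_scope.

(* Subspaces, subalgebras and ideals are sets [A -> Prop]; the closure
   predicates of the algebra library apply to them through [in S]. *)

Definition lin_span (K : fieldType) (V : lmodType K) (S : set V) : set V :=
  smallest (fun W : set V => submod_closed [in W]) S.

Definition fin_dim (K : fieldType) (V : lmodType K) (W : set V) : Prop :=
  exists s : seq V, W `<=` lin_span [set` s].

Definition gen_subalg (K : fieldType) (A : algType K) (S : set A) : set A :=
  smallest (fun B : set A => subalg_closed [in B]) S.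

Definition fg_subalg (K : fieldType) (A : algType K) (B : set A) : Prop :=
  exists s : seq A, B = gen_subalg [set` s].

Definition commutative_on (A : pzRingType) (B : set A) : Prop :=
  forall a b : A, B a -> B b -> a * b = b * a.

(* A is finitely generated as a (B-C)-bimodule, that is, as a module over the
   tensor product of B with the opposite of C, where b (x) c acts by
   x |-> b * x * c.  *)
Definition fg_bimodule (A : pzRingType) (B C : set A) : Prop :=
  exists s : seq A, forall x : A,
    exists (n : nat) (b g c : 'I_n -> A),
      [/\ forall i, B (b i), forall i, g i \in s, forall i, C (c i)
        & x = \sum_(i < n) b i * g i * c i].

Section Gradings.
Variables (K : fieldType) (A : algType K).
Implicit Types (G V : int -> set A) (B : set A).

(* The sum of the V m over the degrees m satisfying P. *)
Definition sum_of (P : pred int) V : set A :=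
  [set a | exists (s : seq int) (x : int -> A),
     [/\ uniq s, all P s, forall m, V m (x m) & a = \sum_(m <- s) x m]].

Record is_grading G : Prop := IsGrading {
  grading_submod : forall m, submod_closed [in G m];
  grading_one : G 0 1;
  grading_mul : forall m n a b, G m a -> G n b -> G (m + n) (a * b);
  grading_total : sum_of predT G = setT;
  grading_direct : forall (s : seq int) (x : int -> A),
    uniq s -> (forall m, G m (x m)) -> \sum_(m <- s) x m = 0 ->
    forall m, m \in s -> x m = 0
}.

Definition homog G B (m : int) : set A := B `&` G m.

Definition graded_subalg G B : Prop :=
  subalg_closed [in B] /\ sum_of predT (homog G B) = B.

End Gradings.

Section AssociatedGraded.
Variables (K : fieldType) (A : algType K).

Record filtration := Filtration {
  fil :> nat -> set A;
  fil_submod : forall i, submod_closed [in fil i];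
  fil_subset : forall i, fil i `<=` fil i.+1;
  fil_one : fil 0 1;
  fil_mul : forall i j a b, fil i a -> fil j b -> fil (i + j)%N (a * b);
  fil_exhaustive : \bigcup_i fil i = setT
}.

Variable F : filtration.

Definition fil_prev (i : nat) : set A := if i is j.+1 then F j else [set 0].

Lemma filZ i (c : K) a : F i a -> F i (c *: a).
Proof.
move=> Fa; have [F0 FZ] := fil_submod F i.
by have := FZ c a 0; rewrite addr0 !inE in F0 * => /(_ Fa F0).
Qed.

Lemma fil0 i : F i 0.
Proof. by have [F0 _] := fil_submod F i; rewrite !inE in F0. Qed.

Lemma filB i a b : F i a -> F i b -> F i (a - b).
Proof.
move=> Fa Fb; have [F0 FZ] := fil_submod F i.
by have := FZ (-1) b a; rewrite !inE scaleN1r addrC => /(_ Fb Fa).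
Qed.

Lemma fil_le i j : (i <= j)%N -> F i `<=` F j.
Proof.
elim: j => [|j IH]; first by rewrite leqn0 => /eqP->.
rewrite leq_eqVlt => /orP[/eqP->//|/IH sij] a /sij; exact: fil_subset.
Qed.

Lemma filD i a b : F i a -> F i b -> F i (a + b).
Proof.
by move=> Fa Fb; rewrite -[b]opprK -[- b]add0r; apply: filB => //;
  apply: filB => //; exact: fil0.
Qed.

Lemma fil_sum i (I : Type) (r : seq I) (f : I -> A) :
  (forall k, F i (f k)) -> F i (\sum_(k <- r) f k).
Proof. by move=> Ff; elim/big_ind: _ => //; [exact: fil0 | exact: filD]. Qed.

Lemma prev0 i : fil_prev i 0.
Proof. by case: i => [//|i]; exact: fil0. Qed.

Lemma prevB i a b : fil_prev i a -> fil_prev i b -> fil_prev i (a - b).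
Proof. by case: i => [/= -> ->|i]; [rewrite subr0|exact: filB]. Qed.

Lemma prevD i a b : fil_prev i a -> fil_prev i b -> fil_prev i (a + b).
Proof. by case: i => [/= -> ->|i]; [rewrite addr0|exact: filD]. Qed.

Lemma prevZ i (c : K) a : fil_prev i a -> fil_prev i (c *: a).
Proof. by case: i => [/= ->|i]; [rewrite scaler0|exact: filZ]. Qed.

Lemma prev_sum i (I : Type) (r : seq I) (f : I -> A) :
  (forall k, fil_prev i (f k)) -> fil_prev i (\sum_(k <- r) f k).
Proof. by move=> Ff; elim/big_ind: _ => //; [exact: prev0 | exact: prevD]. Qed.

Lemma prevMl i j a b : F i a -> fil_prev j b -> fil_prev (i + j)%N (a * b).
Proof.
case: j => [Fa /= ->|j]; first by rewrite mulr0; exact: prev0.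
by rewrite addnS; exact: fil_mul.
Qed.

Lemma prevMr i j a b : fil_prev i a -> F j b -> fil_prev (i + j)%N (a * b).
Proof.
case: i => [/= -> _|i]; first by rewrite mul0r; exact: prev0.
by rewrite addSn; exact: fil_mul.
Qed.

(* The associated graded algebra is presented as the quotient of the Rees
   algebra { sum_i a_i t^i in A[t] | a_i in A_i } by the two-sided ideal of the
   sum_i a_i t^i with a_i in A_(i-1): its degree i part is A_i / A_(i-1), and
   the class of a t^i is the class of a in A_i / A_(i-1). *)

Definition rees_pred : {pred {poly A}} :=
  fun p => `[< forall i, F i p`_i >].

Lemma rees_subring : subring_closed rees_pred.
Proof.
split; rewrite /in_mem /=.
- apply/asboolP => -[|i]; rewrite coef1 /=; [exact: fil_one|exact: fil0].
- by move=> p q /asboolP Fp /asboolP Fq; apply/asboolP => i;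
    rewrite coefB; exact: filB.
- move=> p q /asboolP Fp /asboolP Fq; apply/asboolP => i.
  rewrite coefM; apply: fil_sum => k.
  by rewrite -{1}(subnKC (ltn_ord k : (k <= i)%N)); exact: fil_mul.
Qed.

HB.instance Definition _ :=
  GRing.isSubringClosed.Build {poly A} rees_pred rees_subring.

Record rees := Rees { rees_val :> {poly A}; _ : rees_val \in rees_pred }.

HB.instance Definition _ := [isSub for rees_val].
HB.instance Definition _ := [Choice of rees by <:].
HB.instance Definition _ := [SubChoice_isSubNzRing of rees by <:].

Definition rees_ideal : {pred rees} :=
  fun p => `[< forall i, fil_prev i (val p)`_i >].

Lemma rees_ideal_zmod : zmod_closed rees_ideal.
Proof.
split; rewrite /in_mem /=.
- by apply/asboolP => i; rewrite raddf0 coef0; exact: prev0.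
- by move=> p q /asboolP Fp /asboolP Fq; apply/asboolP => i;
    rewrite raddfB coefB; exact: prevB.
Qed.

HB.instance Definition _ :=
  GRing.isZmodClosed.Build rees rees_ideal rees_ideal_zmod.

Definition gr : Type := Quotient.quot rees_ideal.

HB.instance Definition _ := GRing.Zmodule.on gr.

Definition gr_pi (p : rees) : gr := \pi_(Quotient.quot rees_ideal)%qT p.

Lemma gr_piK x : exists p, x = gr_pi p.
Proof. by exists (repr x); rewrite /gr_pi reprK. Qed.

Lemma gr_piD p q : gr_pi (p + q) = gr_pi p + gr_pi q.
Proof. by rewrite /gr_pi raddfD. Qed.

Lemma gr_pi_eq p q :
  gr_pi p = gr_pi q <-> forall i, fil_prev i ((val p)`_i - (val q)`_i).
Proof.
rewrite /gr_pi; split=> [/eqP|h].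
  rewrite -Quotient.idealrBE => /asboolP h i.
  by have := h i; rewrite raddfB coefB.
apply/eqP; rewrite -Quotient.idealrBE; apply/asboolP => i.
by rewrite raddfB coefB; exact: h.
Qed.

Lemma rees_coef (p : rees) i : F i (val p)`_i.
Proof. by have /asboolP := valP p; exact. Qed.

Lemma gr_pi_mul p p' q q' :
  gr_pi p = gr_pi p' -> gr_pi q = gr_pi q' -> gr_pi (p * q) = gr_pi (p' * q').
Proof.
move=> /gr_pi_eq hp /gr_pi_eq hq; apply/gr_pi_eq => i.
rewrite !rmorphM !coefM -sumrB; apply: prev_sum => k.
set a := (val p)`_k; set b := (val q)`_(i - k).
set a' := (val p')`_k; set b' := (val q')`_(i - k).
have -> : a * b - a' * b' = a * (b - b') + (a - a') * b'.
  by rewrite mulrBr mulrBl addrA subrK.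
rewrite -(subnKC (ltn_ord k : (k <= i)%N)).
apply: prevD; first by apply: prevMl; [exact: rees_coef | exact: hq].
by apply: prevMr; [exact: hp | exact: rees_coef].
Qed.

Definition gr_one : gr := gr_pi 1.
Definition gr_mul (x y : gr) : gr := gr_pi (repr x * repr y).

Lemma gr_piM p q : gr_pi (p * q) = gr_mul (gr_pi p) (gr_pi q).
Proof. by apply: gr_pi_mul; rewrite /gr_pi reprK. Qed.

Lemma gr_mulA : associative gr_mul.
Proof.
move=> x y z; case: (gr_piK x) (gr_piK y) (gr_piK z) => p -> [q ->] [r ->].
by rewrite -!gr_piM mulrA.
Qed.

Lemma gr_mul1 : left_id gr_one gr_mul.
Proof. by move=> x; case: (gr_piK x) => p ->; rewrite -gr_piM mul1r. Qed.

Lemma gr_mul1r : right_id gr_one gr_mul.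
Proof. by move=> x; case: (gr_piK x) => p ->; rewrite -gr_piM mulr1. Qed.

Lemma gr_mulDl : left_distributive gr_mul +%R.
Proof.
move=> x y z; case: (gr_piK x) (gr_piK y) (gr_piK z) => p -> [q ->] [r ->].
by rewrite -gr_piD -!gr_piM mulrDl gr_piD.
Qed.

Lemma gr_mulDr : right_distributive gr_mul +%R.
Proof.
move=> x y z; case: (gr_piK x) (gr_piK y) (gr_piK z) => p -> [q ->] [r ->].
by rewrite -gr_piD -!gr_piM mulrDr gr_piD.
Qed.

Lemma gr_one_neq0 : gr_one != 0.
Proof.
have -> : 0 = gr_pi 0 by rewrite /gr_pi raddf0.
apply/eqP => /gr_pi_eq /(_ 0%N).
by rewrite rmorph1 raddf0 coef1 coef0 subr0 /= => /eqP; rewrite oner_eq0.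
Qed.

HB.instance Definition _ := GRing.Zmodule_isNzRing.Build gr
  gr_mulA gr_mul1 gr_mul1r gr_mulDl gr_mulDr gr_one_neq0.

Lemma rees_scale_subproof (c : K) (p : rees) : c%:A *: val p \in rees_pred.
Proof.
by apply/asboolP => i; rewrite coefZ mulr_algl; apply: filZ; exact: rees_coef.
Qed.

Definition rees_scale c p : rees := Rees (rees_scale_subproof c p).

Definition gr_scale (c : K) (x : gr) : gr := gr_pi (rees_scale c (repr x)).

Lemma gr_piZ c p : gr_pi (rees_scale c p) = gr_scale c (gr_pi p).
Proof.
have : gr_pi p = gr_pi (repr (gr_pi p)) by rewrite /gr_pi reprK.
move/gr_pi_eq => h; apply/gr_pi_eq => i.
by rewrite !coefZ -mulrBr mulr_algl; apply: prevZ; exact: h.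
Qed.

Lemma gr_scaleA a b x : gr_scale a (gr_scale b x) = gr_scale (a * b) x.
Proof.
case: (gr_piK x) => p ->; rewrite -!gr_piZ; congr gr_pi; apply: val_inj => /=.
by rewrite scalerA mulr_algl scalerA.
Qed.

Lemma gr_scale1 : left_id 1 gr_scale.
Proof.
move=> x; case: (gr_piK x) => p ->; rewrite -gr_piZ; congr gr_pi.
by apply: val_inj => /=; rewrite !scale1r.
Qed.

Lemma gr_scaleDr : right_distributive gr_scale +%R.
Proof.
move=> c x y; case: (gr_piK x) (gr_piK y) => p -> [q ->].
rewrite -gr_piD -!gr_piZ -gr_piD; congr gr_pi; apply: val_inj => /=.
by rewrite scalerDr.
Qed.

Lemma gr_scaleDl x : {morph gr_scale^~ x : a b / a + b}.
Proof.
move=> a b; case: (gr_piK x) => p ->; rewrite -!gr_piZ -gr_piD; congr gr_pi.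
by apply: val_inj => /=; rewrite !scalerDl.
Qed.

HB.instance Definition _ := GRing.Zmodule_isLmodule.Build K gr
  gr_scaleA gr_scale1 gr_scaleDr gr_scaleDl.

Lemma gr_scaleAl (c : K) (x y : gr) : c *: (x * y) = (c *: x) * y.
Proof.
case: (gr_piK x) (gr_piK y) => p -> [q ->].
change (gr_scale c (gr_mul (gr_pi p) (gr_pi q)) =
        gr_mul (gr_scale c (gr_pi p)) (gr_pi q)).
rewrite -gr_piM -!gr_piZ -gr_piM; congr gr_pi; apply: val_inj => /=.
by rewrite scalerAl.
Qed.

HB.instance Definition _ := GRing.Lmodule_isLalgebra.Build K gr gr_scaleAl.

Lemma gr_scaleAr (c : K) (x y : gr) : c *: (x * y) = x * (c *: y).
Proof.
case: (gr_piK x) (gr_piK y) => p -> [q ->].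
change (gr_scale c (gr_mul (gr_pi p) (gr_pi q)) =
        gr_mul (gr_pi p) (gr_scale c (gr_pi q))).
rewrite -gr_piM -!gr_piZ -gr_piM; congr gr_pi; apply: val_inj => /=.
apply/polyP => i; rewrite coefZ !coefM mulr_sumr; apply: eq_bigr => k _.
by rewrite coefZ !mulr_algl scalerAr.
Qed.

HB.instance Definition _ := GRing.Lalgebra_isAlgebra.Build K gr gr_scaleAr.

(* The class in A_i / A_(i-1) of an element a of A_i (junk value 0 when a is
   not in A_i). *)
Definition symb (i : nat) (a : A) : gr := gr_pi (insubd 0 (a *: 'X^i)).

Lemma symb_rees i a : F i a -> val (insubd (0 : rees) (a *: 'X^i)) = a *: 'X^i.
Proof.
move=> Fa; rewrite val_insubd ifT //; apply/asboolP => j.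
by rewrite coefZ coefXn; case: eqP => [->|_]; rewrite ?mulr1 // mulr0; exact: fil0.
Qed.

Lemma symb_eq i a b :
  F i a -> F i b -> (symb i a = symb i b <-> fil_prev i (a - b)).
Proof.
move=> Fa Fb; split=> [/gr_pi_eq /(_ i)|h].
  by rewrite !symb_rees // !coefZ coefXn eqxx !mulr1.
apply/gr_pi_eq => j; rewrite !symb_rees // !coefZ coefXn.
by case: eqP => [->|_]; rewrite ?mulr1 // !mulr0 subr0; exact: prev0.
Qed.

Lemma symbM i j a b :
  F i a -> F j b -> symb i a * symb j b = symb (i + j) (a * b).
Proof.
move=> Fa Fb; change (gr_mul (symb i a) (symb j b) = symb (i + j) (a * b)).
rewrite /symb -gr_piM; congr gr_pi; apply: val_inj.
transitivity (val (insubd (0 : rees) (a *: 'X^i)) *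
              val (insubd (0 : rees) (b *: 'X^j))); first by rewrite rmorphM.
rewrite !symb_rees //; last exact: fil_mul.
rewrite -!mul_polyC exprD polyCM -!mulrA; congr (_ * _).
by rewrite mulrA -(commr_polyXn b%:P) mulrA.
Qed.

(* For a subalgebra B of A with the induced filtration B_i = B /\ A_i one has
   B_i / B_(i-1) included in A_i / A_(i-1); gr B is identified with the
   corresponding subalgebra of gr A, and gr_i B with its degree i component. *)
Definition gr_sub (B : set A) : set gr :=
  [set x | exists p : rees, (forall i, B (val p)`_i) /\ x = gr_pi p].

Definition gr_sub_comp (B : set A) (i : nat) : set gr :=
  [set symb i a | a in B `&` F i].

End AssociatedGraded.

Arguments gr_sub {K A} F B%_classical_set_scope _.
Arguments gr_sub_comp {K A} F B%_classical_set_scope i%_nat_scope _.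

Section TriangularStructures.
Variables (K : fieldType) (A : algType K).
Variables (G : int -> set A) (Ap Am : set A) (delta : A).

Record triangular : Prop := Triangular {
  tri_Ap : graded_subalg G Ap;
  tri_Am : graded_subalg G Am;
  tri_T0 : fg_bimodule Ap Am;
  tri_T1 : forall (m : int) (a : A), G m a -> delta * a - a * delta = a *~ m;
  tri_T2_fg : fg_subalg Ap /\ fg_subalg Am;
  tri_T2_pos : forall m : int, (m < 0)%R -> homog G Ap m = [set 0];
  tri_T2_neg : forall m : int, (0 < m)%R -> homog G Am m = [set 0];
  tri_T2_zero : homog G Ap 0 = range (fun c : K => c%:A) /\
                homog G Am 0 = range (fun c : K => c%:A)
}.

Record commutative_triangular : Prop := CommutativeTriangular {
  ctri_triangular : triangular;
  ctri_Ap : commutative_on Ap;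
  ctri_Am : commutative_on Am
}.

Record noncommutative_triangular (F : filtration A) : Prop :=
  NoncommutativeTriangular {
  nctri_triangular : triangular;
  nctri_T0' : fg_bimodule (gr_sub F Ap) (gr_sub F Am);
  nctri_T1' : F 1%N delta /\
    forall x : gr F, symb F 1 delta * x = x * symb F 1 delta;
  nctri_T3 : commutative_on (gr_sub F Ap) /\ commutative_on (gr_sub F Am);
  nctri_T4_gen :
    gr_sub F Ap = gen_subalg (gr_sub_comp F Ap 0 `|` gr_sub_comp F Ap 1) /\
    gr_sub F Am = gen_subalg (gr_sub_comp F Am 0 `|` gr_sub_comp F Am 1);
  nctri_T4_dim : forall i : nat,
    fin_dim (gr_sub_comp F Ap i) /\ fin_dim (gr_sub_comp F Am i)
}.

(* The sum of the A^-(-m), m > 0. *)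
Definition Am_bar : set A := sum_of (fun m => (m < 0)%R) (homog G Am).

End TriangularStructures.

Section Modules.
Variable A : nzRingType.

Definition zero_module (M : lmodType A) : Prop := forall x : M, x = 0.

Definition fg_module (M : lmodType A) : Prop :=
  exists s : seq M, forall x : M,
    exists c : 'I_(size s) -> A, x = \sum_i c i *: s`_i.

Definition simple_module (M : lmodType A) : Prop :=
  ~ zero_module M /\
  forall N : set M, submod_closed [in N] -> N = [set 0] \/ N = setT.

Definition annihilator (M : lmodType A) : set A :=
  [set a | forall x : M, a *: x = 0].

Definition locally_nilpotent_on (B : set A) (M : lmodType A) : Prop :=
  forall x : M, exists2 n : nat, (0 < n)%N &
    forall a : 'I_n -> A, (forall i, B (a i)) -> (\prod_(i < n) a i) *: x = 0.

End Modules.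

Section CategoryO.
Variables (K : fieldType) (A : algType K) (G : int -> set A) (Am : set A).

Definition in_catO (M : lmodType A) : Prop :=
  fg_module M /\ locally_nilpotent_on (Am_bar G Am) M.

(* Simplicity inside the category: a nonzero object whose only subobjects are
   zero and the whole object. *)
Definition simple_in_catO (M : lmodType A) : Prop :=
  [/\ in_catO M, ~ zero_module M &
    forall (N : lmodType A) (f : {linear N -> M}),
      in_catO N -> injective f ->
      zero_module N \/ forall x : M, exists y : N, f y = x].

End CategoryO.

Section Ideals.
Variable A : nzRingType.
Implicit Types I J L : set A.

Record two_sided_ideal I : Prop := TwoSidedIdeal {
  ideal0 : I 0;
  idealD : forall x y, I x -> I y -> I (x + y);
  idealMl : forall a x, I x -> I (a * x);
  idealMr : forall a x, I x -> I (x * a)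
}.

Definition proper_two_sided_ideal I : Prop := two_sided_ideal I /\ I <> setT.

Definition ideal_mul I J : set A :=
  [set x | exists (n : nat) (a b : 'I_n -> A),
     [/\ forall i, I (a i), forall i, J (b i) & x = \sum_(i < n) a i * b i]].

Definition primitive_ideal I : Prop :=
  proper_two_sided_ideal I /\
  exists2 M : lmodType A, simple_module M & I = annihilator M.

Definition prime_two_sided_ideal I : Prop :=
  proper_two_sided_ideal I /\
  forall J L, two_sided_ideal J -> two_sided_ideal L ->
    ideal_mul J L `<=` I -> J `<=` I \/ L `<=` I.

(* A has a composition series as a module over the tensor product of A with
   its opposite: the submodules of A are its two-sided ideals. *)
Definition finite_bimodule_length : Prop :=
  exists (n : nat) (J : nat -> set A),
    [/\ forall i, (i <= n)%N -> two_sided_ideal (J i),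
        J 0%N = [set 0], J n = setT &
        forall i, (i < n)%N ->
          [/\ J i `<=` J i.+1, J i <> J i.+1 &
            forall L, two_sided_ideal L -> J i `<=` L -> L `<=` J i.+1 ->
              L = J i \/ L = J i.+1]].

End Ideals.

(* Main.v *)
(** Write [E v = delta v + v delta], and let [D_M] be the span of the [b v c]
    with [b] of degree [m1], [c] of degree [-m2] and [m1 + m2 >= M].  Two facts
    about ideals [I <= J] carry the proof.

    Separation: if [J <= I + D_M] for every [M], then [J <= I].  An element of
    [J] outside [I] is detected by a functional [f] killing [I] whose growth
    along words [x_1 ... x_n] in the letters [v |-> b v c] is so slow (a
    factorial of a proper fraction of the degree) that the flow [exp(-E)] can be
    run on [f].  Since [E] shifts every letter [x_k] by its degree, [n] steps of
    the flow multiply the values of [f] on words of degree [>= M] by at most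
    [C^n q^(nM)]; running the flow back on the generators of [J], which lie in
    [I + D_M] for large [M], shows that [f] vanishes on them.

    Uniformity: there is [M0] such that [J <= I + D_M0] already forces
    [J <= I + D_M] for every [M].  Indeed some [p(E)] maps [J] into
    [A(>0) J + J A(<0)], some [b(E - j)] maps [D_j] into [D_(j+1)], and [p] is
    prime to [b(X - j)] for large [j].

    Hence ideals are separated by their images in the finite dimensional space
    [A / D_M0], which bounds the length of [A].  If [I] is prime, then [I] is
    the annihilator of [A / (I + A A(<= -M0))], an object of finite length of
    the category O, so it annihilates one of its simple subquotients. *)

From HB Require Import structures.
Require Import Defs.
From mathcomp Require Import all_boot all_order all_algebra.
From mathcomp Require Import boolp classical_sets functions reals complex.
From mathcomp Require Import topology normedtype sequences exp.
From mathcomp Require Import ring lra zify.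

Set Implicit Arguments.
Unset Strict Implicit.
Unset Printing Implicit Defensive.

Import Order.TTheory GRing.Theory Num.Theory.
Import numFieldNormedType.Exports.
Local Open Scope classical_set_scope.
Local Open Scope ring_scope.
Local Open Scope quotient_scope.

(** The obstacle is that E is not locally finite modulo I: each application may append a letter, so
    E^j w contains words of length j, and the series of f(E^j v) / j! diverges for a general f.
    Hence the need for slow growth. Give a letter of degree d the weight S - d, where S exceeds all
    degrees. A commutator adds degrees, so it lowers the weight by exactly S; a word of n letters
    has weight at most (S - 1) n and undergoes at most (1 - 1/S) n commutators, each costing a
    factor of order n. The product is absorbed by j!. The bounds must also be uniform in the number
    of flow steps. Letters appended at step k are already damped by q^k, so together they act like a
    flow of bounded duration, a geometric series; what remains is a factor C^n, beaten by q^(nM)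
    once M is large. All this needs E to append at most one letter to suitable generators, of A and
    of J alike. For A this decides the choice of letters; for J it is an Artin-Rees statement about
    the traces on J of a filtration of A. *)

Local Notation normc := Normc.normc.

(** * Subspaces and polynomials in an operator *)

Section Subspaces.
Variables (K : fieldType) (V : lmodType K).
Implicit Types (U W S : set V).

Definition subsp (W : set V) : Prop := submod_closed [in W].

Lemma subspP W : W 0 -> (forall a u v, W u -> W v -> W (a *: u + v)) -> subsp W.
Proof.
move=> W0 WD; split; first by rewrite inE.
by move=> a u v; rewrite !inE; exact: WD.
Qed.

Lemma subsp0 W : subsp W -> W 0. Proof. by case; rewrite inE. Qed.

Lemma subspZD W : subsp W -> forall a u v, W u -> W v -> W (a *: u + v).
Proof. by case=> _ h a u v Wu Wv; have := h a u v; rewrite !inE => /(_ Wu Wv). Qed.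

Lemma subspD W : subsp W -> forall u v, W u -> W v -> W (u + v).
Proof. by move=> h u v Wu Wv; rewrite -[u]scale1r; exact: subspZD. Qed.

Lemma subspZ W : subsp W -> forall a u, W u -> W (a *: u).
Proof.
by move=> h a u Wu; rewrite -[a *: u]addr0; apply: subspZD => //; exact: subsp0.
Qed.

Lemma subspB W : subsp W -> forall u v, W u -> W v -> W (u - v).
Proof. by move=> h u v Wu Wv; rewrite addrC -scaleN1r; exact: subspZD. Qed.

Lemma subsp_sum W : subsp W ->
  forall (I : Type) (r : seq I) (P : pred I) (F : I -> V),
  (forall i, P i -> W (F i)) -> W (\sum_(i <- r | P i) F i).
Proof.
by move=> h I r P F WF; elim/big_ind: _ => //; [exact: subsp0 | exact: subspD].
Qed.

Lemma subsp_sum_seq W : subsp W ->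
  forall (I : eqType) (r : seq I) (F : I -> V), (forall i, i \in r -> W (F i)) -> W (\sum_(i <- r) F i).
Proof. by move=> h I r F WF; rewrite big_seq; exact: subsp_sum. Qed.

Lemma subspDr W : subsp W -> forall u v, W v -> W (u + v) -> W u.
Proof. by move=> h u v Wv /(subspB h) /(_ Wv); rewrite addrK. Qed.

Lemma subsp_span S : subsp (lin_span S).
Proof.
apply: subspP => [W [hW _]|a u v hu hv W hW]; first exact: subsp0.
by apply: subspZD; [case: hW | exact: hu | exact: hv].
Qed.

Lemma span_sub S : S `<=` lin_span S.
Proof. by move=> x Sx W [_]; exact. Qed.

Lemma span_min S W : subsp W -> S `<=` W -> lin_span S `<=` W.
Proof. by move=> hW SW x; apply; split. Qed.

Lemma span_mono S S' : S `<=` S' -> lin_span S `<=` lin_span S'.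
Proof.
by move=> SS; apply: span_min; [exact: subsp_span | move=> x /SS; exact: span_sub].
Qed.

Lemma subsp1 : subsp [set 0 : V].
Proof. by apply: subspP => // a u v -> ->; rewrite scaler0 addr0. Qed.

Lemma subspT : subsp (setT : set V). Proof. exact: subspP. Qed.

Lemma subspI U W : subsp U -> subsp W -> subsp (U `&` W).
Proof.
move=> hU hW; apply: subspP; first by split; exact: subsp0.
by move=> a u v [? ?] [? ?]; split; exact: subspZD.
Qed.

Definition addsp U W : set V := [set v | exists u w, [/\ U u, W w & v = u + w]].

Lemma subsp_add U W : subsp U -> subsp W -> subsp (addsp U W).
Proof.
move=> hU hW; apply: subspP.
  by exists 0, 0; rewrite addr0; split=> //; exact: subsp0.
move=> a _ _ [u [w [Uu Ww ->]]] [u' [w' [Uu' Ww' ->]]].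
exists (a *: u + u'), (a *: w + w'); split; try exact: subspZD.
by rewrite scalerDr addrACA.
Qed.

Lemma addspl U W : subsp W -> U `<=` addsp U W.
Proof. by move=> hW u Uu; exists u, 0; rewrite addr0; split=> //; exact: subsp0. Qed.

Lemma addspr U W : subsp U -> W `<=` addsp U W.
Proof. by move=> hU u Uu; exists 0, u; rewrite add0r; split=> //; exact: subsp0. Qed.

Lemma addsp_min U W X : subsp X -> U `<=` X -> W `<=` X -> addsp U W `<=` X.
Proof. by move=> hX UX WX _ [u [w [/UX ? /WX ? ->]]]; exact: subspD. Qed.

Lemma span_family Z (T : eqType) (P : T -> Prop) (e : T -> V) v : subsp Z ->
  lin_span (Z `|` [set e t | t in P]) v ->
  exists z (s : seq T) (c : T -> K), [/\ Z z, uniq s, (forall t, t \in s -> P t)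
    & v = z + \sum_(t <- s) c t *: e t].
Proof.
(* Demanding that [c] vanish off [s] lets two such expressions be brought to a common support and
   added. *)
move=> hZ; pose Q v := exists z (s : seq T) (c : T -> K),
  [/\ Z z, uniq s, (forall t, t \in s -> P t), (forall t, t \notin s -> c t = 0)
    & v = z + \sum_(t <- s) c t *: e t].
suff : lin_span (Z `|` [set e t | t in P]) `<=` Q.
  by move=> h /h [z [s [c [? ? ? _ ?]]]]; exists z, s, c.
apply: span_min.
  apply: subspP; first by exists 0, [::], (fun=> 0);
    rewrite big_nil addr0; split=> //; exact: subsp0.
  move=> a _ _ [z [s [c [Zz us Ps cs ->]]]] [z' [s' [c' [Zz' us' Ps' cs' ->]]]].
  have ext (q q' : seq T) (d : T -> K) : uniq q -> uniq q' -> {subset q <= q'} ->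
      (forall t, t \notin q -> d t = 0) ->
      \sum_(t <- q) d t *: e t = \sum_(t <- q') d t *: e t.
    move=> uq uq' qq dq; rewrite [RHS](bigID (mem q)) /=.
    rewrite [X in _ + X]big1 ?addr0; last by move=> t /dq ->; rewrite scale0r.
    rewrite -[RHS]big_filter; apply: perm_big; apply: uniq_perm => //.
      exact: filter_uniq.
    move=> t; rewrite mem_filter; case: (boolP (t \in q)) => //= tq.
    by rewrite qq.
  pose s2 := undup (s ++ s').
  have ss2 : {subset s <= s2} by move=> t ts; rewrite mem_undup mem_cat ts.
  have ss2' : {subset s' <= s2} by move=> t ts; rewrite mem_undup mem_cat ts orbT.
  exists (a *: z + z'), s2, (fun t => a * c t + c' t).
  split; [exact: subspZD | exact: undup_uniq | | |].
  - by move=> t; rewrite mem_undup mem_cat => /orP[/Ps|/Ps'].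
  - move=> t; rewrite mem_undup mem_cat negb_or => /andP[/cs -> /cs' ->].
    by rewrite mulr0 addr0.
  rewrite (ext s s2) ?undup_uniq // (ext s' s2) ?undup_uniq //.
  rewrite scalerDr addrACA; congr (_ + _).
  rewrite scaler_sumr -big_split /=; apply: eq_bigr => t _.
  by rewrite scalerDl scalerA.
move=> x [Zx|[t Pt <-]].
  by exists x, [::], (fun=> 0); rewrite big_nil addr0.
exists 0, [:: t], (fun t' => (t' == t)%:R); split=> //; first exact: subsp0.
- by move=> t'; rewrite inE => /eqP ->.
- by move=> t'; rewrite inE => /negbTE ->.
- by rewrite big_seq1 eqxx scale1r add0r.
Qed.

(** [U] has codimension one, so the coefficient of [e] modulo [U] is unique, and uniqueness alone
    makes it linear; no basis of the space is chosen. *)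
Lemma functional U (e : V) : subsp U -> ~ U e -> (forall v, exists a, U (v - a *: e)) ->
  exists f : {linear V -> K^o}, (forall v, U v -> f v = 0) /\ f e = 1.
Proof.
move=> hU Ue /choice[f hf].
have f_uniq v a : U (v - a *: e) -> f v = a.
  move=> h; apply/eqP; rewrite -subr_eq0; apply/negP => /negP fa; apply: Ue.
  have := subspB hU h (hf v); rewrite opprB addrC subrKA -scalerBl => /(subspZ hU (f v - a)^-1).
  by rewrite scalerA mulVf // scale1r.
have f_lin : linear (f : V -> K^o).
  move=> a u v; apply: f_uniq; have := subspZD hU a (hf u) (hf v).
  by rewrite scalerBr addrACA -opprD scalerA -scalerDl.
pose F : {linear V -> K^o} := HB.pack (f : V -> K^o) (GRing.isLinear.Build _ _ _ _ _ f_lin).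
exists F; split=> [v Uv|] /=; apply: f_uniq; first by rewrite scale0r subr0.
by rewrite scale1r subrr; exact: subsp0.
Qed.

End Subspaces.

Lemma subsp_preim (K : fieldType) (V V' : lmodType K) (f : {linear V' -> V})
  (W : set V) : subsp W -> subsp (f @^-1` W).
Proof.
move=> hW; apply: subspP => /=; first by rewrite raddf0; exact: subsp0.
by move=> a u v Wu Wv; rewrite linearP; exact: subspZD.
Qed.

Section PolyOperator.
Variables (K : fieldType) (V : lmodType K) (T : {linear V -> V}).
Implicit Types (p q : {poly K}) (v : V).

Definition pev p v : V := \sum_(i < size p) p`_i *: iter i T v.

Lemma iter_linear n : linear (iter n T).
Proof. by elim: n => [|n IH] a u v //=; rewrite IH linearP. Qed.

Lemma pev_wide n p v : (size p <= n)%N -> pev p v = \sum_(i < n) p`_i *: iter i T v.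
Proof.
move=> pn; rewrite -(subnKC pn) big_split_ord /= [X in _ = _ + X]big1 ?addr0 //.
by move=> i _; rewrite nth_default ?scale0r ?leq_addr.
Qed.

Lemma pev_is_linear p : linear (pev p).
Proof.
move=> a u v; rewrite /pev scaler_sumr -big_split; apply: eq_bigr => i _ /=.
by rewrite iter_linear scalerDr !scalerA mulrC.
Qed.

HB.instance Definition _ p := GRing.isLinear.Build K V V _ (pev p) (pev_is_linear p).

Lemma pevD p q v : pev (p + q) v = pev p v + pev q v.
Proof.
pose n := maxn (size p) (size q).
rewrite (@pev_wide n (p + q)) ?size_polyD // (@pev_wide n p) ?leq_maxl //.
rewrite (@pev_wide n q) ?leq_maxr // -big_split; apply: eq_bigr => i _ /=.
by rewrite coefD scalerDl.
Qed.

Lemma pevZ a p v : pev (a *: p) v = a *: pev p v.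
Proof.
rewrite (@pev_wide (size p)) ?size_scale_leq // scaler_sumr.
by apply: eq_bigr => i _; rewrite coefZ scalerA.
Qed.

Lemma pevC a v : pev a%:P v = a *: v.
Proof.
by rewrite (@pev_wide 1) ?size_polyC_leq1 // big_ord1 coefC.
Qed.

Lemma pev0 v : pev 0 v = 0. Proof. by rewrite pevC scale0r. Qed.
Lemma pev1 v : pev 1 v = v. Proof. by rewrite pevC scale1r. Qed.

Lemma pevMX p v : pev (p * 'X) v = T (pev p v).
Proof.
rewrite (@pev_wide (size p).+1); last first.
  by apply: leq_trans (size_polyMleq _ _) _; rewrite size_polyX addn2.
rewrite big_ord_recl coefMX scale0r add0r linear_sum.
by apply: eq_bigr => i _; rewrite coefMX /= linearZ.
Qed.

Lemma pevX v : pev 'X v = T v.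
Proof. by rewrite -['X]mul1r pevMX pev1. Qed.

Lemma pev_sum (I : Type) (r : seq I) (P : pred I) (F : I -> {poly K}) v :
  pev (\sum_(i <- r | P i) F i) v = \sum_(i <- r | P i) pev (F i) v.
Proof. by elim/big_rec2: _ => [|i y1 y2 _ <-]; rewrite ?pev0 ?pevD. Qed.

Lemma pevMn p n v : pev (p *+ n) v = pev p v *+ n.
Proof. by elim: n => [|n IH]; rewrite ?mulr0n ?pev0 // !mulrS pevD IH. Qed.

Lemma pevM p q v : pev (p * q) v = pev p (pev q v).
Proof.
elim/poly_ind: p => [|p a IH]; first by rewrite mul0r !pev0.
by rewrite mulrDl pevD mulrAC pevMX IH mul_polyC pevZ pevD pevMX pevC.
Qed.

Lemma pev_stable (W : set V) p v : subsp W -> (forall w, W w -> W (T w)) ->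
  W v -> W (pev p v).
Proof.
move=> hW TW Wv; apply: (subsp_sum hW) => i _; apply: (subspZ hW).
by elim: (i : nat) => //= n; exact: TW.
Qed.

End PolyOperator.

(** * Ordering words in graded letters *)

Section Words.
Variables (L : finType) (key : L -> nat) (key_inj : injective key).

Definition lle : rel L := relpre key leq.
Definition tot (f : L -> nat) (s : seq L) : nat := sumn [seq f l | l <- s].

Lemma lle_trans : transitive lle.
Proof. by move=> y x z; exact: leq_trans. Qed.
Lemma lle_total : total lle.
Proof. by move=> x y; exact: leq_total. Qed.
Lemma lle_anti : antisymmetric lle.
Proof. by move=> x y; rewrite /lle /= -eqn_leq => /eqP /key_inj. Qed.

Lemma tot_cons f l s : tot f (l :: s) = (f l + tot f s)%N. Proof. by []. Qed.
Lemma tot_cat f s t : tot f (s ++ t) = (tot f s + tot f t)%N.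
Proof. by rewrite /tot map_cat sumn_cat. Qed.
Lemma tot_perm f s t : perm_eq s t -> tot f s = tot f t.
Proof. by move=> st; rewrite /tot; apply: perm_sumn; exact: perm_map. Qed.
Lemma tot_sort f s : tot f (sort lle s) = tot f s.
Proof. by apply: tot_perm; rewrite perm_sort. Qed.
Lemma size_tot f s : (forall l, 0 < f l)%N -> (size s <= tot f s)%N.
Proof. by move=> f0; elim: s => //= l s IH; rewrite tot_cons -add1n leq_add. Qed.

Lemma sort_eq s t : sorted lle s -> perm_eq s t -> sort lle t = s.
Proof.
move=> ss st; apply: (sorted_eq lle_trans lle_anti) => //.
  exact: sort_sorted lle_total _.
by rewrite perm_sort perm_sym.
Qed.

Lemma sorted_cons l s : sorted lle (l :: s) = all (lle l) s && sorted lle s.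
Proof. by rewrite /= path_sortedE //; exact: lle_trans. Qed.

Lemma sort_cons_sorted k (s : seq L) :
  all (lle k) s -> sorted lle s -> sort lle (k :: s) = k :: s.
Proof.
by move=> ks ss; apply: sort_eq => //; rewrite sorted_cons ks.
Qed.

Lemma sort_swap k (b : L) (s : seq L) : (key b < key k)%N ->
  sorted lle (b :: s) -> sort lle (k :: b :: s) = b :: sort lle (k :: s).
Proof.
rewrite sorted_cons => bk /andP[bs ss]; apply: sort_eq.
  rewrite sorted_cons sort_sorted ?andbT; last exact: lle_total.
  by rewrite all_sort /= bs andbT; exact: ltnW.
apply/permP => p /=; rewrite (permP (permEl (perm_sort lle _))) /=; lia.
Qed.

End Words.

(** * The cost of sorting a word *)

Section Insertion.
Variables (K : numFieldType) (V : lmodType K) (L : finType).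
Variables (key o : L -> nat) (S : nat) (X : L -> {linear V -> V}).
Variables (c : L -> L -> L -> K) (mu y : K) (n : nat).
Hypothesis key_inj : injective key.
Hypothesis o_gt0 : forall l, (0 < o l)%N.
Hypothesis Xcomm : forall i j v,
  X i (X j v) = X j (X i v) + \sum_k c i j k *: X k v.
(** A commutator lowers the total weight [o] by exactly [S], which bounds the number of commutators.
    By [c_key] the letter that it creates is larger than both of its parents, so a lower bound on
    keys survives. *)
Hypothesis c_o : forall i j k, c i j k != 0 -> (o k + S = o i + o j)%N.
Hypothesis c_key : forall i j k, c i j k != 0 -> (key i < key k)%N && (key j < key k)%N.
Hypothesis y_ge0 : 0 <= y.
Hypothesis mu_ge0 : 0 <= mu.
Hypothesis mu_le1 : mu <= 1.
Hypothesis ny : n%:R * y <= 1.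
Hypothesis c_small : forall i j, \sum_k `|c i j k| <= mu / 2.

Local Notation lle := (lle key).
Local Notation word := (seq L).
Implicit Types (a b : word) (f : {linear V -> K^o}) (lam : K).

Definition wact (w : word) (v : V) : V := foldr (fun l => X l) v w.

Lemma wact_cat a b v : wact (a ++ b) v = wact a (wact b v).
Proof. by rewrite /wact foldr_cat. Qed.

(* f is bounded on the sorted words that arise from a word of weight O after
   j >= j0 commutations. *)
Definition low f v (j0 O : nat) (lo : nat) lam : Prop :=
  forall b j, sorted lle b -> all (fun l => lo <= key l)%N b ->
    (j0 <= j)%N -> (tot o b + j * S = O)%N -> `|f (wact b v)| <= lam * y ^+ j.

Lemma size_mul_y (s : word) : (tot o s <= n)%N -> (size s)%:R * y <= 1.
Proof.
move=> sn; apply: le_trans ny; apply: ler_wpM2r => //.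
by rewrite ler_nat; apply: leq_trans sn; exact: size_tot.
Qed.

Lemma lowS f v O O' lo lam : (O' + S)%N = O ->
  low f v 1 O lo lam -> low f v 0 O' lo (lam * y).
Proof.
move=> OO h b j sb lb _ e; rewrite -mulrA -exprS; apply: h => //.
by rewrite -OO -e; lia.
Qed.

Lemma low_weak f v j0 j1 O lo lam : (j0 <= j1)%N ->
  low f v j0 O lo lam -> low f v j1 O lo lam.
Proof. by move=> jj h b j sb lb ij; apply: h => //; exact: leq_trans ij. Qed.

(** Prepending [k] keeps a word sorted only when its letters have keys at least [key k]. This is why
    [low] carries the bound [lo], which rises whenever a letter is absorbed into the functional. *)
Lemma low_comp f v k j0 O lo lam : (o k <= O)%N -> (lo <= key k)%N ->
  low f v j0 O lo lam ->
  low (f \o X k : {linear V -> K^o}) v j0 (O - o k) (key k) lam.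
Proof.
move=> kO lok h b j sb lb jj e; apply: (h (k :: b)) => //.
- by rewrite sorted_cons; apply/andP.
- by apply/andP; split=> //; apply: sub_all lb => l; exact: leq_trans.
- by rewrite tot_cons; lia.
Qed.

(* Each swap costs one commutator, and the swaps are at most n while n * y <= 1. *)
Definition insertable a := forall f v k O lo lam, sorted lle a ->
  all (fun l => lo <= key l)%N (k :: a) -> (o k + tot o a = O)%N -> (O <= n)%N ->
  0 <= lam -> low f v 1 O lo lam ->
  `|f (wact (k :: a) v) - f (wact (sort lle (k :: a)) v)|
    <= lam * mu * ((size a)%:R * y).

(** The word [l :: a] has weight [O - S], so its sorted form contributes at most [lam * y], and the
    error of inserting [l] is at most [lam * y] as well. The resulting factor 2 is what the bound
    [mu / 2] on the structure constants is made for. *)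
Lemma commutator_bound a f v k (b : L) O lo lam : insertable a ->
  sorted lle a -> all (fun l => lo <= key l)%N (k :: a) ->
  (o k + o b + tot o a = O)%N -> (O <= n)%N ->
  0 <= lam -> low f v 1 O lo lam ->
  `|f (\sum_l c k b l *: X l (wact a v))| <= lam * mu * y.
Proof.
move=> ins sa /andP[lok loa] eO On lam0 h.
have mua : (size a)%:R * y <= 1.
  by apply: size_mul_y; apply: leq_trans On; rewrite -eO leq_addl.
have h2 l : `|f (c k b l *: X l (wact a v))| <= `|c k b l| * (lam * y * 2).
  have [->|cl] := eqVneq (c k b l) 0.
    by rewrite scale0r raddf0 normr0 mul0r.
  rewrite linearZ normrM; apply: ler_wpM2l => //.
  have [ol /andP[kl bl]] := (c_o cl, c_key cl).
  have lol : all (fun i => lo <= key i)%N (l :: a).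
    by apply/andP; split=> //; exact: leq_trans lok (ltnW kl).
  have OS : (O - S + S = O)%N by rewrite subnK // -eO -ol -addnA addnC -addnA leq_addr.
  have eO' : (o l + tot o a = O - S)%N.
    by apply/eqP; rewrite -(eqn_add2r S) OS -eO -ol addnAC.
  have h0 : low f v 0 (O - S) lo (lam * y) by exact: lowS h.
  have h3 := ins f v l (O - S)%N lo (lam * y) sa lol eO'
    (leq_trans (leq_subr _ _) On) (mulr_ge0 lam0 y_ge0) (low_weak (leq0n _) h0).
  rewrite -[X l (wact a v)](addrNK (wact (sort lle (l :: a)) v)) raddfD raddfB /=.
  apply: le_trans (ler_normD _ _) _.
  rewrite mulrDr mulr1; apply: lerD.
    apply: le_trans h3 _; rewrite -mulrA -[leRHS]mulr1.
    apply: ler_wpM2l; first exact: mulr_ge0.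
    by apply: mulr_ile1; rewrite ?mulr_ge0.
  rewrite -[leRHS]mulr1 -(expr0 y); apply: h0 => //.
  - by apply: sort_sorted; exact: lle_total.
  - by rewrite all_sort.
  - by rewrite tot_sort tot_cons mul0n addn0.
rewrite raddf_sum; apply: le_trans (ler_norm_sum _ _ _) _.
apply: le_trans (ler_sum _ (fun l _ => h2 l)) _.
rewrite -mulr_suml; apply: le_trans (_ : mu / 2 * (lam * y * 2) <= _).
  by apply: ler_wpM2r => //; rewrite !mulr_ge0.
by rewrite le_eqVlt; apply/orP; left; apply/eqP; field.
Qed.

(** Insertion by adjacent swaps. After [k] is swapped with [b], the main term is the same problem
    for [f \o X b], and the commutator term is bounded by the induction hypothesis for [f] itself;
    hence the quantification over [f], [lo] and [lam] in [insertable]. *)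
Lemma insert_left a : insertable a.
Proof.
elim: a => [|b a IH] f v k O lo lam sa la eO On lam0 h.
  by rewrite (sort_eq key_inj (s := [:: k])) // subrr normr0 mul0r mulr0.
have [kb|bk] := leqP (key k) (key b).
  have ka : all (lle k) (b :: a).
    move: sa; rewrite sorted_cons => /andP[ba _]; apply/andP; split=> //.
    by apply: sub_all ba => l; exact: leq_trans.
  by rewrite (sort_cons_sorted key_inj) // subrr normr0 !mulr_ge0.
move: (sa); rewrite sorted_cons => /andP[ba sa'].
have /and3P[lok lob loa] := la.
rewrite (sort_swap key_inj) //.
rewrite tot_cons addnA in eO.
have obO : (o b <= O)%N by rewrite -eO addnAC leq_addl.
have eO' : (o k + tot o a = O - o b)%N by rewrite -eO addnAC addnK.
pose g : {linear V -> K^o} := f \o X b.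
have h1 : `|g (wact (k :: a) v) - g (wact (sort lle (k :: a)) v)|
    <= lam * mu * ((size a)%:R * y).
  apply: (IH _ _ _ (O - o b)%N (key b)) => //.
  - by apply/andP; split; [exact: ltnW | exact: ba].
  - exact: leq_trans (leq_subr _ _) On.
  - exact: low_comp h.
have h2 := commutator_bound IH sa' (introT andP (conj lok loa)) eO On lam0 h.
have -> : lam * mu * ((size (b :: a))%:R * y) =
   lam * mu * ((size a)%:R * y) + lam * mu * y by rewrite /= -natr1; ring.
rewrite /= Xcomm raddfD addrAC; apply: le_trans (ler_normD _ _) _.
exact: lerD.
Qed.

(** Here a small letter acts innermost and is pulled out through [b] to the front. The commutators
    arise to the left of sorted words, so [insert_left] bounds them. *)
Lemma insert_under b : forall f v (k : L) O lo lam, sorted lle b ->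
  all (lle k) b -> all (fun l => lo <= key l)%N b ->
  (o k + tot o b = O)%N -> (O <= n)%N ->
  0 <= lam -> low f v 1 O lo lam ->
  `|f (wact b (X k v)) - f (wact (k :: b) v)|
    <= lam * mu * ((size b)%:R * y).
Proof.
elim: b => [|b b' IH] f v k O lo lam sa ka la eO On lam0 h.
  by rewrite subrr normr0 mul0r mulr0.
move: (sa); rewrite sorted_cons => /andP[ba sa'].
have /andP[kb ka'] := ka; have /andP[lob lob'] := la.
rewrite tot_cons in eO.
pose g : {linear V -> K^o} := f \o X b.
have obO : (o b <= O)%N by rewrite -eO addnCA leq_addr.
have eO' : (o k + tot o b' = O - o b)%N by rewrite -eO addnCA addKn.
have h1 : `|g (wact b' (X k v)) - g (wact (k :: b') v)|
    <= lam * mu * ((size b')%:R * y).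
  apply: (IH _ _ _ (O - o b)%N (key b)) => //.
  - exact: leq_trans (leq_subr _ _) On.
  - exact: low_comp h.
have eO2 : (o b + o k + tot o b' = O)%N by rewrite -eO (addnC (o b)) addnA.
have h2 := @commutator_bound b' f v b k O lo lam (@insert_left b') sa' la eO2 On lam0 h.
have -> : lam * mu * ((size (b :: b'))%:R * y) =
   lam * mu * ((size b')%:R * y) + lam * mu * y by rewrite /= -natr1; ring.
have -> : f (wact (b :: b') (X k v)) - f (wact (k :: b :: b') v) =
  g (wact b' (X k v)) - g (wact (k :: b') v) +
  f (\sum_l c b k l *: X l (wact b' v)).
  have e : f (X b (X k (wact b' v))) =
    f (X k (X b (wact b' v))) + f (\sum_l c b k l *: X l (wact b' v)).
    by rewrite Xcomm raddfD.
  by rewrite /= e opprD addrA subrK.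
by apply: le_trans (ler_normD _ _) _; apply: lerD.
Qed.

Lemma insert_right b : forall f v (k : L) O lo lam, sorted lle b ->
  all (fun l => lo <= key l)%N b -> (o k + tot o b = O)%N -> (O <= n)%N ->
  0 <= lam -> low f v 1 O lo lam ->
  `|f (wact b (X k v)) - f (wact (sort lle (rcons b k)) v)|
    <= lam * mu * ((size b)%:R * y).
Proof.
elim: b => [|b b' IH] f v k O lo lam sa la eO On lam0 h.
  by rewrite subrr normr0 mul0r mulr0.
move: (sa); rewrite sorted_cons => /andP[ba sa'].
have /andP[lob lob'] := la.
rewrite tot_cons in eO.
have obO : (o b <= O)%N by rewrite -eO addnCA leq_addr.
have eO' : (o k + tot o b' = O - o b)%N by rewrite -eO addnCA addKn.
have [kb|bk] := leqP (key k) (key b).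
  have ka : all (lle k) (b :: b').
    apply/andP; split=> //.
    by apply: sub_all ba => l; exact: leq_trans.
  have -> : sort lle (rcons (b :: b') k) = k :: b :: b'.
    rewrite -(sort_cons_sorted key_inj ka sa); apply/(perm_sortP (lle_total _) (@lle_trans _ _) (lle_anti key_inj)).
    by rewrite perm_rcons.
  exact: insert_under h.
have -> : sort lle (rcons (b :: b') k) = b :: sort lle (rcons b' k).
  rewrite -[b :: sort _ _](sort_cons_sorted key_inj (k := b)).
  - apply/(perm_sortP (lle_total _) (@lle_trans _ _) (lle_anti key_inj)).
    by rewrite /= perm_cons perm_sym perm_sort.
  - by rewrite all_sort all_rcons ba andbT; exact: ltnW.
  - by apply: sort_sorted; exact: lle_total.
pose g : {linear V -> K^o} := f \o X b.
have h1 : `|g (wact b' (X k v)) - g (wact (sort lle (rcons b' k)) v)|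
    <= lam * mu * ((size b')%:R * y).
  apply: (IH _ _ _ (O - o b)%N (key b)) => //.
  - exact: leq_trans (leq_subr _ _) On.
  - exact: low_comp h.
apply: le_trans h1 _; apply: ler_wpM2l; first exact: mulr_ge0.
by apply: ler_wpM2r => //; rewrite ler_nat.
Qed.

(** The letters of [a] are inserted one by one into the sorted prefix [b], each multiplying the
    constant by [1 + mu]. The length of [b] costs nothing, so that a relation between short words
    can later be used behind an arbitrarily long sorted prefix. *)
Lemma word_bound a : forall b f v O lam, sorted lle b ->
  (tot o b + tot o a = O)%N -> (O <= n)%N -> 0 <= lam -> low f v 1 O 0 lam ->
  `|f (wact (b ++ a) v) - f (wact (sort lle (b ++ a)) v)|
    <= ((1 + mu) ^+ size a - 1) * lam.
Proof.
have all0 b : all (fun l => 0 <= key l)%N b by apply/allP.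
elim: a => [|k a IH] b f v O lam sb eO On lam0 h.
  by rewrite cats0 (sort_eq key_inj (s := b)) // !subrr normr0 mul0r.
rewrite tot_cons in eO.
set q := (1 + mu) ^+ size a.
have q1 : 1 <= q by rewrite exprn_ege1 // lerDl.
(* On the vector [wact a v], a sorted word [b'] is really [b' ++ a]; sorting it by the induction
   hypothesis costs [q - 1], and the sorted result costs 1, both in units of [lam * y ^+ j]. *)
have hl : low f (wact a v) 1 (o k + tot o b) 0 (q * lam).
  move=> b' j sb' _ j1 ej; rewrite -mulrA -wact_cat.
  have yj0 : 0 <= lam * y ^+ j by rewrite mulr_ge0 ?exprn_ge0.
  have ej' : (tot o b' + tot o a + j * S = O)%N.
    by rewrite addnAC ej -eO -addnA addnCA.
  have h' : low f v 0 (tot o b' + tot o a) 0 (lam * y ^+ j).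
    move=> b2 j2 s2 _ _ e2; rewrite -mulrA -exprD; apply: h => //.
      exact: leq_trans j1 (leq_addr _ _).
    by rewrite addnC mulnDl -addnA (addnC (j2 * S)%N) e2 addnC.
  rewrite -[f _](subrK (f (wact (sort lle (b' ++ a)) v))).
  apply: le_trans (ler_normD _ _) _.
  rewrite -[q](subrK 1) mulrDl mul1r; apply: lerD.
    apply: IH (low_weak _ h') => //.
    by rewrite -ej' in On; exact: leq_trans (leq_addr _ _) On.
  rewrite -[leRHS]mulr1 -(expr0 y); apply: h' => //.
    by apply: sort_sorted; exact: lle_total.
  by rewrite mul0n addn0 tot_sort tot_cat.
have kbn : (o k + tot o b <= n)%N.
  by apply: leq_trans On; rewrite -eO addnCA addnA leq_addr.
have q0 : 0 <= q * lam by rewrite mulr_ge0 // (le_trans ler01).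
have h1 := insert_right sb (all0 b) erefl kbn q0 hl.
have h1' : `|f (wact b (X k (wact a v))) -
    f (wact (sort lle (rcons b k)) (wact a v))| <= q * lam * mu.
  apply: le_trans h1 _; rewrite -[leRHS]mulr1; apply: ler_wpM2l.
    exact: mulr_ge0.
  by apply: size_mul_y; apply: leq_trans kbn; rewrite leq_addl.
have eO2 : (tot o (sort lle (rcons b k)) + tot o a = O)%N.
  by rewrite tot_sort -cats1 tot_cat tot_cons addn0 -eO -addnA.
have h2 := IH _ f v O lam (sort_sorted (lle_total _) _) eO2 On lam0 h.
have e : sort lle (sort lle (rcons b k) ++ a) = sort lle (b ++ k :: a).
  apply/(perm_sortP (lle_total _) (@lle_trans _ _) (lle_anti key_inj)).
  by rewrite -cat_rcons perm_cat2r perm_sort.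
rewrite e wact_cat in h2; rewrite wact_cat.
rewrite -[f _](subrK (f (wact (sort lle (rcons b k)) (wact a v)))) -addrA.
apply: le_trans (ler_normD _ _) _.
apply: le_trans (lerD h1' h2) _.
by rewrite exprS -/q le_eqVlt; apply/orP; left; apply/eqP; ring.
Qed.

End Insertion.

Lemma wact_lin (K : numFieldType) (V : lmodType K) (L : finType)
    (X : L -> {linear V -> V}) a : linear (wact X a).
Proof. by elim: a => [|l a IH] d u v //=; rewrite IH linearP. Qed.

HB.instance Definition _ (K : numFieldType) (V : lmodType K) (L : finType)
    (X : L -> {linear V -> V}) a :=
  GRing.isLinear.Build K V V _ (wact X a) (wact_lin X a).

(** * Lexicographic term orders and Dickson's lemma *)

Section TermOrder.
Variables (L : finType) (r : nat).

Definition mono : Type := (seq L * 'I_r)%type.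
Definition wform : Type := ((L -> nat) * ('I_r -> nat))%type.
Definition ev (p : wform) (m : mono) : nat := (tot p.1 m.1 + p.2 m.2)%N.
Definition mact (b : seq L) (m : mono) : mono := (b ++ m.1, m.2).

Fixpoint lex (P : seq wform) (m m' : mono) : bool :=
  if P is p :: P' then
    (ev p m < ev p m')%N || ((ev p m == ev p m') && lex P' m m')
  else false.

Lemma ev_act p b m : ev p (mact b m) = (tot p.1 b + ev p m)%N.
Proof. by rewrite /ev tot_cat addnA. Qed.

Lemma ev_perm p (a a' : seq L) i : perm_eq a a' -> ev p (a, i) = ev p (a', i).
Proof. by move=> h; rewrite /ev (tot_perm _ h). Qed.

Lemma lex_act P b m m' : lex P m m' -> lex P (mact b m) (mact b m').
Proof.
elim: P => //= p P IH /orP[h|/andP[/eqP e /IH h]]; rewrite !ev_act.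
  by rewrite ltn_add2l h.
by rewrite e eqxx h orbT.
Qed.

Lemma lex_perm P (a a' b b' : seq L) i j : perm_eq a a' -> perm_eq b b' ->
  lex P (a, i) (b, j) = lex P (a', i) (b', j).
Proof.
by move=> aa bb; elim: P => //= p P ->; rewrite !(ev_perm _ _ aa) !(ev_perm _ _ bb).
Qed.

Lemma lex_trans P : transitive (lex P).
Proof.
elim: P => //= p P IH m' m m''.
by move=> /orP[h1|/andP[/eqP-> h1]] /orP[h2|/andP[/eqP<- h2]];
  rewrite ?h1 ?h2 ?(ltn_trans h1 h2) ?(IH _ _ _ h1 h2) ?eqxx ?orbT.
Qed.

Lemma lex_total P m m' : (forall p, List.In p P -> ev p m = ev p m') \/
  lex P m m' \/ lex P m' m.
Proof.
elim: P => [|p P IH] /=; first by left.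
have [h|h|e] := ltngtP (ev p m) (ev p m'); first by right; left.
  by right; right.
by case: IH => [h|[->|->]]; [left=> q [<-//|/h] | right; left | right; right].
Qed.

Lemma lex_wf P : well_founded (lex P).
Proof.
elim: P => [m|p P IH m]; first by constructor.
have [k mk] : exists k, (ev p m < k)%N by exists (ev p m).+1.
elim: k m mk => [m|k IHk m mk]; first by rewrite ltn0.
elim: (IH m) mk => {}m _ h mk; constructor=> m' /= /orP[lt|/andP[/eqP e /h]].
  by apply: IHk; exact: leq_trans lt mk.
by apply; rewrite e.
Qed.

(** Finitely many strict lexicographic inequalities are realised by one weight [B * p + w]: [B]
    exceeds all values of [w] on the smaller members, so one unit of the leading form outweighs
    them, while [w] decides the pairs on which the leading form is tied. *)
Lemma lex_weight P (s : seq (mono * mono)) : all (fun q => lex P q.1 q.2) s ->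
  exists w : wform, all (fun q => ev w q.1 < ev w q.2)%N s.
Proof.
elim: P s => [|p P IH] s hs.
  by exists (fun=> 0%N, fun=> 0%N); apply: sub_all hs.
have [w hw] := IH [seq q <- s | lex P q.1 q.2] (filter_all _ s).
pose B := (\max_(q <- s) ev w q.1)%N.+1.
exists (fun l => B * p.1 l + w.1 l, fun i => B * p.2 i + w.2 i)%N.
have evE m : ev (fun l => B * p.1 l + w.1 l, fun i => B * p.2 i + w.2 i)%N m =
    (B * ev p m + ev w m)%N.
  rewrite /ev /=; have -> : tot (fun l => B * p.1 l + w.1 l)%N m.1 =
    (B * tot p.1 m.1 + tot w.1 m.1)%N.
    by elim: m.1 => [|l a IHa]; rewrite ?tot_cons ?IHa /tot /=; lia.
  by lia.
apply/allP => q qs; rewrite !evE.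
have qB : (ev w q.1 < B)%N.
  by rewrite ltnS; exact: (bigmaxn_sup_seq _ qs).
clearbody B; have /orP[lt|/andP[/eqP e lq]] := allP hs q qs.
  have : (B * (ev p q.1).+1 <= B * ev p q.2)%N by rewrite leq_mul.
  move=> h; apply: leq_trans (leq_trans h (leq_addr _ _)).
  by rewrite mulnS addnC -addSn leq_add2r.
have : (ev w q.1 < ev w q.2)%N by apply: (allP hw); rewrite mem_filter; apply/andP.
by rewrite e ltn_add2l.
Qed.

End TermOrder.

(** The set [D0] for the other functions dominates all [x] with [f x >= B]; the finitely many slices
    [f x = b] with [b < B] are treated separately. *)
Lemma dickson (T : eqType) (fs : seq (T -> nat)) (P : T -> Prop) :
  exists D : seq T, (forall d, d \in D -> P d) /\
    forall x, P x -> exists2 d, d \in D & forall f, List.In f fs -> (f d <= f x)%N.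
Proof.
elim: fs P => [|f fs IH] P.
  have [[x Px]|h] := pselect (exists x, P x).
    by exists [:: x]; split=> [d|y _]; [rewrite inE => /eqP-> | exists x => //; rewrite inE].
  by exists [::]; split=> // x Px; case: h; exists x.
have [D0 [D0P D0x]] := IH P.
have /choice[D hD] : forall b, exists D : seq T,
    (forall d, d \in D -> P d /\ f d = b) /\
    forall x, P x /\ f x = b -> exists2 d, d \in D &
      forall g, List.In g fs -> (g d <= g x)%N.
  by move=> b; exact: (IH (fun x => P x /\ f x = b)).
pose B := (\max_(d <- D0) f d)%N.
exists (D0 ++ flatten [seq D b | b <- iota 0 B]); split=> [d|x Px].
  rewrite mem_cat => /orP[/D0P//|/flattenP[_ /mapP[b _ ->]]].
  by case: (hD b) => h _ /h [].
have [Bx|xB] := leqP B (f x).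
  have [d dD0 hd] := D0x x Px; exists d; first by rewrite mem_cat dD0.
  move=> g [<-|/hd//]; apply: leq_trans Bx.
  exact: (bigmaxn_sup_seq _ dD0).
have [_ h] := hD (f x); have [d dD hd] := h x (conj Px erefl).
exists d.
  rewrite mem_cat; apply/orP; right; apply/flattenP; exists (D (f x)) => //.
  by apply/mapP; exists (f x) => //; rewrite mem_iota.
by move=> g [<-|/hd//]; have [h1 _] := hD (f x); case: (h1 d dD) => _ ->.
Qed.

(** * Functionals of slow growth *)

Section Growth.
Variables (K : numFieldType) (V : lmodType K) (L : finType) (r : nat).
Variables (key o : L -> nat) (S : nat) (X : L -> {linear V -> V}).
Variables (c : L -> L -> L -> K) (w : 'I_r -> V) (Z : set V).
Hypothesis key_inj : injective key.
Hypothesis o_gt0 : forall l, (0 < o l)%N.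
Hypothesis S_gt0 : (0 < S)%N.
Hypothesis Xcomm : forall i j v,
  X i (X j v) = X j (X i v) + \sum_k c i j k *: X k v.
Hypothesis c_o : forall i j k, c i j k != 0 -> (o k + S = o i + o j)%N.
Hypothesis c_key : forall i j k, c i j k != 0 -> (key i < key k)%N && (key j < key k)%N.
Hypothesis hZ : subsp Z.
Hypothesis XZ : forall l z, Z z -> Z (X l z).
Hypothesis archi : forall x : K, exists N : nat, `|x| <= N%:R.

Local Notation lle := (lle key).
Local Notation mono := (mono L r).
Implicit Types (m t : mono).

Definition vec m : V := wact X m.1 (w m.2).

Hypothesis Vspan : forall v, lin_span (Z `|` range vec) v.

Lemma wactZ a z : Z z -> Z (wact X a z).
Proof. by move=> Zz; elim: a => //= l a; exact: XZ. Qed.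

(** The weight [o] comes first, so that a commutator always leads to smaller words. The letter
    counts and the indicators of the generators make the order total on sorted words, and turn
    divisibility of words into inequalities between forms. *)
Definition forms : seq (wform L r) :=
  (o, fun=> 0%N) ::
  [seq (fun l' => (l' == l) : nat, fun=> 0%N) | l <- enum L] ++
  [seq (fun=> 0%N, fun j => (j == i) : nat) | i <- enum 'I_r].

Local Notation lt := (lex forms).

Lemma tot_count l (a : seq L) : tot (fun l' => (l' == l) : nat) a = count_mem l a.
Proof. by elim: a => //= l' a <-. Qed.

Lemma tot0 (a : seq L) : tot (fun=> 0%N) a = 0%N.
Proof. by elim: a. Qed.

Lemma In_map (T : eqType) (T' : Type) (f : T -> T') (s : seq T) x :
  x \in s -> List.In (f x) [seq f x | x <- s].
Proof. by elim: s => //= y s IH; rewrite inE => /orP[/eqP->|/IH]; [left|right]. Qed.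

Lemma forms_dom m m' : (forall p, List.In p forms -> (ev p m <= ev p m')%N) ->
  m.2 = m'.2 /\ forall l, (count_mem l m.1 <= count_mem l m'.1)%N.
Proof.
move=> h; split.
  have : List.In (fun=> 0%N, fun j => (j == m.2) : nat) forms.
    rewrite /= List.in_app_iff; right; right.
    apply: (In_map (fun i => (fun=> 0%N, fun j => (j == i) : nat))).
    by rewrite mem_enum.
  move/h; rewrite /ev /= !tot0 eqxx; case: eqP => [->|_] //.
move=> l; have : List.In (fun l' => (l' == l) : nat, fun=> 0%N) forms.
  rewrite /= List.in_app_iff; right; left.
  apply: (In_map (fun l => (fun l' => (l' == l) : nat, fun=> 0%N))).
  by rewrite mem_enum.
by move/h; rewrite /ev /= !tot_count !addn0.
Qed.

Lemma lt_total m m' : sorted lle m.1 -> sorted lle m'.1 ->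
  [\/ m = m', lt m m' | lt m' m].
Proof.
move=> sm sm'; case: (lex_total forms m m') => [h|[h|h]]; [|by constructor 2|by constructor 3].
constructor 1.
have [e1 c1] := forms_dom (fun p hp => eq_leq (h p hp)).
have [_ c2] := forms_dom (fun p hp => eq_leq (esym (h p hp))).
case: m m' sm sm' h e1 c1 c2 => [a i] [a' i'] /= sa sa' _ -> c1 c2; congr (_, _).
apply: (sorted_eq (@lle_trans _ _) (lle_anti key_inj)) => //.
by apply/allP => l _ /=; rewrite eqn_leq c1 c2.
Qed.

Lemma lt_o m m' : lt m m' -> (tot o m.1 <= tot o m'.1)%N.
Proof. by case/orP => [/ltnW|/andP[/eqP/eq_leq + _]]; rewrite /ev /= !addn0. Qed.

Lemma o_lt m m' : (tot o m.1 < tot o m'.1)%N -> lt m m'.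
Proof. by move=> h; apply/orP; left; rewrite /ev /= !addn0. Qed.

Section SortedSpan.

Let shorter n := lin_span (Z `|` [set vec m | m in [set m | (size m.1 < n)%N]]).

Lemma shorter_act n l v : shorter n v -> shorter n.+1 (X l v).
Proof.
move: v; apply: span_min; first exact: subsp_preim (subsp_span _).
move=> x [Zx|[m hm <-]]; first by apply: span_sub; left; exact: XZ.
by apply: span_sub; right; exists (l :: m.1, m.2).
Qed.

Lemma shorter_vec m n : (size m.1 < n)%N -> shorter n (vec m).
Proof. by move=> h; apply: span_sub; right; exists m. Qed.

Lemma shorter_insert (a : seq L) l i : sorted lle a ->
  shorter (size a).+1 (vec (l :: a, i) - vec (sort lle (l :: a), i)).
Proof.
elim: a l => [|b a IH] l sa.
  by rewrite (sort_eq key_inj (s := [:: l])) // subrr; exact: subsp0 (subsp_span _).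
have [kb|bk] := leqP (key l) (key b).
  rewrite (sort_cons_sorted key_inj) ?subrr //; first exact: subsp0 (subsp_span _).
  move: sa; rewrite sorted_cons => /andP[ba _]; apply/andP; split=> //.
  by apply: sub_all ba => x; exact: leq_trans.
move: (sa); rewrite sorted_cons => /andP[ba sa'].
rewrite (sort_swap key_inj) // /vec /= Xcomm addrAC; apply: (subspD (subsp_span _)).
  by rewrite -raddfB; apply: shorter_act; exact: IH.
apply: (subsp_sum (subsp_span _)) => k _; apply: (subspZ (subsp_span _)).
exact: (@shorter_vec (k :: a, i)).
Qed.

Lemma shorter_sort (a : seq L) i :
  shorter (size a) (vec (a, i) - vec (sort lle a, i)).
Proof.
elim: a => [|l a IH]; first by rewrite subrr; exact: subsp0 (subsp_span _).
have -> : sort lle (l :: a) = sort lle (l :: sort lle a).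
  apply/(perm_sortP (lle_total _) (@lle_trans _ _) (lle_anti key_inj)).
  by rewrite perm_cons perm_sym perm_sort.
have := shorter_insert l i (sort_sorted (@lle_total _ key) a).
rewrite size_sort => h; have := shorter_act l IH; rewrite raddfB => h'.
by have := subspD (subsp_span _) h' h; rewrite subrKA.
Qed.

Lemma sorted_span v :
  lin_span (Z `|` [set vec m | m in [set m | sorted lle m.1]]) v.
Proof.
have h := subsp_span (Z `|` [set vec m | m in [set m | sorted lle m.1]]).
have sh n : shorter n `<=` lin_span (Z `|` [set vec m | m in [set m | sorted lle m.1]]).
  elim: n => [|n IH]; apply: (span_min h) => x [Zx|[m hm <-]];
    try by apply: span_sub; left.
  case: m hm => a i /=; rewrite ltnS => an.
  rewrite -[vec _](subrK (vec (sort lle a, i))); apply: (subspD h).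
    apply: IH; move: (@shorter_sort a i); apply: span_mono.
    by move=> y [|[m hm <-]]; [left | right; exists m => //; exact: leq_trans hm an].
  apply: span_sub; right; exists (sort lle a, i) => //=.
  by apply: sort_sorted; exact: lle_total.
move: v (Vspan v); apply: span_min => // x [Zx|[m _ <-]].
  by apply: span_sub; left.
by apply: (sh (size m.1).+1); exact: shorter_vec.
Qed.

End SortedSpan.

(** A sorted word is [standard] when it is not the leading word of a relation modulo [Z]; as in
    Gröbner theory, the standard words give a basis of the quotient by [Z]. *)
Definition below m : set V :=
  lin_span (Z `|` [set vec t | t in [set t | sorted lle t.1 /\ lt t m]]).

Definition standard m : Prop := sorted lle m.1 /\ ~ below m (vec m).

Lemma subsp_below m : subsp (below m). Proof. exact: subsp_span. Qed.

Lemma standard_span v : lin_span (Z `|` [set vec m | m in standard]) v.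
Proof.
have h := subsp_span (Z `|` [set vec m | m in standard]).
move: v (sorted_span v); apply: span_min => // x [Zx|[m hm <-]].
  by apply: span_sub; left.
elim: m / (lex_wf forms m) hm => m _ IH hm.
have [nb|sb] := pselect (standard m); first by apply: span_sub; right; exists m.
have : below m (vec m) by apply: contrapT => nb; apply: sb.
apply: span_min => // y [Zy|[t [st tm] <-]]; first by apply: span_sub; left.
exact: IH.
Qed.

(** In a nontrivial relation the largest word with nonzero coefficient would lie in the span of [Z]
    and smaller sorted words, so it would not be standard. *)
Lemma standard_free (s : seq mono) (d : mono -> K) : uniq s ->
  (forall t, t \in s -> standard t) -> Z (\sum_(t <- s) d t *: vec t) ->
  forall t, t \in s -> d t = 0.
Proof.
move=> us hs hd t ts; apply/eqP/negPn/negP => dt.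
pose s' := [seq t <- s | d t != 0].
have [m ms' mmax] : exists2 m, m \in s' & forall t, t \in s' -> t = m \/ lt t m.
  have : t \in s' by rewrite mem_filter dt.
  have : forall t, t \in s' -> standard t by move=> x; rewrite mem_filter => /andP[_ /hs].
  elim: s' {ts dt} t => // x s' IH t hx _.
  case: s' IH hx => [|y s'] IH hx.
    by exists x; rewrite ?mem_head // => z; rewrite inE => /eqP ->; left.
  have [m ms mmax] := IH y (fun z hz => hx z (mem_behead (s := x :: _) hz)) (mem_head _ _).
  have [sx _] := hx x (mem_head _ _).
  have [sm _] := hx m (mem_behead (s := x :: _) ms).
  case: (lt_total sx sm) => [e|l|l].
  - exists m; first by rewrite inE ms orbT.
    by move=> z; rewrite inE => /orP[/eqP->|/mmax//]; left.
  - exists m; first by rewrite inE ms orbT.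
    by move=> z; rewrite inE => /orP[/eqP->|/mmax//]; right.
  - exists x; first exact: mem_head.
    move=> z; rewrite inE => /orP[/eqP->|/mmax [->|h]]; [by left|by right|right].
    exact: lex_trans h l.
move: ms'; rewrite mem_filter => /andP[dm ms].
have [sm] := hs m ms; apply.
have hb := subsp_below m.
have : below m (\sum_(t <- s) d t *: vec t) by apply: span_sub; left.
rewrite (bigD1_seq m) //= => h.
have rest : below m (\sum_(i <- s | i != m) d i *: vec i).
  rewrite big_seq_cond; apply: (subsp_sum hb) => x /andP[xs xm].
  have [->|dx] := eqVneq (d x) 0; first by rewrite scale0r; exact: subsp0.
  apply: (subspZ hb); apply: span_sub; right; exists x => //.
  split; first by case: (hs x xs).
  have /mmax [e|//] : x \in s' by rewrite mem_filter dx.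
  by rewrite e eqxx in xm.
have := subspZ hb (d m)^-1 (subspDr hb rest h).
by rewrite scalerA mulVf // scale1r.
Qed.

Section Scaled.

Variables (om : wform L r) (kap mu : K) (M : nat).
Variables (D : seq mono) (rel : mono -> seq mono) (d : mono -> mono -> K).
Variable f : {linear V -> K^o}.
Hypothesis kap1 : 1 <= kap.
Hypothesis mu_ge0 : 0 <= mu.
Hypothesis mu_le1 : mu <= 1.
Hypothesis muM : forall k, (k <= M)%N -> (1 + mu) ^+ k - 1 <= 4^-1.
Hypothesis om_c : forall i j k, c i j k != 0 -> (om.1 k < om.1 i + om.1 j)%N.
Hypothesis c_small : forall i j, \sum_k `|c i j k| <= kap * (mu / 2).
Hypothesis D_dom : forall m, sorted lle m.1 -> ~ standard m ->
  exists2 m0, m0 \in D & forall p, List.In p forms -> (ev p m0 <= ev p m)%N.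
Hypothesis D_sorted : forall m, m \in D -> sorted lle m.1 /\ (size m.1 <= M)%N.
Hypothesis D_rel : forall m, m \in D -> exists2 z, Z z &
  vec m = z + \sum_(t <- rel m) d m t *: vec t.
Hypothesis rel_lt : forall m t, m \in D -> t \in rel m ->
  [/\ lt t m, (ev om t < ev om m)%N & (size t.1 <= M)%N].
Hypothesis d_small : forall m, m \in D -> \sum_(t <- rel m) `|d m t| <= kap / 4.
Hypothesis fZ : forall z, Z z -> f z = 0.
Hypothesis f_std : forall m, standard m -> `|f (vec m)| <= 1.

Let kap0 : 0 < kap. Proof. exact: lt_le_trans ltr01 kap1. Qed.
Let kapn k : kap ^+ k != 0. Proof. by rewrite expf_neq0 // gt_eqF. Qed.

(** The weight [om] strictly decreases along commutators and along the finitely many chosen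
    relations, so after this rescaling each of their coefficients carries a factor of at most
    [kap^-1]. *)
Let Xs l : {linear V -> V} := kap ^- om.1 l \*: X l.
Let ws i : V := kap ^- om.2 i *: w i.
Let cs i j k : K := c i j k * kap ^+ om.1 k / (kap ^+ om.1 i * kap ^+ om.1 j).

Lemma XsE a v : wact Xs a v = kap ^- tot om.1 a *: wact X a v.
Proof.
elim: a => [|l a IH] /=; first by rewrite expr0 invr1 scale1r.
by rewrite IH linearZ /= scalerA tot_cons exprD invfM mulrC.
Qed.

Let vs m := wact Xs m.1 (ws m.2).

Lemma vsE m : vs m = kap ^- ev om m *: vec m.
Proof.
by rewrite /vs XsE /ws linearZ scalerA -invfM -exprD.
Qed.

Lemma Xs_comm i j v : Xs i (Xs j v) = Xs j (Xs i v) + \sum_k cs i j k *: Xs k v.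
Proof.
rewrite /Xs /= !linearZ /= !scalerA Xcomm scalerDr mulrC; congr (_ + _).
rewrite scaler_sumr; apply: eq_bigr => k _; rewrite !scalerA; congr (_ *: _).
rewrite /cs invfM; have := kapn (om.1 k); set q := kap ^+ om.1 k => q0.
by field; rewrite q0 !kapn.
Qed.

Lemma cs_neq0 i j k : cs i j k != 0 -> c i j k != 0.
Proof. by apply: contraNneq; rewrite /cs => ->; rewrite !mul0r. Qed.

Lemma cs_small i j : \sum_k `|cs i j k| <= mu / 2.
Proof.
rewrite -(ler_pM2l kap0); apply: le_trans (c_small i j); rewrite mulr_sumr; apply: ler_sum => k _.
have [e|/om_c h] := eqVneq (c i j k) 0.
  by rewrite /cs e !mul0r normr0 mulr0.
rewrite /cs -mulrA normrM mulrCA -[leRHS]mulr1; apply: ler_wpM2l => //.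
have kp k' : 0 < kap ^+ k' by rewrite exprn_gt0.
rewrite gtr0_norm ?divr_gt0 ?mulr_gt0 //.
rewrite mulrA -exprS -exprD ler_pdivrMr ?exprn_gt0 // mul1r.
by apply: ler_weXn2l.
Qed.

(** A nonstandard sorted word is, up to sorting, a sorted prefix followed by one of the words of
    [D]; this sorting costs 1/4. The relation turns it into smaller words, each bounded by 5/4 after
    sorting, with coefficients of total size at most 1/4. Altogether 1/4 + 5/16 = 9/16 of the
    allowed bound, so the constant does not grow along the induction. *)
Lemma standard_rec n m : (0 < n)%N -> sorted lle m.1 -> (tot o m.1 <= n)%N ->
  `|f (vs m)| <= n%:R ^+ (tot o m.1 %/ S).
Proof.
move=> n0; set y : K := n%:R^-1.
have n1 : 1 <= n%:R :> K by rewrite ler1n.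
have y0 : 0 <= y by rewrite invr_ge0 ler0n.
have ny : n%:R * y <= 1 by rewrite divff // pnatr_eq0 -lt0n.
have cso i j k : cs i j k != 0 -> (o k + S = o i + o j)%N by move/cs_neq0/c_o.
have csk i j k : cs i j k != 0 -> (key i < key k)%N && (key j < key k)%N.
  by move/cs_neq0/c_key.
have wb := word_bound key_inj o_gt0 Xs_comm cso csk y0 mu_ge0 mu_le1 ny cs_small.
elim: m / (lex_wf forms m) => -[a i] _ IH /= sa an.
set O := tot o a; set lam : K := n%:R ^+ (O %/ S).
have lam0 : 0 <= lam by rewrite exprn_ge0.
have [std|nstd] := pselect (standard (a, i)).
  rewrite vsE linearZ normrM -[leRHS]mulr1; apply: ler_pM => //; last exact: f_std.
  rewrite gtr0_norm ?invr_gt0 ?exprn_gt0 //.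
  apply: le_trans (_ : 1 <= _); last by rewrite exprn_ege1.
  by rewrite invf_le1 ?exprn_gt0 // exprn_ege1.
(* After at least one commutator the weight has dropped, so the words are smaller in the term order
   and the induction hypothesis applies; each loss of [S] in weight is worth one factor
   [y = 1/n]. *)
have lowO j k : (j <= O)%N -> low key o S Xs y f (ws k) 1 j 0 (n%:R ^+ (j %/ S)).
  move=> jO b h sb _ h1 e; have lt1 : lt (b, k) (a, i).
    by apply: o_lt; apply: leq_trans jO; rewrite /= -e; nia.
  have bn : (tot o b <= n)%N by apply: leq_trans an; exact: lt_o lt1.
  apply: le_trans (IH _ lt1 sb bn) _; rewrite /= -e divnDMl // exprD -mulrA.
  by rewrite /y exprVn divff ?mulr1 // expf_neq0 // pnatr_eq0 -lt0n.
have [[a0 i0] mD /forms_dom[/= e0 le0]] := @D_dom (a, i) sa nstd; subst i0.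
have [sa0 za0] := D_sorted mD.
have [b sb pb] : exists2 b, sorted lle b & perm_eq a (b ++ a0).
  have /count_subseqP[a1 /perm_to_subseq[b1 p1] p2] := le0.
  exists (sort lle b1); first by apply: sort_sorted; exact: lle_total.
  rewrite (perm_trans p1) // perm_catC; apply: perm_cat; last by rewrite perm_sym.
  by rewrite perm_sym perm_sort.
have eO : (tot o b + tot o a0 = O)%N by rewrite -tot_cat /O (tot_perm _ pb).
have est a' k : (tot o b + tot o a' <= O)%N -> (size a' <= M)%N ->
  `|f (wact Xs (b ++ a') (ws k)) - f (wact Xs (sort lle (b ++ a')) (ws k))|
    <= 4^-1 * lam.
  move=> ba' za'; set O' := (tot o b + tot o a')%N in ba' *.
  have lam'0 : 0 <= n%:R ^+ (O' %/ S) :> K by rewrite exprn_ge0.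
  apply: le_trans (wb _ _ _ _ O' _ sb erefl (leq_trans ba' an) lam'0 (lowO _ _ ba')) _.
  apply: ler_pM; rewrite ?subr_ge0 ?exprn_ege1 ?lerDl //; first exact: muM.
  by apply: ler_weXn2l => //; exact: leq_div2r.
have sortE : sort lle (b ++ a0) = a.
  by apply: (sort_eq key_inj) => //; rewrite perm_sym.
have {}est0 : `|f (vs (a, i)) - f (wact Xs b (vs (a0, i)))| <= 4^-1 * lam.
  have := est a0 i; rewrite sortE wact_cat distrC; apply; last by [].
  by rewrite eO.
have [z Zz ez] := D_rel mD.
have each t : t \in rel (a0, i) -> `|f (wact Xs b (vs t))| <= 5 / 4 * lam.
  move=> tr; have [tm _ tM] := rel_lt mD tr.
  have lt1 : lt (mact b t) (a, i).
    rewrite (lex_perm _ _ _ (perm_refl _) pb); exact: (lex_act b tm).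
  have ot : (tot o b + tot o t.1 <= O)%N by rewrite -tot_cat; exact: lt_o lt1.
  rewrite /vs -wact_cat -[f _](subrK (f (wact Xs (sort lle (b ++ t.1)) (ws t.2)))).
  apply: le_trans (ler_normD _ _) _.
  have -> : 5 / 4 * lam = 4^-1 * lam + lam by field.
  apply: lerD; first exact: est.
  have lt2 : lt (sort lle (b ++ t.1), t.2) (a, i).
    have ps : perm_eq (sort lle (b ++ t.1)) (b ++ t.1) by rewrite perm_sort.
    by rewrite (lex_perm _ _ _ ps (perm_refl a)).
  have sb2 : sorted lle (sort lle (b ++ t.1)) by apply: sort_sorted; exact: lle_total.
  apply: le_trans (IH _ lt2 sb2 (leq_trans (lt_o lt2) an)) _.
  by apply: ler_weXn2l => //; apply: leq_div2r; exact: lt_o lt2.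
have main : `|f (wact Xs b (vs (a0, i)))| <= 4^-1 * (5 / 4 * lam).
  have -> : f (wact Xs b (vs (a0, i))) = \sum_(t <- rel (a0, i))
      d (a0, i) t * (kap ^+ ev om t / kap ^+ ev om (a0, i)) * f (wact Xs b (vs t)).
    have fz : f (wact Xs b (kap ^- ev om (a0, i) *: z)) = 0.
      by apply: fZ; rewrite XsE; apply: (subspZ hZ); apply: wactZ; exact: (subspZ hZ).
    rewrite vsE ez scalerDr linearD raddfD /= fz add0r linearZ linearZ.
    rewrite !linear_sum /= scaler_sumr; apply: eq_bigr => t _.
    rewrite vsE !linearZ /=; have := kapn (ev om t).
    set q := kap ^+ ev om t => q0.
    by rewrite /GRing.scale /=; field; rewrite q0 kapn.
  apply: le_trans (ler_norm_sum _ _ _) _.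
  have lam5 : 0 <= 5 / 4 * lam by rewrite !mulr_ge0 ?invr_ge0 ?ler0n. set q := 5 / 4 * lam in lam5 each *.
  apply: le_trans (_ : \sum_(t <- rel (a0, i)) `|d (a0, i) t| * (kap^-1 * (q)) <= _).
    rewrite big_seq [leRHS]big_seq; apply: ler_sum => t tr.
    rewrite 2!normrM -mulrA; apply: ler_wpM2l => //.
    apply: ler_pM => //; last exact: each.
    have [_ h _] := rel_lt mD tr.
    rewrite gtr0_norm ?divr_gt0 ?exprn_gt0 // ler_pdivrMr ?exprn_gt0 // ler_pdivlMl //.
    by rewrite -exprS; apply: ler_weXn2l.
  rewrite -mulr_suml mulrA; rewrite ler_wpM2r //.
  by rewrite ler_pdivrMr // mulrC; exact: d_small.
rewrite -[f _](subrK (f (wact Xs b (vs (a0, i))))).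
apply: le_trans (ler_normD _ _) _.
apply: le_trans (lerD est0 main) _.
have -> : 4^-1 * lam + 4^-1 * (5 / 4 * lam) = 9 / 16 * lam by field.
rewrite -[leRHS]mul1r; apply: ler_wpM2r => //.
by rewrite ler_pdivrMr // mul1r ler_nat.
Qed.

Lemma scaled_bound m n : (0 < n)%N -> (tot o m.1 <= n)%N ->
  `|f (vs m)| <= 2 ^+ size m.1 * n%:R ^+ (tot o m.1 %/ S).
Proof.
move=> n0 mn; have n1 : 1 <= n%:R :> K by rewrite ler1n.
have y0 : 0 <= n%:R^-1 :> K by rewrite invr_ge0 ler0n.
have ny : n%:R * n%:R^-1 <= 1 :> K by rewrite divff // pnatr_eq0 -lt0n.
have cso i j k : cs i j k != 0 -> (o k + S = o i + o j)%N by move/cs_neq0/c_o.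
have csk i j k : cs i j k != 0 -> (key i < key k)%N && (key j < key k)%N.
  by move/cs_neq0/c_key.
have wb := word_bound key_inj o_gt0 Xs_comm cso csk y0 mu_ge0 mu_le1 ny cs_small.
case: m mn => a i /= an; set lam : K := n%:R ^+ (tot o a %/ S).
have lam0 : 0 <= lam by rewrite exprn_ge0.
have h : low key o S Xs n%:R^-1 f (ws i) 1 (tot o a) 0 lam.
  move=> b j sb _ j1 e.
  have bn : (tot o b <= n)%N by apply: leq_trans an; rewrite -e leq_addr.
  apply: le_trans (@standard_rec n (b, i) n0 sb bn) _.
  rewrite /lam -e divnDMl // exprD -mulrA.
  by rewrite exprVn divff ?mulr1 // expf_neq0 // pnatr_eq0 -lt0n.
have := wb a [::] f (ws i) (tot o a) lam isT erefl an lam0 h.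
rewrite cat0s => h1; rewrite -[f _](subrK (f (wact Xs (sort lle a) (ws i)))).
apply: le_trans (ler_normD _ _) _.
have ss : sorted lle (sort lle a) by apply: sort_sorted; exact: lle_total.
have h2 : `|f (wact Xs (sort lle a) (ws i))| <= lam.
  have := @standard_rec n (sort lle a, i) n0 ss; rewrite /= tot_sort; exact.
apply: le_trans (lerD h1 h2) _; rewrite mulrBl mul1r subrK.
apply: ler_wpM2r => //; rewrite lerXn2r // ?nnegrE ?addr_ge0 //.
by rewrite (_ : 2 = 1 + 1) // lerD2l.
Qed.

End Scaled.

Lemma standard_coord s : standard s -> exists f : {linear V -> K^o},
  [/\ forall z, Z z -> f z = 0, f (vec s) = 1 &
      forall t, standard t -> t != s -> f (vec t) = 0].
Proof.
move=> ss; pose P t := standard t /\ t != s.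
pose U := lin_span (Z `|` [set vec t | t in P]).
have hU : subsp U by exact: subsp_span.
have Us : ~ U (vec s).
  move=> /(span_family hZ)[z [T [d [Zz uT PT e]]]].
  have sT : s \notin T by apply/negP => /PT[_]; rewrite eqxx.
  have := @standard_free (s :: T) (fun t => if t == s then 1 else - d t).
  rewrite /= sT uT big_cons eqxx scale1r e => /(_ isT).
  have -> : \sum_(t <- T) (if t == s then 1 else - d t) *: vec t =
      - \sum_(t <- T) d t *: vec t.
    rewrite -sumrN big_seq [RHS]big_seq; apply: eq_bigr => t tT.
    by rewrite ifN ?scaleNr //; apply: contraNneq sT => <-.
  rewrite addrK => /(_ _ Zz s); rewrite mem_head eqxx => h.
  have /eqP : (1 : K) = 0; last by rewrite oner_eq0.
  by apply: h => // t; rewrite inE => /orP[/eqP-> //|/PT[]].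
have [f [fU fs]] : exists f : {linear V -> K^o}, (forall v, U v -> f v = 0) /\ f (vec s) = 1.
  apply: functional => // v; move: v (standard_span v); apply: span_min.
    apply: subspP; first by exists 0; rewrite scale0r subr0; exact: (subsp0 hU).
    move=> a u v [b hb] [b' hb']; exists (a * b + b').
    by rewrite scalerDl -scalerA opprD addrACA -scalerBr; exact: (subspZD hU).
  move=> v [Zv|[t st <-]].
    by exists 0; rewrite scale0r subr0; apply: span_sub; left.
  have [->|ts] := eqVneq t s; first by exists 1; rewrite scale1r subrr; exact: (subsp0 hU).
  by exists 0; rewrite scale0r subr0; apply: span_sub; right; exists t.
exists f; split=> // [z Zz|t st ts]; apply: fU; apply: span_sub; first by left.
by right; exists t.
Qed.

(** Since (1 + x)^j is at most 1 + 2jx as long as 2jx is at most 1, the value 1/(8(M+1)) of x keeps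
    the excess below 1/4. *)
Lemma expr_bound (M k : nat) : (k <= M)%N ->
  (1 + (8 * M.+1)%:R^-1 : K) ^+ k - 1 <= 4^-1.
Proof.
move=> kM; set x : K := _^-1.
have x0 : 0 <= x by rewrite invr_ge0 ler0n.
have Mx : M.+1%:R * x = 8^-1.
  rewrite /x natrM invfM mulrCA divff ?mulr1 // pnatr_eq0 //.
suff h j : (j <= M.+1)%N -> (1 + x) ^+ j <= 1 + 2 * (j%:R * x).
  rewrite lerBlDl; apply: le_trans (h k (leq_trans kM (leqnSn M))) _.
  rewrite lerD2l; apply: le_trans (_ : 2 * (M.+1%:R * x) <= _).
    by rewrite ler_wpM2l // ler_wpM2r // ler_nat leqW.
  by rewrite Mx le_eqVlt; apply/orP; left; apply/eqP; field.
elim: j => [_|j IH jM]; first by rewrite expr0 mul0r mulr0 addr0.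
have jx : 2 * (j%:R * x) <= 1.
  apply: le_trans (_ : 2 * (M.+1%:R * x) <= _).
    by rewrite ler_wpM2l // ler_wpM2r // ler_nat ltnW.
  rewrite Mx ler_pdivrMr ?mul1r ?ler_nat //.
rewrite exprSr; apply: le_trans (_ : (1 + 2 * (j%:R * x)) * (1 + x) <= _).
  by apply: ler_wpM2r; [rewrite addr_ge0 | exact/IH/ltnW].
have -> : (1 + 2 * (j%:R * x)) * (1 + x) =
  1 + 2 * (j%:R * x) + x + 2 * (j%:R * x) * x by ring.
have -> : 1 + 2 * (j.+1%:R * x) = 1 + 2 * (j%:R * x) + x + 1 * x.
  by rewrite -natr1; ring.
by rewrite lerD2l; apply: ler_wpM2r.
Qed.

(* Sorted words outside Z plus the span of the smaller words form a basis modulo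
   Z; the functional is a coordinate in it, and its values on other words are forced
   by finitely many relations (Dickson), made small by rescaling the letters. *)
Theorem growth_functional u0 : ~ Z u0 ->
  exists (f : {linear V -> K^o}) (C B : K),
  [/\ 0 <= C /\ 0 <= B, forall z, Z z -> f z = 0, f u0 != 0 &
    forall m n, (0 < n)%N -> (tot o m.1 <= n)%N ->
      `|f (vec m)| <= C * B ^+ size m.1 * n%:R ^+ (tot o m.1 %/ S)].
Proof.
move=> Zu0.
have [z [T [e [Zz uT sT eu0]]]] := span_family hZ (standard_span u0).
have [s sinT es] : exists2 s, s \in T & e s != 0.
  apply: contrapT => h; apply: Zu0; rewrite eu0 big_seq big1 ?addr0 // => t tT.
  have [->|et] := eqVneq (e t) 0; first by rewrite scale0r.
  by case: h; exists t.
have [f [fZ fs ft]] := standard_coord (sT s sinT).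
have i0 : 'I_r by case: s {sinT es fs ft}.
have fu0 : f u0 != 0.
  rewrite eu0 raddfD /= fZ // add0r raddf_sum (bigD1_seq s) //=.
  have -> : f (e s *: vec s) = e s by rewrite linearZ fs; exact: mulr1.
  rewrite big_seq_cond big1 ?addr0 //.
  move=> t /andP[tT ts]; rewrite linearZ ft ?mulr0 //; [exact: mulr0 | exact: sT].
have fstd m : standard m -> `|f (vec m)| <= 1.
  by have [->|ms] := eqVneq m s; rewrite ?fs ?normr1 // => /ft -> //; rewrite normr0.
pose P m := sorted lle m.1 /\ below m (vec m).
have [D [DP hD]] := dickson [seq @ev L r p | p <- forms] P.
have /choice[rel hrel] : forall m, exists q : V * seq mono * (mono -> K), P m ->
    [/\ Z q.1.1, (forall t, t \in q.1.2 -> lt t m) &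
        vec m = q.1.1 + \sum_(t <- q.1.2) q.2 t *: vec t].
  move=> m; have [Pm|nP] := pselect (P m); last by exists (0, [::], fun=> 0).
  have [_ /(span_family hZ)[z' [T' [d' [Zz' _ hT' e']]]]] := Pm.
  by exists (z', T', d') => _; split=> // t /hT'[].
(* The two families of strict inequalities that [om] must satisfy: the terms of a relation lie below
   its leading word, and the letter created by a commutator lies below the product of its parents.
   The index [i0] only serves to view words in the letters as monomials. *)
pose pr1 := [seq (t, m) | m <- D, t <- (rel m).1.2].
pose pr2 := [seq (([:: q.2], i0) : mono, ([:: q.1.1; q.1.2], i0) : mono) |
  q <- enum [pred q : L * L * L | c q.1.1 q.1.2 q.2 != 0]].
have /lex_weight[om /allP hom] : all (fun q => lt q.1 q.2) (pr1 ++ pr2).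
  rewrite all_cat; apply/andP; split; apply/allP.
    move=> _ /allpairsPdep[m [t [mD tm ->]]] /=.
    by have [_ h _] := hrel m (DP m mD); exact: h.
  move=> p /mapP[[[i j] k]]; rewrite mem_enum inE /= => cijk -> /=.
  by apply: o_lt; rewrite /tot /= !addn0 -(c_o cijk); lia.
(* The order of choices matters: [M] bounds the words of the relations, [mu] depends on [M] alone,
   and [kap] comes last, large enough to make all rescaled coefficients small. *)
pose M := (\max_(m <- D) size m.1 + \max_(q <- pr1) size q.1.1)%N.
pose mu : K := (8 * M.+1)%:R^-1.
have mu_gt0 : 0 < mu by rewrite invr_gt0 ltr0n.
have mu_le1 : mu <= 1 by rewrite invf_le1 ?ltr0n // ler1n.
pose tot1 := \sum_i \sum_j \sum_k `|c i j k|.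
pose tot2 := \sum_(m <- D) \sum_(t <- (rel m).1.2) `|(rel m).2 t|.
have [N hN] := archi (tot1 * (mu / 2)^-1 + tot2 * 4).
have tot1_ge0 : 0 <= tot1 by do 3 (apply: sumr_ge0 => ? _).
have tot2_ge0 : 0 <= tot2 by do 2 (apply: sumr_ge0 => ? _).
have mu20 : 0 < mu / 2 by rewrite divr_gt0.
have t1 : 0 <= tot1 * (mu / 2)^-1 by rewrite mulr_ge0 // invr_ge0 ltW.
have t2 : 0 <= tot2 * 4 by rewrite mulr_ge0.
rewrite ger0_norm ?addr_ge0 // in hN.
pose kap : K := N.+1%:R.
have hk1 : tot1 <= kap * (mu / 2).
  rewrite -ler_pdivrMr //; apply: le_trans (_ : N%:R <= _); last by rewrite ler_nat.
  by apply: le_trans hN; rewrite lerDl.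
have hk2 : tot2 <= kap / 4.
  rewrite ler_pdivlMr //; apply: le_trans (_ : N%:R <= _); last by rewrite ler_nat.
  by apply: le_trans hN; rewrite lerDr.
have kap1 : 1 <= kap by rewrite ler1n.
have sb := @scaled_bound om kap mu M D (fun m => (rel m).1.2) (fun m => (rel m).2) f
  kap1 (ltW mu_gt0) mu_le1 (@expr_bound M).
(* Undoing the rescaling of a word multiplies the bound by [kap] to its weight, which is at most [W]
   per letter plus [W'] for the generator. *)
pose W := (\max_l om.1 l)%N; pose W' := (\max_i om.2 i)%N.
exists f, (kap ^+ W'), (kap ^+ W * 2); split=> //.
  by rewrite mulr_ge0 ?exprn_ge0 // (le_trans ler01).
move=> m n n0 mn.
have {}sb : `|f (wact (fun l => kap ^- om.1 l \*: X l) m.1 (kap ^- om.2 m.2 *: w m.2))|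
    <= 2 ^+ size m.1 * n%:R ^+ (tot o m.1 %/ S).
  apply: sb => //.
  - move=> i j k cijk.
    have := hom (([:: k], i0), ([:: i; j], i0)).
    rewrite mem_cat /ev /tot /= !addn0 ltn_add2r; apply; apply/orP; right.
    by apply/mapP; exists (i, j, k) => //; rewrite mem_enum.
  - move=> i j; apply: le_trans hk1.
    rewrite /tot1 [leRHS](bigD1 i) //= [X in _ <= X + _](bigD1 j) //= -addrA lerDl addr_ge0 //.
      by do 2 (apply: sumr_ge0 => ? _).
    by do 3 (apply: sumr_ge0 => ? _).
  - move=> m' sm' nst; have : P m'.
      by split=> //; apply: contrapT => nb; apply: nst.
    move/hD => [m0 mD h]; exists m0 => // p pf; apply: h.
    by move: pf; rewrite -/forms; elim: forms => //= q qs IH [->|/IH]; [left|right].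
  - move=> m' mD; split; first by case: (DP m' mD).
    apply: leq_trans (leq_addr _ _); exact: (bigmaxn_sup_seq _ mD).
  - by move=> m' mD; have [h1 _ h2] := hrel m' (DP m' mD); exists (rel m').1.1.
  - move=> m' t mD tm; have [_ h _] := hrel m' (DP m' mD).
    have tp : (t, m') \in pr1 by apply/allpairsPdep; exists m', t.
    split; first exact: h.
      by have := hom (t, m'); rewrite mem_cat tp; exact.
    apply: leq_trans (leq_addl _ _); exact: (bigmaxn_sup_seq _ tp).
  - move=> m' mD; apply: le_trans hk2; rewrite /tot2 [leRHS](big_rem m') //= lerDl.
    by do 2 (apply: sumr_ge0 => ? _).
have kap0 : 0 < kap by rewrite ltr0n.
have evb : (ev om m <= W * size m.1 + W')%N.
  apply: leq_add; last exact: leq_bigmax.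
  elim: m.1 => //= l a IH; rewrite tot_cons mulnS; apply: leq_add => //.
  exact: leq_bigmax.
have vE : f (vec m) = kap ^+ ev om m *
    f (wact (fun l => kap ^- om.1 l \*: X l) m.1 (kap ^- om.2 m.2 *: w m.2)).
  rewrite (vsE om kap m) linearZ /= /GRing.scale /= mulrA divff ?mul1r //.
  by rewrite expf_neq0 // gt_eqF.
rewrite vE normrM gtr0_norm ?exprn_gt0 // exprMn -exprM !mulrA -exprD addnC -mulrA.
apply: ler_pM => //; first by rewrite exprn_ge0 // ltW.
exact: ler_weXn2l.
Qed.

End Growth.

(** * Flows of linear functionals *)

Section Sums.
Variable R : realType.
Implicit Types (u v : nat -> R) (a : nat -> nat -> R) (l B : R).

Definition sums u l : Prop := (fun n => \sum_(i < n) u i) @ \oo --> l.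

Lemma sums_unique u l l' : sums u l -> sums u l' -> l = l'.
Proof. by move=> h h'; exact: (cvg_unique _ h h'). Qed.

Lemma sumsD u v l l' : sums u l -> sums v l' -> sums (fun i => u i + v i) (l + l').
Proof.
move=> h h'; rewrite /sums.
rewrite (_ : (fun n => _) = (fun n => \sum_(i < n) u i) \+ (fun n => \sum_(i < n) v i)).
  exact: cvgD.
by apply/funext => n /=; rewrite big_split.
Qed.

Lemma sumsZ u l (k : R) : sums u l -> sums (fun i => k * u i) (k * l).
Proof.
move=> h; rewrite /sums.
rewrite (_ : (fun n => _) = (fun n => k * \sum_(i < n) u i)); first exact: cvgMl_tmp.
by apply/funext => n /=; rewrite mulr_sumr.
Qed.

Lemma sumsB u v l l' : sums u l -> sums v l' -> sums (fun i => u i - v i) (l - l').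
Proof.
move=> h h'; have := sumsD h (@sumsZ _ _ (-1) h'); rewrite mulN1r.
by rewrite (_ : (fun i => _) = (fun i => u i - v i)) //; apply/funext => i; rewrite mulN1r.
Qed.

Lemma sums_le u l B : sums u l -> (forall n, \sum_(i < n) u i <= B) -> l <= B.
Proof.
move=> h uB; apply: (cvgr_to_le h).
by near=> n; exact: uB.
Unshelve. all: by end_near. Qed.

Lemma sums_ge u l n : (forall i, 0 <= u i) -> sums u l -> \sum_(i < n) u i <= l.
Proof.
move=> u0 h; apply: (cvgr_to_ge h).
near=> m; have nm : (n <= m)%N by near: m; exact: nbhs_infty_ge.
rewrite -(subnKC nm) big_split_ord /= lerDl; exact: sumr_ge0.
Unshelve. all: by end_near. Qed.

Lemma sums_exist0 u B : (forall i, 0 <= u i) -> (forall n, \sum_(i < n) u i <= B) ->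
  exists l, sums u l.
Proof.
move=> u0 uB; exists (limn (fun n => \sum_(i < n) u i)).
apply: nondecreasing_is_cvgn.
  apply/nondecreasing_seqP => n; rewrite big_ord_recr /= lerDl; exact: u0.
by exists B => _ [n _ <-].
Qed.

Lemma sums_exist u B : (forall n, \sum_(i < n) `|u i| <= B) -> exists l, sums u l.
Proof.
move=> uB.
have [l hl] : exists l, sums (fun i => `|u i|) l by apply: (sums_exist0 _ uB).
have [l' hl'] : exists l, sums (fun i => u i + `|u i|) l.
  apply: (@sums_exist0 _ (B + B)) => [i|n].
    by rewrite -lerBlDr sub0r; exact: lerNnormlW.
  rewrite big_split /=; apply: lerD; last exact: uB.
  apply: le_trans (uB n).
  by apply: ler_sum => i _; exact: ler_norm.
exists (l' - l); have := sumsB hl' hl.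
by rewrite (_ : (fun i => _) = u) //; apply/funext => i; rewrite addrK.
Qed.

Lemma sums_norm u l B : sums u l -> (forall n, \sum_(i < n) `|u i| <= B) -> `|l| <= B.
Proof.
move=> h uB; have hn : (fun n => `|\sum_(i < n) u i|) @ \oo --> `|l| by exact: cvg_norm.
apply: (cvgr_to_le hn).
by near=> n; apply: le_trans (uB n); exact: ler_norm_sum.
Unshelve. all: by end_near. Qed.

Definition diag a n : R := \sum_(i < n.+1) a i (n - i)%N.

Lemma diagE a n : \sum_(k < n) diag a k = \sum_(i < n) \sum_(j < n - i) a i j.
Proof.
elim: n => [|n IH]; first by rewrite !big_ord0.
rewrite big_ord_recr /= IH {}/diag [RHS]big_ord_recr /= subSnn big_ord1.
rewrite big_ord_recr /= subnn addrA; congr (_ + _).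
rewrite -big_split; apply: eq_bigr => i _ /=.
by rewrite subSn ?[in RHS]big_ord_recr //= ltnW.
Qed.

Lemma ler_sum_ord u m n : (forall i, 0 <= u i) -> (m <= n)%N ->
  \sum_(i < m) u i <= \sum_(i < n) u i.
Proof.
move=> u0 mn; rewrite -(subnKC mn) big_split_ord /= lerDl; exact: sumr_ge0.
Qed.

(** The triangle of side n lies in the square of side n, which lies in the triangle of side 2n;
    hence squares, rows and antidiagonals all have the same total. *)
Lemma double_sum0 a B : (forall i j, 0 <= a i j) ->
  (forall n, \sum_(i < n) \sum_(j < n) a i j <= B) ->
  exists r l, [/\ forall i, sums (a i) (r i), sums r l & sums (diag a) l].
Proof.
move=> a0 aB; pose q n := \sum_(i < n) \sum_(j < n) a i j.
have q_le m n : (m <= n)%N -> q m <= q n.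
  move=> mn; apply: (le_trans _ (@ler_sum_ord (fun i => \sum_(j < n) a i j) m n _ mn)).
    by apply: ler_sum => i _; exact: (@ler_sum_ord (a i)).
  by move=> i; exact: sumr_ge0.
have diag0 k : 0 <= diag a k by apply: sumr_ge0 => i _; exact: a0.
have dq n : \sum_(k < n) diag a k <= q n.
  by rewrite diagE; apply: ler_sum => i _; apply: (@ler_sum_ord (a i)) => //;
    exact: leq_subr.
have qd n : q n <= \sum_(k < n + n) diag a k.
  rewrite diagE; apply: le_trans (_ : \sum_(i < n) \sum_(j < n + n - i) a i j <= _).
    apply: ler_sum => i _; apply: (@ler_sum_ord (a i)) => //.
    by have := ltn_ord i; lia.
  apply: (@ler_sum_ord (fun i => \sum_(j < n + n - i) a i j)); last exact: leq_addr.
  by move=> i; exact: sumr_ge0.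
have [l hl] : exists l, sums (diag a) l.
  by apply: (sums_exist0 diag0) => n; apply: le_trans (dq n) (aB n).
have ql n : q n <= l by apply: le_trans (qd n) _; exact: sums_ge.
have row i n m : (i < n)%N -> \sum_(j < m) a i j <= q (maxn n m).
  move=> im; apply: le_trans (_ : \sum_(j < maxn n m) a i j <= _).
    by apply: (@ler_sum_ord (a i)) => //; exact: leq_maxr.
  have i' : (i < maxn n m)%N by rewrite leq_max im.
  rewrite /q [leRHS](bigD1 (Ordinal i')) //= lerDl.
  by apply: sumr_ge0 => k _; exact: sumr_ge0.
have /choice[r hr] : forall i, exists r, sums (a i) r.
  move=> i; apply: (@sums_exist0 _ l) => // n.
  by apply: le_trans (row i i.+1 n _) (ql _).
have r0 i : 0 <= r i by apply: le_trans (sums_ge 0 (a0 i) (hr i)); rewrite big_ord0.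
have rl n : \sum_(i < n) r i <= l.
  have h : sums (fun j => \sum_(i < n) a i j) (\sum_(i < n) r i).
    elim: n => [|n IH].
      rewrite big_ord0 /sums (_ : (fun n => _) = fun=> 0); first exact: cvg_cst.
      by apply/funext => n; rewrite big1 // => i _; rewrite big_ord0.
    rewrite big_ord_recr; have := sumsD IH (hr n).
    by rewrite (_ : (fun j => _) = (fun j => \sum_(i < n.+1) a i j)) //;
      apply/funext => j; rewrite big_ord_recr.
  apply: (sums_le h) => m; rewrite exchange_big /=.
  apply: le_trans (ql (maxn n m)).
  apply: le_trans (_ : \sum_(i < n) \sum_(j < maxn n m) a i j <= _).
    by apply: ler_sum => i _; apply: (@ler_sum_ord (a i)) => //; exact: leq_maxr.
  apply: (@ler_sum_ord (fun i => \sum_(j < maxn n m) a i j)); last exact: leq_maxl.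
  by move=> i; exact: sumr_ge0.
have [l' hl'] := sums_exist0 r0 rl.
exists r, l; split=> //; suff -> : l = l' by [].
apply/eqP; rewrite eq_le; apply/andP; split; last exact: sums_le hl' rl.
apply: (sums_le hl) => n; apply: le_trans (dq n) _.
apply: le_trans (sums_ge n r0 hl'); apply: ler_sum => i _.
exact: sums_ge.
Qed.

Lemma double_sum a B : (forall n, \sum_(i < n) \sum_(j < n) `|a i j| <= B) ->
  exists r l, [/\ forall i, sums (a i) (r i), sums r l & sums (diag a) l].
Proof.
move=> aB.
have [r [l [h1 h2 h3]]] := @double_sum0 (fun i j => `|a i j|) B
  (fun i j => normr_ge0 _) aB.
have [|n|r' [l' [h1' h2' h3']]] := @double_sum0 (fun i j => a i j + `|a i j|) (B + B).
- by move=> i j; rewrite -lerBlDr sub0r; exact: lerNnormlW.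
- apply: le_trans (_ : \sum_(i < n) \sum_(j < n) (`|a i j| + `|a i j|) <= _).
    by do 2 (apply: ler_sum => ? _); rewrite lerD2r ler_norm.
  under eq_bigr do rewrite big_split /=.
  by rewrite big_split; exact: lerD.
exists (fun i => r' i - r i), (l' - l); split.
- move=> i; have := sumsB (h1' i) (h1 i).
  by rewrite (_ : (fun i => _) = a i) //; apply/funext => j; rewrite addrK.
- exact: sumsB.
- have := sumsB h3' h3; rewrite (_ : (fun i => _) = diag a) //.
  apply/funext => n; rewrite /diag -sumrB; apply: eq_bigr => j _.
  by rewrite addrK.
Qed.

End Sums.

Section ExpSums.
Variable R : realType.
Implicit Types (x y s : R).

Lemma sums_exp x : sums (fun i => x ^+ i / i`!%:R) (expR x).
Proof.
have h := is_cvg_series_exp_coeff x; rewrite /sums /expR.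
rewrite (_ : (fun n => _) = series (exp_coeff x)) //.
by apply/funext => n; rewrite /series /= big_mkord.
Qed.

Lemma exp_partial x n : 0 <= x -> \sum_(i < n) x ^+ i / i`!%:R <= expR x.
Proof.
move=> x0; apply: (sums_ge n _ (@sums_exp x)) => i.
by rewrite divr_ge0 // exprn_ge0.
Qed.

Lemma exprD_fact x y n :
  (x + y) ^+ n / n`!%:R =
  \sum_(i < n.+1) x ^+ i / i`!%:R * (y ^+ (n - i) / (n - i)`!%:R).
Proof.
rewrite addrC exprDn mulr_suml; apply: eq_bigr => i _.
have in' : (i <= n)%N by rewrite -ltnS ltn_ord.
have f0 k : k`!%:R != 0 :> R by rewrite pnatr_eq0 -lt0n fact_gt0.
have e : n`!%:R = 'C(n, i)%:R * (i`!%:R * (n - i)`!%:R) :> R.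
  by rewrite -!natrM bin_fact.
have b0 : 'C(n, i)%:R != 0 :> R by rewrite pnatr_eq0 -lt0n bin_gt0.
rewrite e -mulr_natr; set c := 'C(n, i)%:R in b0 *.
by field; rewrite !f0 b0.
Qed.

End ExpSums.

Section HeatFamily.
Variable R : realType.
Implicit Types (Psi : R -> nat -> R) (tau c : R).

(* A family that absorbs Taylor shifts, as the derivatives at tau of an entire
   function with nonnegative Taylor coefficients do. *)
Definition heat Psi : Prop := (forall tau m, 0 <= tau -> 0 <= Psi tau m) /\
  forall tau c H m, 0 <= tau -> 0 <= c ->
    \sum_(h < H) c ^+ h / h`!%:R * Psi tau (m + h)%N <= Psi (tau + c) m.

Lemma heat_mono Psi tau tau' m : heat Psi -> 0 <= tau -> tau <= tau' ->
  Psi tau m <= Psi tau' m.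
Proof.
move=> [_ h] t0 tt; have := h tau (tau' - tau) 1%N m t0.
rewrite subr_ge0 big_ord1 expr0 fact0 invr1 mulr1 mul1r addn0 addrC subrK.
exact.
Qed.

Lemma heat_exists (Phi : nat -> R) : (forall m, 0 <= Phi m) ->
  (forall tau m, 0 <= tau -> exists B, forall H,
     \sum_(h < H) tau ^+ h / h`!%:R * Phi (m + h)%N <= B) ->
  exists2 Psi, heat Psi & forall m, Phi m <= Psi 0 m.
Proof.
move=> Phi0 PhiB.
have t0 tau m h : 0 <= tau -> 0 <= tau ^+ h / h`!%:R * Phi (m + h)%N.
  by move=> tau0; rewrite mulr_ge0 // divr_ge0 // exprn_ge0.
have /choice[P hP] : forall q : R * nat, exists l, 0 <= q.1 ->
    sums (fun h => q.1 ^+ h / h`!%:R * Phi (q.2 + h)%N) l.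
  move=> [tau m] /=; have [tau0|] := boolP (0 <= tau); last by exists 0.
  have [B hB] := PhiB tau m tau0.
  by have [l hl] := sums_exist0 (fun h => t0 tau m h tau0) hB; exists l.
exists (fun tau m => P (tau, m)); last first.
  move=> m; have := sums_ge 1 (fun h => t0 0 m h (lexx 0)) (hP (0, m) (lexx 0)).
  by rewrite big_ord1 expr0 fact0 invr1 mulr1 mul1r addn0.
split=> [tau m tau0|tau c H m tau0 c0].
  by have := sums_ge 0 (fun h => t0 tau m h tau0) (hP (tau, m) tau0); rewrite big_ord0.
have : sums (fun k => \sum_(h < H) c ^+ h / h`!%:R *
    (tau ^+ k / k`!%:R * Phi (m + h + k)%N))
    (\sum_(h < H) c ^+ h / h`!%:R * P (tau, (m + h)%N)).
  elim: H => [|H IH].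
    rewrite big_ord0 /sums (_ : (fun n => _) = fun=> 0); first exact: cvg_cst.
    by apply/funext => n; rewrite big1 // => i _; rewrite big_ord0.
  rewrite big_ord_recr /=; have := sumsD IH (@sumsZ _ _ _ (c ^+ H / H`!%:R) (hP (tau, (m + H)%N) tau0)).
  by congr (sums _ _); apply/funext => k; rewrite big_ord_recr.
move/sums_le; apply=> N; rewrite exchange_big /=.
pose a h k := c ^+ h / h`!%:R * (tau ^+ k / k`!%:R * Phi (m + h + k)%N).
have a0 h k : 0 <= a h k by rewrite mulr_ge0 ?t0 // divr_ge0 // exprn_ge0.
pose M := maxn H N.
apply: le_trans (_ : \sum_(i < M + M) diag a i <= _).
  rewrite diagE; apply: le_trans (_ : \sum_(h < H) \sum_(k < M + M - h) a h k <= _).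
    apply: ler_sum => h _; apply: (@ler_sum_ord _ (a h)) => //.
    by have := ltn_ord h; rewrite /M; lia.
  apply: (@ler_sum_ord _ (fun h => \sum_(k < M + M - h) a h k)).
    by move=> h; exact: sumr_ge0.
  by rewrite /M; lia.
have tc0 : 0 <= tau + c by rewrite addr_ge0.
have := sums_ge (M + M) (fun h => t0 (tau + c) m h tc0) (hP (tau + c, m) tc0).
apply: le_trans; apply: ler_sum => n _.
rewrite addrC exprD_fact mulr_suml le_eqVlt; apply/orP; left; apply/eqP.
apply: eq_bigr => i _; rewrite /a !mulrA; congr (_ * Phi _).
by rewrite -addnA subnKC // -ltnS.
Qed.

End HeatFamily.

Section GrowthSummable.
Variables (R : realType) (S : nat).
Hypothesis S_gt0 : (0 < S)%N.
Implicit Types (x B C tau : R).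

Lemma fact_gt0R n : 0 < n`!%:R :> R. Proof. by rewrite ltr0n fact_gt0. Qed.

(** The indices [h] are grouped by their quotient by [S]: each group of [S] terms is at most
    [S * x ^+ S] times one term of the exponential series at [x ^+ S]. *)
Lemma lacunary_exp x H : 1 <= x ->
  \sum_(h < H) x ^+ h / (h %/ S)`!%:R <= S%:R * x ^+ S * expR (x ^+ S).
Proof.
move=> x1; have x0 : 0 <= x by apply: le_trans x1.
have t0 h : 0 <= x ^+ h / (h %/ S)`!%:R by rewrite divr_ge0 ?exprn_ge0.
apply: le_trans (_ : \sum_(h < S * H) x ^+ h / (h %/ S)`!%:R <= _).
  by apply: (ler_sum_ord t0); rewrite leq_pmull.
apply: le_trans (_ : S%:R * x ^+ S * \sum_(q < H) (x ^+ S) ^+ q / q`!%:R <= _).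
  elim: H => [|H IH]; first by rewrite muln0 !big_ord0 mulr0.
  rewrite mulnS addnC big_split_ord /= big_ord_recr /= mulrDr; apply: lerD => //.
  apply: le_trans (_ : \sum_(i < S) x ^+ S * ((x ^+ S) ^+ H / H`!%:R) <= _).
    apply: ler_sum => i _; rewrite mulnC divnMDl // divn_small ?addn0 //.
    rewrite mulrA; apply: ler_wpM2r; first by rewrite invr_ge0 ltW ?fact_gt0R.
    rewrite mulnC exprD exprM mulrC; apply: ler_wpM2r; first by rewrite !exprn_ge0.
    by apply: ler_weXn2l => //; exact: ltnW.
  by rewrite sumr_const card_ord -[_ *+ S]mulr_natl -!mulrA.
apply: ler_wpM2l; first by rewrite mulr_ge0 ?exprn_ge0.
by apply: exp_partial; rewrite exprn_ge0.
Qed.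

Lemma pow_le_fact m : (m.+1%:R : R) ^+ m <= expR m.+1%:R * m`!%:R.
Proof.
rewrite -ler_pdivrMr ?fact_gt0R //; apply: le_trans (exp_partial m.+1 (ler0n _ _)).
rewrite big_ord_recr /= lerDr; apply: sumr_ge0 => i _.
by rewrite divr_ge0 // exprn_ge0.
Qed.

Lemma bin_le_exp k h : ('C(k, h) <= 2 ^ k)%N.
Proof.
elim: k h => [|k IH] [|h] //; first by rewrite bin0 expn_gt0.
by rewrite binS expnS mul2n -addnn leq_add.
Qed.

(** Here the proper fraction pays off. Up to a factor const^k, the power is at most k! / (k %/ S)!,
    and k! = C(k, h) h! m! is absorbed by the h! of the series and a factor 2^k; the denominator (h
    %/ S)! that is left over makes the sum converge for every [tau]. *)
Lemma growth_summable C B tau m : 0 <= C -> 0 <= B -> 0 <= tau ->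
  exists Bd, forall H, \sum_(h < H) tau ^+ h / h`!%:R *
    (C * B ^+ (m + h) * (S * (m + h).+1)%:R ^+ (m + h - (m + h) %/ S)) <= Bd.
Proof.
move=> C0 B0 tau0; pose e : R := expR 1.
have e0 : 0 <= e by exact: expR_ge0.
pose Q := S%:R * e * B; have Q0 : 0 <= Q by rewrite !mulr_ge0.
have bound k : (S * k.+1)%:R ^+ (k - k %/ S) <= (S%:R * e) ^+ k * e * (k`!%:R / (k %/ S)`!%:R) :> R.
  set p := (k %/ S)%N; have pk : (p <= k)%N by exact: leq_div.
  rewrite mulrA ler_pdivlMr ?fact_gt0R // natrM exprMn.
  have -> : (S%:R * e) ^+ k * e * k`!%:R = S%:R ^+ k * (expR k.+1%:R * k`!%:R).
    rewrite exprMn -[in RHS]natr1 expRD -[k%:R]mulr1 expRM_natl -/e; ring.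
  rewrite -mulrA; apply: ler_pM; rewrite ?exprn_ge0 ?mulr_ge0 ?exprn_ge0 //.
    by apply: ler_weXn2l; rewrite ?ler1n ?leq_subr.
  apply: le_trans (pow_le_fact k).
  rewrite -[X in _ <= _ ^+ X](subnK pk) exprD; apply: ler_wpM2l; first by rewrite exprn_ge0.
  rewrite -natrX ler_nat; elim: (p) pk => // j IH jk.
  by rewrite factS expnS leq_mul ?IH ?(ltnW jk) // ltnW.
pose x := Num.max 1 (2 * tau * Q).
have x1 : 1 <= x by rewrite le_max lexx.
exists (C * e * (2 * Q) ^+ m * m`!%:R * (S%:R * x ^+ S * expR (x ^+ S))) => H.
apply: le_trans (ler_wpM2l _ (lacunary_exp H x1)); last first.
  by rewrite !mulr_ge0 ?exprn_ge0 ?mulr_ge0.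
rewrite mulr_sumr; apply: ler_sum => h _; set k := (m + h)%N.
apply: le_trans (_ : tau ^+ h / h`!%:R * (C * B ^+ k * ((S%:R * e) ^+ k * e * (k`!%:R / (k %/ S)`!%:R))) <= _).
  apply: ler_wpM2l; first by rewrite divr_ge0 ?exprn_ge0.
  by apply: ler_wpM2l (bound k); rewrite mulr_ge0 ?exprn_ge0.
have kE : k`!%:R = 'C(k, h)%:R * (h`!%:R * m`!%:R) :> R.
  by rewrite -!natrM -(@bin_fact k h) ?leq_addl // /k addnK.
have f0 j : j`!%:R != 0 :> R by rewrite gt_eqF ?fact_gt0R.
have -> : tau ^+ h / h`!%:R * (C * B ^+ k * ((S%:R * e) ^+ k * e * (k`!%:R / (k %/ S)`!%:R)))
   = C * e * m`!%:R * (tau ^+ h * Q ^+ k * 'C(k, h)%:R / (k %/ S)`!%:R).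
  by rewrite kE /Q !exprMn; field; rewrite !f0.
have -> : C * e * (2 * Q) ^+ m * m`!%:R * (x ^+ h / (h %/ S)`!%:R) =
   C * e * m`!%:R * ((2 * Q) ^+ m * x ^+ h / (h %/ S)`!%:R) by field; rewrite f0.
apply: ler_wpM2l; first by rewrite !mulr_ge0.
apply: ler_pM; rewrite ?mulr_ge0 ?exprn_ge0 ?invr_ge0 //; last first.
  by rewrite lef_pV2 ?posrE ?fact_gt0R // ler_nat leq_fact // leq_div2r ?leq_addl.
apply: le_trans (_ : tau ^+ h * Q ^+ k * 2 ^+ k <= _).
  apply: ler_wpM2l; first by rewrite mulr_ge0 ?exprn_ge0.
  by rewrite -natrX ler_nat bin_le_exp.
rewrite /k !exprD; have -> : tau ^+ h * (Q ^+ m * Q ^+ h) * (2 ^+ m * 2 ^+ h) =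
  (2 * Q) ^+ m * (2 * tau * Q) ^+ h by rewrite !exprMn; ring.
apply: ler_wpM2l; first by rewrite exprn_ge0 ?mulr_ge0.
apply: lerXn2r.
- by rewrite nnegrE !mulr_ge0.
- by rewrite nnegrE (le_trans ler01).
by rewrite le_max lexx orbT.
Qed.

End GrowthSummable.

(** * The flow exp(tE) on functionals *)

Section Flow.
Variables (R : realType) (V : lmodType R[i]) (L : finType).
Variables (d : L -> nat) (dmax : nat) (X : L -> {linear V -> V}).
Variables (E : {linear V -> V}) (Z : set V).
Hypothesis d_gt0 : forall l, (0 < d l)%N.
Hypothesis d_max : forall l, (d l <= dmax)%N.
Hypothesis EX : forall l v, E (X l v) = X l (E v + (d l)%:R *: v).
Hypothesis hZ : subsp Z.
Hypothesis XZ : forall l z, Z z -> Z (X l z).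
Hypothesis EZ : forall z, Z z -> Z (E z).
Implicit Types (g : V -> R) (k : R[i]) (ga : seq L) (Psi : R -> nat -> R).

(** Behind a word of degree [D] the operator [E] acts as [E + D]; these are its powers. *)
Definition shiftpow (D j : nat) : {poly R[i]} := ('X + D%:R%:P) ^+ j.

Lemma shiftpow0 j : shiftpow 0 j = 'X^j.
Proof. by rewrite /shiftpow polyC0 addr0. Qed.

Lemma shiftpowS D j v :
  pev E (shiftpow D j.+1) v = pev E (shiftpow D j) (E v + D%:R *: v).
Proof. by rewrite /shiftpow exprSr pevM pevD pevX pevC. Qed.

Lemma shiftpow_X D j l v :
  pev E (shiftpow D j) (X l v) = X l (pev E (shiftpow (D + d l) j) v).
Proof.
elim: j v => [|j IH] v; first by rewrite !pev1.
rewrite !shiftpowS -IH; congr (pev _ _ _).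
by rewrite EX addnC natrD scalerDl addrA [in RHS]raddfD /= linearZ.
Qed.

Lemma shiftpow_word D j ga v : pev E (shiftpow D j) (wact X ga v) =
  wact X ga (pev E (shiftpow (D + tot d ga) j) v).
Proof.
elim: ga D => [|l ga IH] D; first by rewrite addn0.
by rewrite /= shiftpow_X IH tot_cons addnA.
Qed.

Lemma shiftpowE D n v : pev E (shiftpow D n) v =
  \sum_(i < n.+1) (D%:R ^+ (n - i) *: pev E 'X^i v) *+ 'C(n, i).
Proof.
rewrite /shiftpow addrC exprDn pev_sum; apply: eq_bigr => i _.
by rewrite pevMn pevM -rmorphXn pevC.
Qed.

(** Functions are real valued and merely additive: the flow is applied to the real and the imaginary
    part of a complex functional separately, so that only real series occur. *)
Definition additive_fun g : Prop := forall u v, g (u + v) = g u + g v.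

Lemma additive0 g : additive_fun g -> g 0 = 0.
Proof. by move=> ga; apply: (addrI (g 0)); rewrite -ga !addr0. Qed.

Lemma additive_sum g (I : Type) (r : seq I) (P : pred I) (F : I -> V) : additive_fun g ->
  g (\sum_(i <- r | P i) F i) = \sum_(i <- r | P i) g (F i).
Proof.
move=> ga; elim/big_rec2: _ => [|i y1 y2 _ <-]; first exact: additive0.
exact: ga.
Qed.

Lemma additiveMn g v n : additive_fun g -> g (v *+ n) = g v *+ n.
Proof.
move=> ga; elim: n => [|n IH]; first by rewrite !mulr0n additive0.
by rewrite !mulrS ga IH.
Qed.

Definition kills g : Prop := forall z, Z z -> g z = 0.

Definition summable g v : Prop := forall s : R, 0 <= s -> exists B, forall J,
  \sum_(j < J) s ^+ j / j`!%:R * `|g (pev E 'X^j v)| <= B.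

Definition regular g : Prop := [/\ additive_fun g, kills g & forall v, summable g v].

Definition flow (t : R) g v : R :=
  limn (fun n => \sum_(i < n) t ^+ i / i`!%:R * g (pev E 'X^i v)).

Lemma sums_flow t g v : regular g -> `|t| = 1 ->
  sums (fun i => t ^+ i / i`!%:R * g (pev E 'X^i v)) (flow t g v).
Proof.
move=> [_ _ /(_ v 1 ler01)[B hB]] t1.
have [l hl] : exists l, sums (fun i => t ^+ i / i`!%:R * g (pev E 'X^i v)) l.
  apply: (@sums_exist _ _ B) => n; apply: le_trans (hB n); apply: ler_sum => i _.
  rewrite !normrM normfV normrX t1 [`|i`!%:R|]ger0_norm //.
by rewrite /flow (cvg_lim _ hl).
Qed.

Lemma flow_additive t g : regular g -> `|t| = 1 -> additive_fun (flow t g).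
Proof.
move=> rg t1 u v; have [ga _ _] := rg.
have h := sumsD (@sums_flow t g u rg t1) (@sums_flow t g v rg t1).
apply: (sums_unique _ h); have := @sums_flow t g (u + v) rg t1.
by congr sums; apply/funext => i; rewrite raddfD ga mulrDr.
Qed.

Lemma flow_kills t g : regular g -> `|t| = 1 -> kills (flow t g).
Proof.
move=> rg t1 z Zz; have [ga gZ _] := rg; apply: (sums_unique (@sums_flow t g z rg t1)).
rewrite /sums (_ : (fun n => _) = fun=> 0); first exact: cvg_cst.
apply/funext => n; rewrite big1 // => i _; rewrite gZ ?mulr0 //.
exact: pev_stable.
Qed.

(** This is exp(E) exp(-E) = 1: the n-th antidiagonal of the double series carries the coefficient
    (1 - 1)^n / n!. Absolute convergence of the double series is summability of [g] at 2 = 1 + 1. *)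
Lemma flowK g v : regular g -> regular (flow (-1) g) -> flow 1 (flow (-1) g) v = g v.
Proof.
move=> rg rg'; have [ga gZ gs] := rg.
pose a i j := 1 ^+ i / i`!%:R * ((-1) ^+ j / j`!%:R * g (pev E 'X^j (pev E 'X^i v))).
have [B hB] := gs v 2 ltac:(by []).
have [r [l [h1 h2 h3]]] : exists r l, [/\ forall i, sums (a i) (r i), sums r l & sums (diag a) l].
  apply: (@double_sum _ a B) => n; apply: le_trans (hB (n + n)%N).
  pose b i j := 1 ^+ i / i`!%:R * (1 ^+ j / j`!%:R * `|g (pev E 'X^(i + j) v)|).
  have b0 i j : 0 <= b i j by rewrite !mulr_ge0 ?invr_ge0 ?expr1n.
  have ab i j : `|a i j| = b i j.
    rewrite /a /b -pevM -exprD addnC !normrM !normfV !normrX normrN !normr1 !expr1n.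
    by rewrite !normr_nat.
  have -> : \sum_(j < n + n) 2 ^+ j / j`!%:R * `|g (pev E 'X^j v)| = \sum_(j < n + n) diag b j.
    apply: eq_bigr => j _; rewrite (_ : 2 = 1 + 1 :> R) // exprD_fact mulr_suml.
    apply: eq_bigr => i _; rewrite /b -!mulrA subnKC // -ltnS //.
  rewrite diagE; apply: le_trans (_ : \sum_(i < n) \sum_(j < n + n - i) b i j <= _).
    apply: ler_sum => i _; under eq_bigr do rewrite ab.
    by apply: (@ler_sum_ord _ (b i)) => //; have := ltn_ord i; lia.
  apply: (@ler_sum_ord _ (fun i => \sum_(j < n + n - i) b i j)); last exact: leq_addr.
  by move=> i; exact: sumr_ge0.
have rE i : r i = 1 ^+ i / i`!%:R * flow (-1) g (pev E 'X^i v).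
  apply: (sums_unique (h1 i)); apply: sumsZ; apply: sums_flow => //.
  by rewrite normrN normr1.
have -> : flow 1 (flow (-1) g) v = l.
  apply: (sums_unique (@sums_flow 1 _ v rg' (normr1 _))).
  by move: h2; congr sums; apply/funext => i; rewrite rE.
apply: (sums_unique h3); rewrite /sums -cvg_shiftS /=.
rewrite (_ : (fun n => _) = fun=> g v); first exact: cvg_cst.
apply/funext => n; rewrite big_ord_recl big1 ?addr0.
  by rewrite /diag big_ord1 /a !expr0 fact0 invr1 !mul1r !pev1.
move=> i _; rewrite lift0 /diag.
have -> : \sum_(j < i.+2) a j (i.+1 - j)%N =
   (1 - 1) ^+ i.+1 / i.+1`!%:R * g (pev E 'X^(i.+1) v).
  rewrite exprD_fact mulr_suml; apply: eq_bigr => j _.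
  by rewrite /a -pevM -exprD subnK ?mulrA // -ltnS.
by rewrite subrr expr0n !mul0r.
Qed.

Section Generators.

Variables (I : finType) (w : I -> V) (a : I -> I -> R[i]) (b : I -> L -> I -> R[i]).
Variables (A beta : R).
Hypothesis Ew : forall i, exists2 z, Z z & E (w i) =
  z + \sum_j a i j *: w j + \sum_l \sum_j b i l j *: X l (w j).
Hypothesis aA : forall i, \sum_j normc (a i j) <= A.
Hypothesis bB : forall i, \sum_l \sum_j normc (b i l j) <= beta.
Hypothesis A_ge0 : 0 <= A.
Hypothesis beta_ge0 : 0 <= beta.

(** The scalar [k] sits inside the argument because [g] is not linear over the complex numbers. The
    exponent of [rho] records degree, whereas [P] sees only length. *)
Definition bounded g (C rho : R) (P : nat -> R) : Prop := forall k ga i,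
  `|g (k *: wact X ga (w i))| <= normc k * C * rho ^+ tot d ga * P (size ga).

(** Bound for [E + D] applied [j] times: [h] of the factors append a letter at the price [be], and
    each of the others multiplies by at most [A + D], plus [dmax] for every letter already
    appended. *)
Definition iter_majorant (be : R) (P : nat -> R) (j D m : nat) : R :=
  \sum_(h < j.+1) 'C(j, h)%:R * be ^+ h * (A + D%:R + dmax%:R * h%:R) ^+ (j - h)
    * P (m + h)%N.

Lemma normc_ge0 (k : R[i]) : 0 <= normc k.
Proof. by case: k => x y; rewrite sqrtr_ge0. Qed.

Lemma iter_majorant_ge0 be P j D m : 0 <= be -> (forall m, 0 <= P m) ->
  0 <= iter_majorant be P j D m.
Proof.
move=> be0 P0; apply: sumr_ge0 => h _.
by rewrite !mulr_ge0 // exprn_ge0 // !addr_ge0 // mulr_ge0.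
Qed.

Lemma iter_majorantS be P j D m : 0 <= be -> (forall m, 0 <= P m) ->
  (A + D%:R) * iter_majorant be P j D m + be * iter_majorant be P j (D + dmax) m.+1
    <= iter_majorant be P j.+1 D m.
Proof.
move=> be0 P0; pose Ah h := A + D%:R + dmax%:R * h%:R.
have Ah0 h : 0 <= Ah h by rewrite !addr_ge0 // mulr_ge0.
have -> : iter_majorant be P j.+1 D m =
    \sum_(h < j.+2) 'C(j, h)%:R * be ^+ h * Ah h ^+ (j.+1 - h) * P (m + h)%N +
    \sum_(h < j.+1) 'C(j, h)%:R * be ^+ h.+1 * Ah h.+1 ^+ (j - h) * P (m + h.+1)%N.
  rewrite /iter_majorant big_ord_recl [in RHS]big_ord_recl -[RHS]addrA; congr (_ + _).
    by rewrite /Ah !bin0.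
  rewrite -big_split; apply: eq_bigr => h _ /=.
  by rewrite /bump /= !add1n binS natrD subSS /Ah; ring.
rewrite big_ord_recr /= bin_small // !mul0r addr0 /iter_majorant !mulr_sumr.
apply: lerD; apply: ler_sum => h _.
  have -> : 'C(j, h)%:R * be ^+ h * Ah h ^+ (j.+1 - h) * P (m + h)%N =
      Ah h * ('C(j, h)%:R * be ^+ h * Ah h ^+ (j - h) * P (m + h)%N).
    by rewrite subSn ?exprS -1?ltnS //; ring.
  apply: ler_wpM2r; first by rewrite !mulr_ge0 ?exprn_ge0 //; exact: (Ah0 h).
  by rewrite /Ah lerDl mulr_ge0.
rewrite addSnnS le_eqVlt; apply/orP; left; apply/eqP.
have -> : A + (D + dmax)%:R + dmax%:R * h%:R = Ah h.+1 by rewrite /Ah natrD -natr1; ring.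
by rewrite exprS; ring.
Qed.

Lemma iter_majorantD be P j D D' m : 0 <= be -> (forall m, 0 <= P m) -> (D <= D')%N ->
  iter_majorant be P j D m <= iter_majorant be P j D' m.
Proof.
move=> be0 P0 DD; apply: ler_sum => h _; apply: ler_wpM2r => //.
apply: ler_wpM2l; first by rewrite mulr_ge0 // exprn_ge0.
by apply: lerXn2r; rewrite ?nnegrE ?addr_ge0 ?mulr_ge0 // !lerD2r lerD2l ler_nat.
Qed.

Lemma normc_nat n : normc (n%:R : R[i]) = n%:R.
Proof. by rewrite normcMn Normc.normc1. Qed.

Lemma iter_bound g C rho P j D k ga i : additive_fun g -> kills g ->
  0 <= C -> 0 <= rho -> rho <= 1 -> (forall m, 0 <= P m) -> bounded g C rho P ->
  `|g (k *: wact X ga (pev E (shiftpow D j) (w i)))| <=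
    normc k * C * rho ^+ tot d ga * iter_majorant (beta * rho) P j D (size ga).
Proof.
move=> ga0 gZ C0 r0 r1 P0 hb.
have br0 : 0 <= beta * rho by exact: mulr_ge0.
elim: j D k ga i => [|j IH] D k ga i.
  rewrite pev1; apply: le_trans (hb k ga i) _.
  by rewrite /iter_majorant big_ord1 bin0 !expr0 !mul1r addn0.
rewrite shiftpowS; have [z Zz ->] := Ew i.
pose f v := g (k *: wact X ga (pev E (shiftpow D j) v)).
have fD : additive_fun f by move=> u v; rewrite /f !raddfD ga0.
rewrite -/(f _) !fD !additive_sum //.
have -> : f z = 0.
  by apply: gZ; apply: (subspZ hZ); apply: (wactZ XZ); exact: pev_stable.
have cst0 : 0 <= C * rho ^+ tot d ga by rewrite mulr_ge0 ?exprn_ge0.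
set T := iter_majorant (beta * rho) P j.
have T0 D' m : 0 <= T D' m by exact: iter_majorant_ge0.
set q := normc k * C * rho ^+ tot d ga.
have q0 : 0 <= q by rewrite /q -mulrA mulr_ge0 ?normc_ge0.
have hs (e : R[i]) l : `|f (e *: w l)| <= normc e * (q * T D (size ga)).
  rewrite /f !linearZ /= scalerA; apply: le_trans (IH _ _ _ _) _.
  by rewrite Normc.normcM -/(T D _) /q le_eqVlt; apply/orP; left; apply/eqP; ring.
have hX (e : R[i]) l l' : `|f (e *: X l (w l'))| <=
    normc e * (q * (rho * T (D + dmax)%N (size ga).+1)).
  rewrite /f !linearZ /= scalerA shiftpow_X.
  have -> : wact X ga (X l (pev E (shiftpow (D + d l) j) (w l'))) =
      wact X (rcons ga l) (pev E (shiftpow (D + d l) j) (w l')).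
    by rewrite -cats1 wact_cat.
  apply: le_trans (IH _ _ _ _) _.
  have -> : tot d (rcons ga l) = (tot d ga + d l)%N.
    by rewrite -cats1 tot_cat /tot /= addn0.
  rewrite Normc.normcM size_rcons exprD -/(T _ _).
  have -> : normc e * normc k * C * (rho ^+ tot d ga * rho ^+ d l) *
      T (D + d l)%N (size ga).+1 =
    normc e * (q * (rho ^+ d l * T (D + d l)%N (size ga).+1)) by rewrite /q; ring.
  apply: ler_wpM2l; first exact: normc_ge0.
  apply: ler_wpM2l => //; apply: ler_pM; rewrite ?exprn_ge0 //.
    by rewrite -[leRHS]expr1; apply: ler_wiXn2l.
  by apply: iter_majorantD; rewrite // leq_add2l.
apply: le_trans (_ : q * ((A + D%:R) * T D (size ga) +
    beta * rho * T (D + dmax)%N (size ga).+1) <= _); last first.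
  by apply: ler_wpM2l => //; exact: iter_majorantS.
rewrite add0r; apply: le_trans (ler_normD _ _) _.
apply: le_trans (lerD (ler_normD _ _) (lexx _)) _.
have -> : q * ((A + D%:R) * T D (size ga) + beta * rho * T (D + dmax)%N (size ga).+1) =
  A * (q * T D (size ga)) + beta * (q * (rho * T (D + dmax)%N (size ga).+1)) +
  D%:R * (q * T D (size ga)) by ring.
apply: lerD; first apply: lerD.
- apply: le_trans (ler_norm_sum _ _ _) _.
  apply: le_trans (ler_sum _ (fun l _ => hs (a i l) l)) _.
  by rewrite -mulr_suml; apply: ler_wpM2r => //; exact: mulr_ge0.
- apply: le_trans (ler_norm_sum _ _ _) _.
  apply: le_trans (_ : \sum_l \sum_l' normc (b i l l') * (q * (rho * T (D + dmax)%N (size ga).+1)) <= _).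
    apply: ler_sum => l _; rewrite additive_sum //.
    by apply: le_trans (ler_norm_sum _ _ _) _; apply: ler_sum => l' _.
  under eq_bigr do rewrite -mulr_suml.
  rewrite -mulr_suml; apply: ler_wpM2r; last exact: bB.
  by apply: mulr_ge0 => //; exact: mulr_ge0.
- by rewrite -[X in _ <= X * _]normc_nat; exact: hs.
Qed.

(** Summing first over [j], with the number [h] of appended letters fixed, turns the powers of
    [A + D + dmax h] into an exponential. What remains is a series in [s * be * exp(s * dmax)] that
    the heat family absorbs by advancing its parameter. *)
Lemma exp_bound g C rho Psi tau s k ga i D J : additive_fun g -> kills g ->
  0 <= C -> 0 <= rho -> rho <= 1 -> heat Psi -> 0 <= tau -> 0 <= s ->
  bounded g C rho (Psi tau) ->
  \sum_(j < J) s ^+ j / j`!%:R * `|g (k *: wact X ga (pev E (shiftpow D j) (w i)))|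
    <= normc k * C * rho ^+ tot d ga * (expR (s * (A + D%:R)) *
         Psi (tau + s * (beta * rho) * expR (s * dmax%:R)) (size ga)).
Proof.
move=> g_add gZ C0 r0 r1 hP tau0 s0 hb.
set be := beta * rho; have be0 : 0 <= be by exact: mulr_ge0.
have P0 m : 0 <= Psi tau m by apply: hP.1.
set q := normc k * C * rho ^+ tot d ga.
have q0 : 0 <= q by rewrite !mulr_ge0 ?normc_ge0 ?exprn_ge0.
set m := size ga; pose Ah (h : nat) := A + D%:R + dmax%:R * h%:R.
have Ah0 h : 0 <= Ah h by rewrite !addr_ge0 // mulr_ge0.
apply: le_trans (_ : q * \sum_(j < J) s ^+ j / j`!%:R * iter_majorant be (Psi tau) j D m <= _).
  rewrite mulr_sumr; apply: ler_sum => j _; rewrite mulrCA; apply: ler_wpM2l.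
    by rewrite divr_ge0 // exprn_ge0.
  exact: iter_bound.
apply: ler_wpM2l => //.
pose al h r := (s * be) ^+ h / h`!%:R * Psi tau (m + h)%N * ((s * Ah h) ^+ r / r`!%:R).
have a0 h r : 0 <= al h r by rewrite !mulr_ge0 ?invr_ge0 ?exprn_ge0 // mulr_ge0.
have -> : \sum_(j < J) s ^+ j / j`!%:R * iter_majorant be (Psi tau) j D m =
    \sum_(j < J) diag al j.
  apply: eq_bigr => j _; rewrite /iter_majorant mulr_sumr; apply: eq_bigr => h _.
  have hj : (h <= j)%N by rewrite -ltnS.
  have f0 n : n`!%:R != 0 :> R by rewrite pnatr_eq0 -lt0n fact_gt0.
  have e : j`!%:R = 'C(j, h)%:R * (h`!%:R * (j - h)`!%:R) :> R.
    by rewrite -!natrM bin_fact.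
  have b0 : 'C(j, h)%:R != 0 :> R by rewrite pnatr_eq0 -lt0n bin_gt0.
  rewrite /al e -/(Ah h) -[X in s ^+ X](subnKC hj) exprD !exprMn.
  move: ('C(j, h)%:R) b0 => cj b0; move: (be ^+ h) (s ^+ h) (s ^+ (j - h)) => x1 x2 x3.
  by move: (Ah h ^+ (j - h)) (Psi _ _) => x4 x5; field; rewrite b0 !f0.
rewrite diagE; apply: le_trans (_ : \sum_(h < J) (s * be) ^+ h / h`!%:R * Psi tau (m + h)%N
    * expR (s * Ah h) <= _).
  apply: ler_sum => h _; rewrite -mulr_sumr; apply: ler_wpM2l.
    by rewrite !mulr_ge0 ?invr_ge0 ?exprn_ge0 // mulr_ge0.
  by apply: exp_partial; exact: mulr_ge0.
have -> : \sum_(h < J) (s * be) ^+ h / h`!%:R * Psi tau (m + h)%N * expR (s * Ah h) =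
  expR (s * (A + D%:R)) *
    \sum_(h < J) (s * be * expR (s * dmax%:R)) ^+ h / h`!%:R * Psi tau (m + h)%N.
  rewrite mulr_sumr; apply: eq_bigr => h _.
  have -> : expR (s * Ah h) = expR (s * (A + D%:R)) * expR (s * dmax%:R) ^+ h.
    by rewrite /Ah mulrDr expRD; congr (_ * _); rewrite mulrA mulrC expRM_natl.
  by rewrite [in RHS]exprMn; ring.
apply: ler_wpM2l; first exact: expR_ge0.
by apply: hP.2; rewrite // !mulr_ge0 // expR_ge0.
Qed.

Hypothesis Vspan : forall v,
  lin_span (Z `|` [set v | exists ga i, v = wact X ga (w i)]) v.

Lemma bounded_regular g C rho Psi tau : additive_fun g -> kills g ->
  0 <= C -> 0 <= rho -> rho <= 1 -> heat Psi -> 0 <= tau ->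
  bounded g C rho (Psi tau) -> regular g.
Proof.
move=> g_add gZ C0 r0 r1 hP tau0 hb; split=> // v.
suff h : forall c, summable g (c *: v) by rewrite -[v]scale1r; exact: h.
move: v (Vspan v); apply: span_min.
  apply: subspP => [c|c u v hu hv e] s s0.
    exists 0 => J; rewrite big1 // => j _.
    by rewrite scaler0 raddf0 additive0 // normr0 mulr0.
  have [B hB] := hu (e * c) s s0; have [B' hB'] := hv e s s0.
  exists (B + B') => J; apply: le_trans (lerD (hB J) (hB' J)).
  rewrite -big_split; apply: ler_sum => j _ /=; rewrite -mulrDr; apply: ler_wpM2l.
    by rewrite divr_ge0 // exprn_ge0.
  by rewrite scalerDr scalerA raddfD g_add; exact: ler_normD.
move=> v [Zv|[ga [i ->]]] c s s0.
  exists 0 => J; rewrite big1 // => j _; rewrite gZ ?normr0 ?mulr0 //.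
  by apply: pev_stable => //; exact: subspZ.
have hB J := exp_bound c ga i (tot d ga) J g_add gZ C0 r0 r1 hP tau0 s0 hb.
eexists => J; apply: le_trans (hB J); apply: ler_sum => j _.
by rewrite linearZ /= -shiftpow0 shiftpow_word.
Qed.

(** On a word of degree [D] the flow exp(tE) becomes exp(tD) times the flow at the generator. The
    factor exp(tD) is kept exactly, with its sign; absolute values are taken only at the generator.
    For t = -1 this is the source of the contraction. *)
Lemma flow_bounded t g C rho Psi tau : regular g -> `|t| = 1 ->
  0 <= C -> 0 <= rho -> rho <= 1 -> heat Psi -> 0 <= tau ->
  bounded g C rho (Psi tau) ->
  bounded (flow t g) (C * expR A) (expR t * rho)
    (Psi (tau + beta * rho * expR dmax%:R)).
Proof.
move=> rg t1 C0 r0 r1 hP tau0 hb k ga i; have [g_add gZ gs] := rg.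
set D := tot d ga; set v := k *: wact X ga (w i).
set B := normc k * C * rho ^+ D * (expR A * Psi (tau + beta * rho * expR dmax%:R) (size ga)).
pose p j := t ^+ j / j`!%:R * g (k *: wact X ga (pev E 'X^j (w i))).
have pB n : \sum_(j < n) `|p j| <= B.
  have := exp_bound k ga i 0 n g_add gZ C0 r0 r1 hP tau0 ler01 hb.
  rewrite addr0 !mul1r; apply: le_trans; apply: ler_sum => j _.
  by rewrite /p !normrM normfV normrX t1 normr_nat shiftpow0.
pose al j j' := p j * ((t * D%:R) ^+ j' / j'`!%:R).
have [r [l [h1 h2 h3]]] : exists r l, [/\ forall i, sums (al i) (r i), sums r l & sums (diag al) l].
  apply: (@double_sum _ al (B * expR D%:R)) => n.
  apply: le_trans (_ : \sum_(j < n) `|p j| * expR D%:R <= _).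
    apply: ler_sum => j _; apply: le_trans (_ : \sum_(j' < n) `|p j| * (D%:R ^+ j' / j'`!%:R) <= _).
      apply: ler_sum => j' _.
      rewrite /al normrM; apply: ler_wpM2l => //.
      by rewrite normrM normfV normrX normrM t1 mul1r !normr_nat.
    by rewrite -mulr_sumr; apply: ler_wpM2l => //; exact: exp_partial.
  by rewrite -mulr_suml; apply: ler_wpM2r; [exact: expR_ge0 | exact: pB].
have [l' hl'] := sums_exist pB.
have rE j : r j = expR (t * D%:R) * p j.
  by rewrite mulrC; apply: (sums_unique (h1 j)); apply: sumsZ; exact: sums_exp.
have lE : l = expR (t * D%:R) * l'.
  apply: (sums_unique h2); have := @sumsZ _ _ _ (expR (t * D%:R)) hl'.
  by congr sums; apply/funext => j; rewrite rE.
have -> : flow t g v = l.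
  apply: (sums_unique (@sums_flow t g v rg t1)); move: h3; congr sums.
  apply/funext => n; rewrite /v linearZ /= -shiftpow0 shiftpow_word add0n -/D shiftpowE.
  rewrite linear_sum scaler_sumr additive_sum // mulr_sumr /diag.
  apply: eq_bigr => j _; have jn : (j <= n)%N by rewrite -ltnS.
  rewrite -natrX scaler_nat -mulrnA !raddfMn /= additiveMn //.
  have f0 q : q`!%:R != 0 :> R by rewrite pnatr_eq0 -lt0n fact_gt0.
  have e : n`!%:R = 'C(n, j)%:R * (j`!%:R * (n - j)`!%:R) :> R.
    by rewrite -!natrM bin_fact.
  have b0 : 'C(n, j)%:R != 0 :> R by rewrite pnatr_eq0 -lt0n bin_gt0.
  have tn : t ^+ n = t ^+ j * t ^+ (n - j) by rewrite -exprD subnKC.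
  rewrite /al /p e tn exprMn -[g _ *+ _]mulr_natr natrM natrX.
  move: ('C(n, j)%:R) b0 => cj b0; move: (D%:R ^+ (n - j)) => x4.
  move: (t ^+ j) (t ^+ (n - j)) (g _) => x1 x2 x3.
  by field; rewrite b0 !f0.
rewrite lE normrM gtr0_norm ?expR_gt0 // mulrC [t * _]mulrC expRM_natl.
have -> : normc k * (C * expR A) * (expR t * rho) ^+ D *
    Psi (tau + beta * rho * expR dmax%:R) (size ga) = B * expR t ^+ D.
  by rewrite /B exprMn; ring.
apply: ler_wpM2r; first by rewrite exprn_ge0 // expR_ge0.
exact: (sums_norm hl').
Qed.

End Generators.

End Flow.

(** * Vanishing of slowly growing functionals on deep elements *)

Section Vanishing.
Variables (R : realType) (V : lmodType R[i]) (L : finType).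
Variables (d : L -> nat) (X : L -> {linear V -> V}).
Variables (E : {linear V -> V}) (Z : set V).
Hypothesis d_gt0 : forall l, (0 < d l)%N.
Hypothesis EX : forall l v, E (X l v) = X l (E v + (d l)%:R *: v).
Hypothesis hZ : subsp Z.
Hypothesis XZ : forall l z, Z z -> Z (X l z).
Hypothesis EZ : forall z, Z z -> Z (E z).

Definition order1 (I : finType) (w : I -> V) : Prop := forall i,
  lin_span (Z `|` (range w `|` [set v | exists l j, v = X l (w j)])) (E (w i)).

Lemma order1P (I : finType) (w : I -> V) : order1 w ->
  exists a b, forall i, exists2 z, Z z &
    E (w i) = z + \sum_j a i j *: w j + \sum_l \sum_j b i l j *: X l (w j).
Proof.
move=> h; have /choice[a ha] : forall i, exists ab : (I -> R[i]) * (L -> I -> R[i]),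
    exists2 z, Z z &
    E (w i) = z + \sum_j ab.1 j *: w j + \sum_l \sum_j ab.2 l j *: X l (w j).
  move=> i; move: (E (w i)) (h i); apply: span_min.
    apply: subspP.
      exists (fun=> 0, fun=> fun=> 0), 0; first exact: subsp0.
      rewrite big1 ?add0r; last by move=> j _; rewrite scale0r.
      by rewrite big1 // => l _; rewrite big1 // => j _; rewrite scale0r.
    move=> c _ _ [[a b] [z Zz ->]] [[a' b'] [z' Zz' ->]].
    exists (fun j => c * a j + a' j, fun l j => c * b l j + b' l j), (c *: z + z') => /=.
      exact: subspZD.
    rewrite !scalerDr addrACA (addrACA (c *: z)); congr (_ + _ + _).
      rewrite scaler_sumr -big_split; apply: eq_bigr => j _ /=.
      by rewrite scalerDl scalerA.
    rewrite scaler_sumr -big_split; apply: eq_bigr => l _ /=.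
    rewrite scaler_sumr -big_split; apply: eq_bigr => j _ /=.
    by rewrite scalerDl scalerA.
  move=> v [Zv|[[j _ <-]|[l [j ->]]]].
  - exists (fun=> 0, fun=> fun=> 0), v => //=.
    rewrite big1 ?addr0; last by move=> j _; rewrite scale0r.
    by rewrite big1 ?addr0 // => l _; rewrite big1 // => j _; rewrite scale0r.
  - exists (fun j' => (j' == j)%:R, fun=> fun=> 0), 0 => /=; first exact: subsp0.
    rewrite add0r (bigD1 j) //= eqxx scale1r big1 ?addr0; last first.
      by move=> k /negbTE ->; rewrite scale0r.
    by rewrite big1 ?addr0 // => l _; rewrite big1 // => k _; rewrite scale0r.
  - exists (fun=> 0, fun l' j' => ((l' == l) && (j' == j))%:R), 0 => /=.
      exact: subsp0.
    rewrite big1 ?addr0; last by move=> k _; rewrite scale0r.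
    rewrite add0r (bigD1 l) //= (bigD1 j) //= !eqxx scale1r.
    rewrite big1 ?addr0; last by move=> k /negbTE ->; rewrite scale0r.
    by rewrite big1 ?addr0 // => l' /negbTE ->; rewrite big1 // => k _; rewrite scale0r.
by exists (fun i => (a i).1), (fun i => (a i).2).
Qed.

Lemma heat_shift Psi (I : Type) (s : seq I) (c : I -> R) (n : I -> nat) :
  heat Psi -> (forall t, 0 <= c t) ->
  heat (fun tau m => \sum_(t <- s) c t * Psi tau (m + n t)%N).
Proof.
move=> [P0 hP] c0; split=> [tau m tau0|tau c' H m tau0 c'0].
  by apply: sumr_ge0 => t _; rewrite mulr_ge0 // P0.
under eq_bigr do rewrite mulr_sumr.
rewrite exchange_big /=; apply: ler_sum => t _.
apply: le_trans (ler_wpM2l (c0 t) (hP tau c' H (m + n t)%N tau0 c'0)).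
rewrite mulr_sumr; apply: ler_sum => h _.
by rewrite mulrCA addnAC.
Qed.

Let q : R := expR (-1).
Let q_gt0 : 0 < q. Proof. exact: expR_gt0. Qed.
Let q_ge0 : 0 <= q. Proof. exact: ltW. Qed.
Let q_lt1 : q < 1. Proof. by rewrite /q -[ltRHS]expR0 ltr_expR oppr_lt0. Qed.
Let q_le1 : q <= 1. Proof. exact: ltW. Qed.

Let geo n : \sum_(i < n) q ^+ i <= (1 - q)^-1.
Proof.
have q1 : 0 < 1 - q by rewrite subr_gt0.
rewrite -[leRHS]mul1r ler_pdivlMr // mulrC -opprB mulNr -subrX1 opprB.
by rewrite lerBlDr lerDl exprn_ge0.
Qed.

Let geo_rev n j : (j <= n)%N -> \sum_(i < j) q ^+ (n - i) <= q ^+ (n - j) * (1 - q)^-1.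
Proof.
have q1 : 0 < 1 - q by rewrite subr_gt0.
elim: j => [_|j IH jn].
  by rewrite big_ord0; apply: mulr_ge0; [exact: exprn_ge0 | rewrite invr_ge0 ltW].
rewrite big_ord_recr /=; apply: le_trans (lerD (IH (ltnW jn)) (lexx _)) _.
have -> : (n - j = (n - j.+1).+1)%N by lia.
rewrite exprS.
set x := q ^+ (n - j.+1); have x0 : 0 <= x by rewrite exprn_ge0.
rewrite ler_pdivlMr // mulrDl mulfVK ?gt_eqF //.
have -> : q * x + q * x * (1 - q) = x - x * (1 - q) ^+ 2 by ring.
by rewrite lerBlDr lerDl mulr_ge0 // exprn_ge0 // ltW.
Qed.

(* Each forward step of the flow damps the words by q to their degree, while each
   backward step only costs a constant factor on u. *)
Theorem flow_vanish (I J : finType) (w : I -> V) (u : J -> V) (g : V -> R) Psi :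
  (forall v, lin_span (Z `|` [set v | exists ga i, v = wact X ga (w i)]) v) ->
  order1 w -> order1 u ->
  (forall M i, lin_span (Z `|` [set v | exists ga v', (M <= tot d ga)%N /\ v = wact X ga v'])
     (u i)) ->
  additive_fun g -> kills Z g -> heat Psi -> bounded d X w g 1 1 (Psi 0) ->
  forall i, g (u i) = 0.
Proof.
move=> Vspan /order1P[a [b Ew]] /order1P[a' [b' Eu]] hu g_add gZ hP hb i0.
pose A := \sum_i \sum_j normc (a i j); pose A' := \sum_i \sum_j normc (a' i j).
pose beta := \sum_i \sum_l \sum_j normc (b i l j).
pose beta' := \sum_i \sum_l \sum_j normc (b' i l j).
have n0 (k : R[i]) : 0 <= normc k := normc_ge0 k.
have sum_le (T : finType) (F : T -> R) t : (forall t, 0 <= F t) -> F t <= \sum_t F t.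
  by move=> F0; rewrite (bigD1 t) //= lerDl sumr_ge0.
have A0 : 0 <= A by do 2 (apply: sumr_ge0 => ? _).
have A'0 : 0 <= A' by do 2 (apply: sumr_ge0 => ? _).
have be0 : 0 <= beta by do 3 (apply: sumr_ge0 => ? _).
have be'0 : 0 <= beta' by do 3 (apply: sumr_ge0 => ? _).
have aA i : \sum_j normc (a i j) <= A.
  by apply: (sum_le I (fun i => \sum_j normc (a i j))) => t; exact: sumr_ge0.
have aA' i : \sum_j normc (a' i j) <= A'.
  by apply: (sum_le J (fun i => \sum_j normc (a' i j))) => t; exact: sumr_ge0.
have bB i : \sum_l \sum_j normc (b i l j) <= beta.
  apply: (sum_le I (fun i => \sum_l \sum_j normc (b i l j))) => t.
  by do 2 (apply: sumr_ge0 => ? _).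
have bB' i : \sum_l \sum_j normc (b' i l j) <= beta'.
  apply: (sum_le J (fun i => \sum_l \sum_j normc (b' i l j))) => t.
  by do 2 (apply: sumr_ge0 => ? _).
pose dmax := (\max_l d l)%N; have d_max l : (d l <= dmax)%N by exact: leq_bigmax.
pose c0 := beta * expR dmax%:R; pose c1 := beta' * expR dmax%:R.
have c00 : 0 <= c0 by rewrite mulr_ge0 // expR_ge0.
have c10 : 0 <= c1 by rewrite mulr_ge0 // expR_ge0.
(* A step forward costs exp(A) and a step back exp(A'), so with [M] at least A + A' + 1 each pair of
   steps gains a factor [q]. [M] is fixed before the number of steps. *)
pose M := (Num.truncn (A + A')).+2.
have AM : A + A' - M%:R <= -1.
  by rewrite lerBlDr /M -[_.+2%:R]natr1 [leRHS]addrC addrK ltW // truncnS_gt.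
have /choice[rel hrel] : forall i, exists zTc : V * seq (mono L #|I|) * (mono L #|I| -> R[i]),
    [/\ Z zTc.1.1, (forall t, t \in zTc.1.2 -> (M <= tot d t.1)%N) &
      u i = zTc.1.1 + \sum_(t <- zTc.1.2) zTc.2 t *: wact X t.1 (w (enum_val t.2))].
  move=> i; suff : lin_span (Z `|` [set wact X t.1 (w (enum_val t.2)) | t in
      [set t : mono L #|I| | (M <= tot d t.1)%N]]) (u i).
    move/(span_family hZ) => [z [T [c [Zz _ hT e]]]].
    by exists (z, T, c).
  move: (u i) (hu M i); apply: span_min; first exact: subsp_span.
  move=> v [Zv|[ga [v' [Mga ->]]]]; first by apply: span_sub; left.
  move: v' (Vspan v'); apply: span_min; first exact: (subsp_preim _ (subsp_span _)).
  move=> v' [Zv'|[ga' [j ->]]] /=.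
    by apply: span_sub; left; exact: wactZ.
  apply: span_sub; right; exists (ga ++ ga', enum_rank j) => /=.
    by rewrite tot_cat (leq_trans Mga) // leq_addr.
  by rewrite enum_rankK wact_cat.
pose prs := [seq (i, t) | i <- enum J, t <- (rel i).1.2].
(* Writing [u i] through words [t] in the generators [w] lengthens a word by the size of [t]; the
   corresponding shifts of [Psi] form again a heat family. *)
pose F tau m := \sum_(p <- prs) normc ((rel p.1).2 p.2) * Psi tau (m + size p.2.1)%N.
have hF : heat F by exact: heat_shift.
pose G n := iter n (flow E (-1)) g.
(* A letter appended at step [i] has positive degree and is damped by [q ^+ i], so the parameter
   advances by a geometric series and stays bounded. *)
pose tau n := c0 * \sum_(i < n) q ^+ i.
have tau0 n : 0 <= tau n by rewrite mulr_ge0 // sumr_ge0 // => i _; rewrite exprn_ge0.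
have eA0 : 0 <= expR A by exact: expR_ge0.
have nm1 : `|-1| = 1 :> R by rewrite normrN normr1.
have qn0 n : 0 <= q ^+ n by exact: exprn_ge0.
have qn1 n : q ^+ n <= 1 by exact: exprn_ile1.
have fwd n : [/\ additive_fun (G n), kills Z (G n) &
    bounded d X w (G n) (expR A ^+ n) (q ^+ n) (Psi (tau n))].
  elim: n => [|n [ga_n gZ_n hb_n]].
    by split=> //; rewrite /tau big_ord0 mulr0 !expr0.
  have rg : regular E Z (G n).
    by apply: (bounded_regular d_gt0 d_max EX hZ XZ EZ Ew aA bB A0 be0 Vspan
      ga_n gZ_n (exprn_ge0 _ eA0) (qn0 n) (qn1 n) hP (tau0 n) hb_n).
  split; [exact: (flow_additive rg nm1) | exact: (flow_kills hZ EZ rg nm1) |].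
  have := flow_bounded d_gt0 d_max EX hZ XZ EZ Ew aA bB A0 be0 rg nm1
    (exprn_ge0 n eA0) (qn0 n) (qn1 n) hP (tau0 n) hb_n.
  have -> : tau n + beta * q ^+ n * expR dmax%:R = tau n.+1.
    by rewrite /tau big_ord_recr /= /c0; ring.
  by rewrite -exprS -exprSr.
have rg n : regular E Z (G n).
  have [ga_n gZ_n hb_n] := fwd n.
  by apply: (bounded_regular d_gt0 d_max EX hZ XZ EZ Ew aA bB A0 be0 Vspan
      ga_n gZ_n (exprn_ge0 _ eA0) (qn0 n) (qn1 n) hP (tau0 n) hb_n).
have G_back n : flow E 1 (G n.+1) = G n.
  by apply/funext => v; exact: (flowK v (rg n) (rg n.+1)).
(* All words that make up [u i] modulo [Z] have degree at least [M], whence the gain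
   [q ^+ (n * M)]. *)
have mid n : bounded d X u (G n) (expR A ^+ n * q ^+ (n * M)) (q ^+ n) (F (tau n)).
  move=> k ga i; have [ga_n gZ_n hb_n] := fwd n.
  have [Zz hT ->] := hrel i.
  rewrite raddfD scalerDr ga_n gZ_n; last by apply: subspZ => //; exact: wactZ.
  rewrite add0r /= linear_sum scaler_sumr additive_sum //.
  apply: le_trans (ler_norm_sum _ _ _) _.
  have Fle : \sum_(t <- (rel i).1.2) normc ((rel i).2 t) * Psi (tau n) (size ga + size t.1)%N
      <= F (tau n) (size ga).
    rewrite /F /prs big_allpairs_dep /= big_enum /=.
    apply: (sum_le J (fun i => \sum_(t <- (rel i).1.2)
       normc ((rel i).2 t) * Psi (tau n) (size ga + size t.1)%N)) => j.
    by apply: sumr_ge0 => t _; rewrite mulr_ge0 // hP.1.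
  have cst0 : 0 <= normc k * (expR A ^+ n * q ^+ (n * M)) * (q ^+ n) ^+ tot d ga.
    by rewrite !mulr_ge0 ?exprn_ge0.
  apply: le_trans (ler_wpM2l cst0 Fle).
  rewrite mulr_sumr big_seq [leRHS]big_seq; apply: ler_sum => t tT.
  rewrite linearZ /= scalerA -wact_cat; apply: le_trans (hb_n _ _ _) _.
  rewrite Normc.normcM size_cat tot_cat exprD.
  set x := Psi _ _; have x0 : 0 <= x by rewrite /x hP.1.
  have -> : normc k * normc ((rel i).2 t) * expR A ^+ n *
      ((q ^+ n) ^+ tot d ga * (q ^+ n) ^+ tot d t.1) * x =
    normc k * expR A ^+ n * (q ^+ n) ^+ tot d ga * normc ((rel i).2 t) * x *
      (q ^+ n) ^+ tot d t.1 by ring.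
  have -> : normc k * (expR A ^+ n * q ^+ (n * M)) * (q ^+ n) ^+ tot d ga *
      (normc ((rel i).2 t) * x) =
    normc k * expR A ^+ n * (q ^+ n) ^+ tot d ga * normc ((rel i).2 t) * x *
      (q ^+ n) ^+ M by rewrite exprM; ring.
  apply: ler_wpM2l; first by rewrite !mulr_ge0 ?exprn_ge0.
  by apply: ler_wiXn2l => //; exact: hT.
pose tb n j := tau n + c1 * \sum_(i < j) q ^+ (n - i).
have tb0 n j : 0 <= tb n j.
  by rewrite addr_ge0 // mulr_ge0 // sumr_ge0.
(* Going back, [E] is expanded on the generators [u] themselves. On words in [w] each step back
   would multiply by the exponential of the degree and destroy the gain; on [u] the empty word has
   degree zero and the gain is kept. *)
have bwd n j : (j <= n)%N -> bounded d X u (G (n - j)%N)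
    (expR A ^+ n * q ^+ (n * M) * expR A' ^+ j) (q ^+ (n - j)) (F (tb n j)).
  elim: j => [_|j IH jn].
    by rewrite subn0 expr0 mulr1 /tb big_ord0 mulr0 addr0; exact: mid.
  have C0 : 0 <= expR A ^+ n * q ^+ (n * M) * expR A' ^+ j.
    by rewrite !mulr_ge0 ?exprn_ge0 // expR_ge0.
  have := flow_bounded d_gt0 d_max EX hZ XZ EZ Eu aA' bB' A'0 be'0 (rg (n - j)%N) (normr1 _)
    C0 (qn0 (n - j)%N) (qn1 (n - j)%N) hF (tb0 n j) (IH (ltnW jn)).
  have -> : tb n j + beta' * q ^+ (n - j) * expR dmax%:R = tb n j.+1.
    by rewrite /tb big_ord_recr /= /c1; ring.
  have -> : (n - j = (n - j.+1).+1)%N by rewrite -subSn // subSS.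
  have e1 : expR A ^+ n * q ^+ (n * M) * expR A' ^+ j * expR A' =
    expR A ^+ n * q ^+ (n * M) * expR A' ^+ j.+1 by rewrite exprSr mulrA.
  have e2 k : expR 1 * q ^+ k.+1 = q ^+ k.
    by rewrite exprS mulrA -expRD subrr expR0 mul1r.
  by rewrite G_back e1 e2.
pose T := (c0 + c1) * (1 - q)^-1.
have q1 : 0 < 1 - q by rewrite subr_gt0.
have tbT n : tb n n <= T.
  rewrite /T mulrDl; apply: lerD; first by apply: ler_wpM2l.
  apply: ler_wpM2l => //; apply: le_trans (geo_rev (leqnn n)) _.
  by rewrite subnn expr0 mul1r.
have nc1 : normc (1 : R[i]) = 1 by exact: (normc_nat R 1).
have main n : `|g (u i0)| <= F T 0 * q ^+ n.
  have := bwd n n (leqnn n) 1 [::] i0; rewrite subnn scale1r nc1 mul1r /=.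
  rewrite expr0 expr1n mulr1 => /le_trans; apply.
  have FT : F (tb n n) 0%N <= F T 0%N by exact: heat_mono.
  have F0 : 0 <= F T 0%N by apply: hF.1; apply: le_trans (tbT n).
  rewrite mulrC; apply: ler_pM => //; first by apply: hF.1.
    by rewrite !mulr_ge0 ?exprn_ge0 // expR_ge0.
  have -> : expR A ^+ n * q ^+ (n * M) * expR A' ^+ n = (expR (A + A' - M%:R)) ^+ n.
    rewrite mulnC exprM -!exprMn; congr (_ ^+ n).
    by rewrite /q -expRM_natl mulrN1 -!expRD; congr expR; ring.
  by apply: lerXn2r; rewrite ?nnegrE ?expR_ge0 // ler_expR.
apply/eqP; rewrite -normr_eq0 -[_ == 0]negbK; apply/negP => gu.
have gu0 : 0 < `|g (u i0)| by rewrite lt_neqAle eq_sym gu /=.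
have x0 : 0 <= F T 0%N / `|g (u i0)|.
  by rewrite divr_ge0 // hF.1 //; apply: le_trans (tbT 0%N).
have h := main (Num.truncn (F T 0%N / `|g (u i0)|)).
have h2 := truncnS_gt (F T 0%N / `|g (u i0)|).
set n := Num.truncn _ in h h2.
have qn : q ^+ n * n.+1%:R <= 1.
  rewrite /q -expRM_natl mulrN1 expRN ler_pdivrMl ?expR_gt0 // mulr1.
  by rewrite -natr1 addrC expR_ge1Dx.
move: h2; rewrite ltr_pdivrMr // => h2.
have h3 : n.+1%:R * `|g (u i0)| <= F T 0%N.
  apply: le_trans (ler_wpM2l (ler0n _ _) h) _.
  rewrite mulrCA -[leRHS]mulr1; apply: ler_wpM2l.
    by apply: hF.1; apply: le_trans (tbT 0%N).
  by rewrite mulrC.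
by rewrite ltNge h3 in h2.
Qed.

End Vanishing.

Section JosephNakayama.
Variables (R : realType) (V : lmodType R[i]) (L : finType).
Variables (d : L -> nat) (X : L -> {linear V -> V}) (c : L -> L -> L -> R[i]).
Variables (E : {linear V -> V}) (Z : set V) (r s : nat).
Variables (w : 'I_r -> V) (u : 'I_s -> V).
Hypothesis d_gt0 : forall l, (0 < d l)%N.
Hypothesis Xcomm : forall i j v,
  X i (X j v) = X j (X i v) + \sum_k c i j k *: X k v.
Hypothesis c_d : forall i j k, c i j k != 0 -> d k = (d i + d j)%N.
Hypothesis EX : forall l v, E (X l v) = X l (E v + (d l)%:R *: v).
Hypothesis hZ : subsp Z.
Hypothesis XZ : forall l z, Z z -> Z (X l z).
Hypothesis EZ : forall z, Z z -> Z (E z).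
Hypothesis Vspan : forall v,
  lin_span (Z `|` [set v | exists ga i, v = wact X ga (w i)]) v.
Hypothesis Ew : order1 X E Z w.
Hypothesis Eu : order1 X E Z u.
Hypothesis u_deep : forall M i,
  lin_span (Z `|` [set v | exists ga v', (M <= tot d ga)%N /\ v = wact X ga v']) (u i).

Lemma normcE' (x : R[i]) : `|x| = (normc x)%:C%C.
Proof. by case: x. Qed.

Lemma archi_complex (x : R[i]) : exists N : nat, `|x| <= N%:R.
Proof.
exists (Num.truncn (normc x)).+1; rewrite normcE' -[_%:R](rmorph_nat (real_complex R)).
by rewrite lecR ltW // truncnS_gt.
Qed.

Theorem joseph_nakayama i : Z (u i).
Proof.
apply: contrapT => Zu.
(* Since degrees add under commutators, the positive weights [o = S - d] satisfy
   [o k + S = o i + o j]. *)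
pose S := (\max_l d l)%N.+1; pose o l := (S - d l)%N.
have dS l : (d l < S)%N by rewrite ltnS; exact: leq_bigmax.
have oE l : (o l + d l = S)%N by rewrite subnK // ltnW.
have o_gt0 l : (0 < o l)%N by rewrite subn_gt0.
(* Ordered by degree, with ties broken by rank; a commutator has larger degree than both of its
   entries, hence a larger key. *)
pose key l := (d l * #|L| + enum_rank l)%N.
have key_inj : injective key.
  move=> l l' e; apply: enum_rank_inj; apply: ord_inj.
  by rewrite -[LHS](modn_small (ltn_ord _)) -[RHS](modn_small (ltn_ord _))
    -(modnMDl (d l)) -[in RHS](modnMDl (d l')) -/(key l) -/(key l') e.
have c_o i1 j k : c i1 j k != 0 -> (o k + S = o i1 + o j)%N.
  by move/c_d; have := oE i1; have := oE j; have := oE k; lia.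
have key_lt k l : (d k < d l)%N -> (key k < key l)%N.
  move=> h; apply: leq_trans (_ : (d k).+1 * #|L| <= _)%N.
    by rewrite /key mulSn addnC ltn_add2r ltn_ord.
  by apply: leq_trans (leq_addr _ _); rewrite leq_mul2r h orbT.
have c_key i1 j k : c i1 j k != 0 -> (key i1 < key k)%N && (key j < key k)%N.
  move/c_d => e; have := d_gt0 i1; have := d_gt0 j => h1 h2.
  by apply/andP; split; apply: key_lt; rewrite e; move: h1 h2; clear; lia.
have Vspan' v : lin_span (Z `|` range (vec X w)) v.
  move: v (Vspan v); apply: span_min; first exact: subsp_span.
  move=> v [Zv|[ga [j ->]]]; first by apply: span_sub; left.
  by apply: span_sub; right; exists (ga, j).
have S_gt0 : (0 < S)%N by [].
have [f [C [B [[C0 B0] fZ fu fB]]]] := growth_functional key_inj o_gt0 S_gt0 Xcomm c_o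
  c_key hZ XZ archi_complex Vspan' Zu.
pose Cr := normc C; pose Br := normc B.
have CE : C = Cr%:C%C by rewrite -normcE' ger0_norm.
have BE : B = Br%:C%C by rewrite -normcE' ger0_norm.
(* A word of m letters has weight S m minus its degree, at most (S - 1) m; the growth bound is used
   with n = S (m + 1), which exceeds that weight. *)
pose Phi m := Cr * Br ^+ m * (S * m.+1)%:R ^+ (m - m %/ S).
have fPhi ga j : normc (f (wact X ga (w j))) <= Phi (size ga).
  set m := size ga.
  have oS : (tot o ga + tot d ga = S * m)%N.
    rewrite /m; elim: (ga) => [|l a IH]; first by rewrite muln0.
    by rewrite !tot_cons /= mulnS -IH -(oE l); lia.
  have dm : (m <= tot d ga)%N by exact: size_tot.
  have n0 : (0 < S * m.+1)%N by rewrite muln_gt0.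
  have on : (tot o ga <= S * m.+1)%N by rewrite mulnS; lia.
  have := fB (ga, j) _ n0 on; rewrite normcE' CE BE.
  set N := (S * m.+1)%N; set p := (_ %/ S)%N.
  have -> : Cr%:C%C * Br%:C%C ^+ m * N%:R ^+ p = (Cr * Br ^+ m * N%:R ^+ p)%:C%C.
    by rewrite !rmorphM !rmorphXn /= rmorph_nat.
  rewrite lecR => /le_trans; apply; rewrite /Phi; apply: ler_wpM2l.
    by rewrite mulr_ge0 ?exprn_ge0 ?normc_ge0.
  apply: ler_weXn2l; first by rewrite ler1n.
  apply: leq_trans (_ : (S * m - m) %/ S <= _)%N; first by apply: leq_div2r; rewrite -oS -addnBA // leq_addr.
  rewrite -[leqRHS](mulnK _ S_gt0); apply: leq_div2r.
  by rewrite mulnBl (mulnC S) leq_sub2l // leq_trunc_div.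
have Phi0 m : 0 <= Phi m by rewrite !mulr_ge0 ?exprn_ge0 ?normc_ge0.
have [Psi hPsi PhiPsi] := heat_exists Phi0 (fun tau m h =>
  growth_summable S_gt0 m (normc_ge0 C) (normc_ge0 B) h).
(* To be used for the real and the imaginary part. *)
have van (p : {additive R[i] -> R}) : (forall z, `|p z| <= normc z) -> p (f (u i)) = 0.
  move=> pn; apply: (flow_vanish (g := fun v => p (f v)) d_gt0 EX hZ XZ EZ Vspan Ew Eu u_deep
    _ _ hPsi) => [v v'|z Zz|k ga j].
  - by rewrite raddfD raddfD.
  - by rewrite fZ // raddf0.
  - rewrite linearZ expr1n !mulr1; apply: le_trans (pn _) _.
    rewrite Normc.normcM; apply: ler_wpM2l; first exact: normc_ge0.
    by apply: le_trans (fPhi _ _) _.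
have hRe : (@complex.Re R : {additive R[i] -> R}) (f (u i)) = 0.
  apply: van => -[x y] /=; rewrite -sqrtr_sqr ler_sqrt ?addr_ge0 ?sqr_ge0 //.
  by rewrite lerDl sqr_ge0.
have hIm : (@complex.Im R : {additive R[i] -> R}) (f (u i)) = 0.
  apply: van => -[x y] /=; rewrite -sqrtr_sqr ler_sqrt ?addr_ge0 ?sqr_ge0 //.
  by rewrite lerDr sqr_ge0.
move/eqP: fu; apply; move: hRe hIm => /=; case: (f (u i)) => x y /= -> ->.
by [].
Qed.

End JosephNakayama.

(** * Finite dimension and chains *)

Section FiniteDimension.
Variables (K : fieldType) (V : lmodType K).
Implicit Types (U W : set V) (s : seq V).

Lemma span_cons x s v : lin_span [set` x :: s] v ->
  exists a, lin_span [set` s] (v - a *: x).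
Proof.
have hs : subsp (lin_span [set` s]) by exact: subsp_span.
move: v; apply: span_min.
  apply: subspP; first by exists 0; rewrite scale0r subr0; exact: (subsp0 hs).
  move=> c u v [a ha] [a' ha']; exists (c * a + a').
  by rewrite scalerDl -scalerA opprD addrACA -scalerBr; exact: (subspZD hs).
move=> v /=; rewrite inE => /orP[/eqP->|vs].
  by exists 1; rewrite scale1r subrr; exact: (subsp0 hs).
by exists 0; rewrite scale0r subr0; exact: span_sub.
Qed.

Lemma fin_dim_sub U W : fin_dim W -> U `<=` W -> fin_dim U.
Proof. by move=> [s hs] UW; exists s => v /UW /hs. Qed.

Lemma fin_dim_span s : fin_dim (lin_span [set` s]).
Proof. by exists s. Qed.

Lemma fin_dim_basis W : subsp W -> fin_dim W ->
  exists s, (forall v, v \in s -> W v) /\ W `<=` lin_span [set` s].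
Proof.
move=> hW [s hs]; elim: s W hW hs => [|x s IH] W hW hs.
  by exists [::].
pose W' := W `&` lin_span [set` s].
have [t [tW ht]] : exists t : seq V, (forall v, v \in t -> W' v) /\ W' `<=` lin_span [set` t].
  by apply: (IH W' (subspI hW (subsp_span _))) => v [].
have [[v Wv [a [a0 ha]]]|nv] :=
  pselect (exists2 v, W v & exists a, a != 0 /\ lin_span [set` s] (v - a *: x)).
  exists (v :: t); split.
    by move=> u; rewrite inE => /orP[/eqP->//|/tW[]].
  move=> u Wu; have [a' ha'] := span_cons (hs u Wu).
  have hvt : subsp (lin_span [set` v :: t]) by exact: subsp_span.
  rewrite -[u](subrK ((a' / a) *: v)); apply: (subspD hvt); last first.
    by apply: (subspZ hvt); apply: span_sub; rewrite /= mem_head.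
  have : W' (u - (a' / a) *: v).
    split; first by apply: (subspB hW) => //; exact: (subspZ hW).
    have := subspB (subsp_span _) ha' (subspZ (subsp_span _) (a' / a) ha).
    by rewrite scalerBr scalerA divfK // opprB addrA subrK.
  by move/ht; apply: span_mono => y /= yt; rewrite inE yt orbT.
exists t; split=> [u /tW[]//|u Wu]; apply: ht; split=> //.
have [a ha] := span_cons (hs u Wu).
have [a0|a0] := eqVneq a 0; first by rewrite a0 scale0r subr0 in ha.
by case: nv; exists u => //; exists a.
Qed.

Lemma span_coord s v : lin_span [set` s] v ->
  exists c : 'I_(size s) -> K, v = \sum_i c i *: s`_i.
Proof.
move: v; apply: span_min.
  apply: subspP.
    by exists (fun=> 0); rewrite big1 // => i _; rewrite scale0r.
  move=> a u v [c ->] [c' ->]; exists (fun i => a * c i + c' i).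
  rewrite scaler_sumr -big_split; apply: eq_bigr => i _ /=.
  by rewrite scalerDl scalerA.
move=> v /= vs; have iv : (index v s < size s)%N by rewrite index_mem.
exists (fun i => (i == Ordinal iv)%:R).
rewrite (bigD1 (Ordinal iv)) //= eqxx scale1r nth_index // big1 ?addr0 //.
by move=> i /negbTE ->; rewrite scale0r.
Qed.

Lemma dependence U s n (v : nat -> V) : subsp U -> (size s < n)%N ->
  (forall i, addsp U (lin_span [set` s]) (v i)) ->
  exists c : 'I_n -> K, (exists i, c i != 0) /\ U (\sum_i c i *: v i).
Proof.
move=> hU sn hv.
have /choice[e he] : forall i, exists c : 'I_(size s) -> K,
    U (v i - \sum_j c j *: s`_j).
  by move=> i; have [u [w [Uu /span_coord[c ->] ->]]] := hv i; exists c; rewrite addrK.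
pose M : 'M[K]_(n, size s) := \matrix_(i, j) e i j.
have : kermx M != 0.
  rewrite -mxrank_eq0 mxrank_ker -lt0n subn_gt0.
  exact: leq_ltn_trans (rank_leq_col _) sn.
case/rowV0Pn => r /sub_kermxP rM r0; exists (fun i => r 0 i); split.
  apply: contrapT => h; case/eqP: r0; apply/rowP => i; rewrite mxE.
  by apply/eqP/negPn/negP => ri; apply: h; exists i.
have -> : \sum_i r 0 i *: v i = \sum_i r 0 i *: (v i - \sum_j e i j *: s`_j).
  under [RHS]eq_bigr do rewrite scalerBr scaler_sumr.
  rewrite sumrB exchange_big /= [X in _ - X]big1 ?subr0 // => j _.
  under eq_bigr do rewrite scalerA.
  rewrite -scaler_suml; have /rowP/(_ j) := rM; rewrite !mxE => h.
  rewrite (_ : \sum_i _ = 0) ?scale0r // -[RHS]h.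
  by apply: eq_bigr => i _; rewrite mxE.
by apply: (subsp_sum hU) => i _; exact: (subspZ hU).
Qed.

(** Choose [v i] in [N i.+1] outside [N i + U]. In a linear dependence of the [v i] modulo [U], the
    last vector with nonzero coefficient would lie in [N i + U]. *)
Lemma chain_bound U s n (N : nat -> set V) : subsp U ->
  (forall v, addsp U (lin_span [set` s]) v) ->
  (forall i, (i <= n)%N -> subsp (N i)) ->
  (forall i, (i < n)%N -> N i `<=` N i.+1 /\ ~ N i.+1 `<=` addsp (N i) U) ->
  (n <= size s)%N.
Proof.
move=> hU hV hN hs; rewrite leqNgt; apply/negP => sn.
have /choice[v hv] : forall i, exists v, (i < n)%N -> N i.+1 v /\ ~ addsp (N i) U v.
  move=> i; have [lt|] := ltnP i n; last by exists 0.
  have [_ nsub] := hs i lt; apply: contrapT => h; apply: nsub => v Nv.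
  by apply: contrapT => nv; apply: h; exists v.
have mono i j : (i <= j)%N -> (j <= n)%N -> N i `<=` N j.
  elim: j => [|j IH]; first by rewrite leqn0 => /eqP-> _ u.
  rewrite leq_eqVlt => /orP[/eqP-> _ u //|ij jn u /(IH ij (ltnW jn))].
  by case: (hs j jn) => h _; exact: h.
have [c [[i0 ci0] Uc]] := dependence hU sn (fun i => hV (v i)).
have [i ci imax] := @arg_maxnP _ i0 (fun i => c i != 0) (fun i => i : nat) ci0.
have [_ nv] := hv i (ltn_ord i); apply: nv.
have hNi := hN i (ltnW (ltn_ord i)); have hA := subsp_add hNi hU.
rewrite -[v i](scale1r) -(mulVf ci) -scalerA; apply: (subspZ hA).
move: Uc; rewrite (bigD1 i) //= => Uc.
apply: (subspDr hA _ (addspr hNi Uc)); apply: addspl => //.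
apply: (subsp_sum hNi) => j ji.
have [->|cj] := eqVneq (c j) 0; first by rewrite scale0r; exact: (subsp0 hNi).
apply: (subspZ hNi); have lt : (j < i)%N.
  by rewrite ltn_neqAle ji /=; exact: imax.
by apply: (mono j.+1) => //; [exact: ltnW | case: (hv j (ltn_ord j))].
Qed.

End FiniteDimension.

Lemma maximal_chain (T : Type) (P : set T -> Prop) (bot top : set T) (B : nat) :
  P bot -> P top -> bot `<=` top ->
  (forall n (N : nat -> set T), (forall i, (i <= n)%N -> P (N i)) ->
     (forall i, (i < n)%N -> N i `<=` N i.+1 /\ N i <> N i.+1) -> (n <= B)%N) ->
  exists n (N : nat -> set T), [/\ forall i, (i <= n)%N -> P (N i),
    N 0%N = bot, N n = top & forall i, (i < n)%N -> [/\ N i `<=` N i.+1, N i <> N i.+1 &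
      forall W, P W -> N i `<=` W -> W `<=` N i.+1 -> W = N i \/ W = N i.+1]].
Proof.
move=> Pb Pt bt hB.
pose ch n (N : nat -> set T) := [/\ forall i, (i <= n)%N -> P (N i), N 0%N = bot,
   N n = top & forall i, (i < n)%N -> N i `<=` N i.+1 /\ N i <> N i.+1].
have ex : exists n, `[< exists N, ch n N >].
  have [e|ne] := pselect (bot = top).
    by exists 0%N; apply/asboolP; exists (fun=> bot); split.
  exists 1%N; apply/asboolP; exists (fun i => if i is 0%N then bot else top).
  by split=> // [[|i]|[|i]].
have bd n : `[< exists N, ch n N >] -> (n <= B)%N.
  by move/asboolP => [N [h1 _ _ h4]]; exact: hB h1 h4.
case: (ex_maxnP ex bd) => n /asboolP[N [h1 h2 h3 h4]] nmax.
exists n, N; split=> // i lt; have [h5 h6] := h4 i lt; split=> // W PW iW Wi.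
apply: contrapT => /not_orP[nWi nWi1].
have : `[< exists N, ch n.+1 N >]; last by move/nmax; rewrite ltnn.
apply/asboolP.
exists (fun j => if (j <= i)%N then N j else if j == i.+1 then W else N j.-1).
split=> [j jn||| j jn].
- case: ifP => [ji|ij]; first by apply: h1; exact: leq_trans (ltnW lt).
  by case: ifP => // _; apply: h1; lia.
- by [].
- by rewrite leqNgt ltnS (ltnW lt) /= eqSS gtn_eqF //= h3.
have [ji|] := leqP j.+1 i.
  by rewrite (ltnW ji); apply: h4; exact: ltn_trans lt.
rewrite ltnS leq_eqVlt => /orP[/eqP <-|ij].
  by rewrite leqnn eqxx; split=> // e; apply: nWi.
have e1 : (j <= i)%N = false by rewrite leqNgt ij.
have e2 : (j < i)%N = false by rewrite ltnNge (ltnW ij).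
rewrite ?e2 e1 eqSS (gtn_eqF ij) /=.
have [e|ne] := eqVneq j i.+1; first by rewrite e /=; split=> // e'; apply: nWi1.
have : (i.+1 < j)%N by rewrite ltn_neqAle eq_sym ne.
by case: j {ne ij e1 e2} jn => // j jn ij; apply: h4.
Qed.

(** * Ascending chain conditions *)

Section AscendingChains.
Variables (K : fieldType) (V : lmodType K).
Implicit Types (U W : set V) (y : {linear V -> V}) (ys : seq {linear V -> V}).

Definition stable y U : Prop := forall v, U v -> U (y v).
Definition stable_all ys U : Prop := forall y, List.In y ys -> stable y U.

Definition acc ys W : Prop := forall N : nat -> set V,
  (forall n, [/\ subsp (N n), stable_all ys (N n), N n `<=` W & N n `<=` N n.+1]) ->
  exists n0, forall n, (n0 <= n)%N -> N n `<=` N n0.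

Lemma chain_mono (N : nat -> set V) i j : (forall n, N n `<=` N n.+1) ->
  (i <= j)%N -> N i `<=` N j.
Proof.
move=> hN; elim: j => [|j IH]; first by rewrite leqn0 => /eqP-> u.
by rewrite leq_eqVlt => /orP[/eqP-> u //|/IH ij u /ij]; exact: hN.
Qed.

Lemma acc_fin_dim W : fin_dim W -> acc [::] W.
Proof.
move=> fW N hN; have mono i j := @chain_mono N i j (fun n => let: And4 _ _ _ h := hN n in h).
pose U : set V := fun v => exists n, N n v.
have hU : subsp U.
  apply: subspP; first by exists 0%N; case: (hN 0%N) => h _ _ _; exact: subsp0.
  move=> a u v [n nu] [m mv]; exists (maxn n m); case: (hN (maxn n m)) => h _ _ _.
  by apply: (subspZD h); [apply: (mono n) nu; exact: leq_maxl | apply: (mono m) mv; exact: leq_maxr].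
have [s [sU Us]] : exists s : seq V, (forall v, v \in s -> U v) /\ U `<=` lin_span [set` s].
  apply: (fin_dim_basis hU); apply: fin_dim_sub fW _ => v [n nv].
  by case: (hN n) => _ _ h _; exact: h.
have [n0 hn0] : exists n0, forall v, v \in s -> N n0 v.
  elim: s sU {Us} => [|x s IH] sU; first by exists 0%N.
  have [n0 hn0] := IH (fun v vs => sU v (mem_behead (s := x :: s) vs)).
  have [n1 hn1] := sU x (mem_head _ _).
  exists (maxn n0 n1) => v; rewrite inE => /orP[/eqP->|/hn0 h].
    by apply: (mono n1) hn1; exact: leq_maxr.
  by apply: (mono n0) h; exact: leq_maxl.
exists n0 => n _ v nv; case: (hN n0) => h _ _ _.
have : lin_span [set` s] v by apply: Us; exists n.
by apply: span_min.
Qed.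

Section OneMore.
Variables (y : {linear V -> V}) (ys : seq {linear V -> V}) (W : set V).
Hypothesis hW : subsp W.
Hypothesis Wys : stable_all ys W.
(** The commutators of [y] with the old operators need only preserve every subspace stable under the
    old ones; so operators that do not commute can be adjoined one at a time. *)
Hypothesis ycomm : forall U y', subsp U -> stable_all ys U -> List.In y' ys ->
  forall v, U v -> U (y (y' v) - y' (y v)).

Fixpoint ypoly k : set V := if k is k'.+1 then
    [set v | exists a w, [/\ ypoly k' a, W w & v = a + iter k' y w]]
  else [set 0].

Lemma subsp_ypoly k : subsp (ypoly k).
Proof.
elim: k => [|k IH]; first exact: subsp1.
apply: subspP.
  exists 0, 0; split; [exact: (subsp0 IH) | exact: (subsp0 hW) |].
  rewrite add0r; elim: k {IH} => //= k <-; by rewrite raddf0.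
move=> c u v [a [w [la Ww ->]]] [a' [w' [la' Ww' ->]]].
exists (c *: a + a'), (c *: w + w'); split; [exact: (subspZD IH) | exact: (subspZD hW) |].
by rewrite iter_linear scalerDr addrACA.
Qed.

Lemma ypolyS k : ypoly k `<=` ypoly k.+1.
Proof.
move=> v lv; exists v, 0; split=> //; first exact: (subsp0 hW).
have -> : iter k y 0 = 0 by elim: k {lv} => //= k ->; rewrite raddf0.
by rewrite addr0.
Qed.

Lemma ypoly_y k v : ypoly k v -> ypoly k.+1 (y v).
Proof.
elim: k v => [|k IH] v.
  move=> ->; rewrite raddf0; exact: (subsp0 (subsp_ypoly 1)).
move=> [a [w [la Ww ->]]]; exists (y a), w; split=> //; first exact: IH.
by rewrite raddfD.
Qed.

Lemma ypoly_stable k : stable_all ys (ypoly k) /\ forall y' w, List.In y' ys -> W w ->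
  ypoly k (y' (iter k y w) - iter k y (y' w)).
Proof.
elim: k => [|k [st cm]].
  split=> [y' _ v ->|y' w _ _]; first by rewrite raddf0.
  by rewrite subrr.
have st' : stable_all ys (ypoly k.+1).
  move=> y' y'in _ [a [w [la Ww ->]]].
  exists (y' a + (y' (iter k y w) - iter k y (y' w))), (y' w); split.
  - by apply: (subspD (subsp_ypoly k)); [exact: st | exact: cm].
  - exact: Wys.
  - by rewrite raddfD -addrA subrK.
split=> // y' w y'in Ww; rewrite !iterS.
have lw : ypoly k.+1 (iter k y w).
  by exists 0, w; rewrite add0r; split=> //; exact: (subsp0 (subsp_ypoly k)).
have h1 := ycomm (subsp_ypoly k.+1) st' y'in lw.
have h2 := ypoly_y (cm _ _ y'in Ww); rewrite raddfB in h2.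
have := subspB (subsp_ypoly k.+1) h2 h1; congr (ypoly k.+1 _).
by rewrite opprB addrC subrKA.
Qed.

Definition lead k (N : set V) : set V :=
  [set w | W w /\ exists2 a, ypoly k a & N (a + iter k y w)].

Lemma subsp_lead k N : subsp N -> subsp (lead k N).
Proof.
move=> hN; apply: subspP.
  split; first exact: (subsp0 hW).
  exists 0; first exact: (subsp0 (subsp_ypoly k)).
  have -> : iter k y 0 = 0 by elim: k => //= k ->; rewrite raddf0.
  by rewrite addr0; exact: (subsp0 hN).
move=> c u v [Wu [a la Na]] [Wv [b lb Nb]]; split; first exact: (subspZD hW).
exists (c *: a + b); first exact: (subspZD (subsp_ypoly k)).
by rewrite iter_linear addrACA -scalerDr; exact: (subspZD hN).
Qed.

Lemma stable_lead k N : stable_all ys N -> stable_all ys (lead k N).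
Proof.
move=> sN y' y'in w [Ww [a la Na]]; split; first exact: Wys.
have [st cm] := ypoly_stable k.
exists (y' a + (y' (iter k y w) - iter k y (y' w))).
  by apply: (subspD (subsp_ypoly k)); [exact: st | exact: cm].
by rewrite -addrA subrK -raddfD; exact: sN.
Qed.

Lemma leadS k N : stable y N -> lead k N `<=` lead k.+1 N.
Proof.
move=> sN w [Ww [a la Na]]; split=> //; exists (y a); first exact: ypoly_y.
by rewrite iterS -raddfD; exact: sN.
Qed.

Lemma lead_sub (N N' : set V) k : subsp N -> subsp N' -> N `<=` N' ->
  (forall k, lead k N' `<=` lead k N) -> N' `&` ypoly k `<=` N.
Proof.
move=> hN hN' NN hl; elim: k => [|k IH] v [N'v].
  by move=> ->; exact: (subsp0 hN).
move=> [a [w [la Ww e]]].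
have [_ [a' la' Na']] : lead k N w.
  by apply: hl; split=> //; exists a => //; rewrite -e.
have := IH (v - (a' + iter k y w)).
move=> /(_ _) h; rewrite -[v](subrK (a' + iter k y w)); apply: (subspD hN) => //.
apply: h; split; first by apply: (subspB hN') => //; exact: NN.
rewrite e opprD addrACA subrr addr0; exact: (subspB (subsp_ypoly k)).
Qed.

(* Hilbert's basis theorem, by comparing leading coefficients. *)
Lemma acc_cons : acc ys W -> acc (y :: ys) (fun v => exists k, ypoly k v).
Proof.
move=> hacc N hN.
have Nsub n : subsp (N n) by case: (hN n).
have Nst n : stable_all ys (N n).
  by move=> y' y'in; case: (hN n) => _ h _ _; apply: h; right.
have Ny n : stable y (N n) by case: (hN n) => _ h _ _; apply: h; left.
have Nlow n : N n `<=` (fun v => exists k, ypoly k v) by case: (hN n).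
have NS n : N n `<=` N n.+1 by case: (hN n).
have lead_n k n m : (n <= m)%N -> lead k (N n) `<=` lead k (N m).
  move=> nm w [Ww [a la Na]]; split=> //; exists a => //.
  exact: (chain_mono NS nm).
have lead_k n k k' : (k <= k')%N -> lead k (N n) `<=` lead k' (N n).
  by apply: (chain_mono (N := fun k => lead k (N n))) => j; exact: leadS.
have col k : exists n0, forall n, (n0 <= n)%N -> lead k (N n) `<=` lead k (N n0).
  apply: hacc => n; split; [exact: subsp_lead | exact: stable_lead | by move=> w [] |].
  exact: lead_n.
have [d hd] : exists d, forall n, (d <= n)%N -> lead n (N n) `<=` lead d (N d).
  apply: hacc => n; split; [exact: subsp_lead | exact: stable_lead | by move=> w [] |].
  by move=> w /(lead_k _ _ n.+1 (leqnSn n)); exact: lead_n.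
have [c hc] : exists c, forall k n, (k < d)%N -> (c <= n)%N -> lead k (N n) `<=` lead k (N c).
  elim: d {hd} => [|d [c hc]]; first by exists 0%N.
  have [n0 hn0] := col d; exists (maxn c n0) => k n; rewrite ltnS leq_eqVlt geq_max.
  move=> /orP[/eqP->|kd] /andP[cn n0n] w.
    by move/(hn0 n n0n); apply: lead_n; exact: leq_maxr.
  by move/(hc k n kd cn); apply: lead_n; exact: leq_maxl.
exists (maxn c d) => n nc v nv; have [k lv] := Nlow n v nv.
apply: (@lead_sub (N (maxn c d)) (N n) k) => //.
  exact: (chain_mono NS nc).
move=> j w hw; have [jd|dj] := ltnP j d.
  apply: (lead_n _ c); first exact: leq_maxl.
  by apply: (hc j n) => //; apply: leq_trans nc; exact: leq_maxl.
apply: (lead_n _ d); first exact: leq_maxr.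
apply: (lead_k _ d) => //; apply: (hd (maxn j n)).
  by rewrite leq_max dj.
by apply: (lead_k _ j); [exact: leq_maxl | apply: lead_n hw; exact: leq_maxr].
Qed.

Lemma ypolyU : [/\ subsp (fun v => exists k, ypoly k v),
  stable_all (y :: ys) (fun v => exists k, ypoly k v) & W `<=` (fun v => exists k, ypoly k v)].
Proof.
split=> [|y' [<-|y'in] v [k lv]|w Ww].
- apply: subspP; first by exists 0%N.
  move=> a u v [k lu] [k' lv]; exists (maxn k k').
  apply: (subspZD (subsp_ypoly _)).
    by apply: (chain_mono ypolyS) lu; exact: leq_maxl.
  by apply: (chain_mono ypolyS) lv; exact: leq_maxr.
- by exists k.+1; exact: ypoly_y.
- by exists k; have [h _] := ypoly_stable k; exact: h.
- by exists 1%N, 0, w; rewrite add0r.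
Qed.

End OneMore.

End AscendingChains.

(** * An Artin-Rees lemma *)

Section Rees.
Variables (K : fieldType) (V : lmodType K) (L : finType) (key : L -> nat).
Variables (X : L -> {linear V -> V}) (c : L -> L -> L -> K).
Variables (F : nat -> set V) (i0 : nat).
Hypothesis Xcomm : forall i j v,
  X i (X j v) = X j (X i v) + \sum_k c i j k *: X k v.
Hypothesis c_key : forall i j k, c i j k != 0 -> (key i < key k)%N.
Hypothesis F_sub : forall i, subsp (F i).
Hypothesis F_fin : forall i, fin_dim (F i).
Hypothesis F_S : forall i, F i `<=` F i.+1.
Hypothesis XF : forall l i v, F i v -> F i.+1 (X l v).
Hypothesis F_gen : forall i v, (i0 <= i)%N -> F i.+1 v ->
  lin_span (F i `|` [set v | exists l u, F i u /\ v = X l u]) v.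

(* The Rees module of the family F lives in the space of sequences, where the
   shift plays the role of the Rees parameter. *)
Let VV : lmodType K := nat -> V.

Let addE (f g : VV) i : (f + g) i = f i + g i. Proof. by []. Qed.
Let scaleE a (f : VV) i : (a *: f) i = a *: f i. Proof. by []. Qed.

Definition shift_fun (g : V -> V) (f : VV) : VV := fun i => if i is j.+1 then g (f j) else 0.

Lemma shift_linear (g : {linear V -> V}) : linear (shift_fun g).
Proof.
move=> a u v; apply/funext => i; rewrite addE scaleE.
by case: i => [|i] /=; rewrite ?scaler0 ?addr0 ?linearP.
Qed.

HB.instance Definition _ (g : {linear V -> V}) :=
  GRing.isLinear.Build K VV VV _ (shift_fun g) (shift_linear g).

Let XX l : {linear VV -> VV} := shift_fun (X l).
Let T : {linear VV -> VV} := shift_fun (@idfun V).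

Definition delta_fun (i : nat) (v : V) : VV := fun j => if j == i then v else 0.

Lemma delta_linear i : linear (delta_fun i).
Proof.
move=> a u v; apply/funext => j; rewrite addE scaleE /delta_fun.
by case: eqP; rewrite ?scaler0 ?addr0.
Qed.

HB.instance Definition _ i := GRing.isLinear.Build K V VV _ (delta_fun i) (delta_linear i).

Lemma shift_delta (g : {linear V -> V}) i v :
  shift_fun g (delta_fun i v) = delta_fun i.+1 (g v).
Proof.
apply/funext => -[|j] //=; rewrite /delta_fun eqSS.
by case: eqP => // _; rewrite raddf0.
Qed.

Let ops (ls : seq L) : seq {linear VV -> VV} := [seq XX l | l <- ls] ++ [:: T].

(** Letters are adjoined in order of decreasing key. The commutator of the new letter with an old
    one involves only letters of larger key, which are already present; this is the hypothesis of
    [acc_cons]. *)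
Lemma rees_acc (ls : seq L) : sorted (relpre key leq) ls -> uniq ls ->
  (forall l k, l \in ls -> (key l < key k)%N -> k \in ls) ->
  exists W, [/\ subsp W, stable_all (ops ls) W,
    forall i v, (i <= i0)%N -> F i v -> W (delta_fun i v) & acc (ops ls) W].
Proof.
elim: ls => [|l ls IH] srt unq up.
  have /choice[s hs] : forall i, exists s : seq V, F i `<=` lin_span [set` s].
    by move=> i; case: (F_fin i) => s; exists s.
  pose t := flatten [seq [seq delta_fun i v | v <- s i] | i <- iota 0 i0.+1].
  pose B := lin_span [set` t].
  have hB : subsp B by exact: subsp_span.
  have FB i v : (i <= i0)%N -> F i v -> B (delta_fun i v).
    move=> ii /hs; move: v; apply: span_min; first exact: (subsp_preim _ hB).
    move=> v /= vs; apply: span_sub => /=; apply/flattenP.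
    exists [seq delta_fun i v | v <- s i]; last exact: map_f.
    by apply/mapP; exists i => //; rewrite mem_iota add0n ltnS.
  have hst : stable_all [::] B by [].
  have hc : forall U y', subsp U -> stable_all [::] U -> List.In y' [::] ->
    forall v, U v -> U (T (y' v) - y' (T v)) by [].
  exists (fun v => exists k, ypoly T B k v); have [h1 h2 h3] := ypolyU hB hst hc.
  split=> // [i v ii Fv|]; first by apply: h3; exact: FB.
  apply: acc_cons => //; apply: acc_fin_dim; exact: fin_dim_span.
have lmin l' : l' \in ls -> (key l <= key l')%N.
  move: srt; rewrite /= path_sortedE; last by move=> x y z; exact: leq_trans.
  by case/andP => /allP h _ /h.
have [W [h1 h2 h3 h4]] : exists W, [/\ subsp W, stable_all (ops ls) W,
    forall i v, (i <= i0)%N -> F i v -> W (delta_fun i v) & acc (ops ls) W].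
  apply: IH; [exact: path_sorted srt | by case/andP: unq |].
  move=> l' k l'in lk; have : k \in l :: ls by apply: up lk; rewrite inE l'in orbT.
  rewrite inE => /orP[/eqP e|//]; move: lk; rewrite e ltnNge.
  by rewrite lmin.
have hc : forall U y', subsp U -> stable_all (ops ls) U -> List.In y' (ops ls) ->
    forall v, U v -> U (XX l (y' v) - y' (XX l v)).
  move=> U y' hU sU y'in v Uv.
  move: y'in; rewrite /ops List.in_app_iff => -[|[<-|//]]; last first.
    have -> : XX l (T v) = T (XX l v).
      by apply/funext => -[|[|i]] //=; rewrite raddf0.
    by rewrite subrr; exact: (subsp0 hU).
  elim: (ls) => //= l' ls' IH' [<-|/IH'//].
  (* The left side has degree two in the sequence index and a single letter has degree one; [T]
     makes up the difference. *)
  have -> : XX l (XX l' v) - XX l' (XX l v) = \sum_k c l l' k *: T (XX k v).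
    apply/eqP; rewrite subr_eq; apply/eqP/funext => i.
    rewrite addE fct_sumE; under eq_bigr do rewrite scaleE.
    case: i => [|[|i]] /=.
    - by rewrite big1 ?addr0 // => k _; rewrite scaler0.
    - by rewrite !raddf0 big1 ?addr0 // => k _; rewrite scaler0.
    by rewrite Xcomm addrC.
  apply: (subsp_sum hU) => k _.
  have [->|ck] := eqVneq (c l l' k) 0; first by rewrite scale0r; exact: (subsp0 hU).
  apply: (subspZ hU); apply: (sU T); first by rewrite List.in_app_iff; right; left.
  apply: (sU (XX k)) => //; rewrite List.in_app_iff; left.
  have : k \in l :: ls by apply: up (c_key ck); exact: mem_head.
  rewrite inE => /orP[/eqP e|]; first by move: (c_key ck); rewrite e ltnn.
  by clear; elim: ls => //= x ls IH; rewrite inE => /orP[/eqP->|/IH]; [left|right].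
have [g1 g2 g3] := ypolyU h1 h2 hc.
exists (fun v => exists k, ypoly (XX l) W k v); split=> // [i v ii Fv|].
  by apply: g3; exact: h3.
exact: acc_cons.
Qed.

Variable J : set V.
Hypothesis hJ : subsp J.
Hypothesis XJ : forall l v, J v -> J (X l v).

(** The traces [J]&[F i] up to [i = k], continued beyond [k] by what the letters generate. The
    family grows with [k], and its stabilisation says that high traces are generated by lower
    ones. *)
Fixpoint fam k i : set V :=
  if i is j.+1 then
    if (i <= k)%N then J `&` F i
    else lin_span (fam k j `|` [set v | exists l u, fam k j u /\ v = X l u])
  else J `&` F 0.

Lemma fam_sub k i : subsp (fam k i).
Proof.
case: i => [|i] /=; first exact: (subspI hJ (F_sub _)).
by case: ifP => _; [exact: (subspI hJ (F_sub _)) | exact: subsp_span].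
Qed.

Lemma fam_J k i : fam k i `<=` J `&` F i.
Proof.
elim: i => [|i IH] /=; first by move=> v.
case: ifP => _; first by move=> v.
apply: (span_min (subspI hJ (F_sub i.+1))).
move=> v [/IH[Jv Fv]|[l [u [/IH[Ju Fu] ->]]]]; first by split=> //; exact: F_S.
by split; [exact: XJ | exact: XF].
Qed.

Lemma famE k i : (i <= k)%N -> fam k i = J `&` F i.
Proof. by case: i => [//|i] /= ->. Qed.

Lemma fam_step k i v : fam k i v -> fam k i.+1 v /\ forall l, fam k i.+1 (X l v).
Proof.
move=> fv /=; case: ifP => ik.
  have [Jv Fv] := fam_J fv; split=> [|l]; first by split=> //; exact: F_S.
  by split; [exact: XJ | exact: XF].
split=> [|l]; apply: span_sub; first by left.
by right; exists l, v.
Qed.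

Lemma famS k i : fam k i `<=` fam k.+1 i.
Proof.
elim: i => [//|i IH] v fv; have [ik|ki] := leqP i.+1 k.+1.
  by rewrite famE //; exact: fam_J fv.
move: fv => /=; rewrite !ifN -?ltnNge ?(ltnW ki) //; apply: span_mono.
by move=> u [/IH|[l [u' [/IH h ->]]]]; [left | right; exists l, u'].
Qed.

Theorem rees_artin : exists n0, forall i, (n0 <= i)%N -> J `&` F i.+1 `<=`
  lin_span ((J `&` F i) `|` [set v | exists l u, (J `&` F i) u /\ v = X l u]).
Proof.
pose ls := sort (relpre key leq) (enum L).
have mls l : l \in ls by rewrite mem_sort mem_enum.
have srt : sorted (relpre key leq) ls.
  by apply: sort_sorted => x y; exact: leq_total.
have unq : uniq ls by rewrite sort_uniq enum_uniq.
have [W [hW sW FW accW]] := rees_acc srt unq (fun l k _ _ => mls k).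
have XXin l : List.In (XX l) (ops ls).
  rewrite /ops List.in_app_iff; left; move: (mls l).
  by elim: (ls) => //= x s IH; rewrite inE => /orP[/eqP->|/IH]; [left|right].
have Tin : List.In T (ops ls) by rewrite List.in_app_iff; right; left.
have deltaW i v : F i v -> W (delta_fun i v).
  elim: i v => [|i IH] v Fv; first exact: FW.
  have [ii|ii] := leqP i.+1 i0; first exact: FW.
  have := F_gen ii Fv; move: v {Fv}; apply: span_min.
    exact: (subsp_preim _ hW).
  move=> v [Fv|[l [u [Fu ->]]]] /=.
    by have := sW T Tin _ (IH v Fv); rewrite /= shift_delta.
  by have := sW (XX l) (XXin l) _ (IH u Fu); rewrite /= shift_delta.
pose N k : set VV := fun f => (forall i, fam k i (f i)) /\
  exists n, forall i, (n <= i)%N -> f i = 0.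
have opsE (P : {linear VV -> VV} -> Prop) : P T -> (forall l, P (XX l)) ->
    forall y, List.In y (ops ls) -> P y.
  move=> PT PX y; rewrite List.in_app_iff => -[|[<-|//]//].
  by elim: (ls) => //= l s IH [<-//|/IH].
have [n0 hn0] : exists n0, forall n, (n0 <= n)%N -> N n `<=` N n0.
  apply: accW => k; split.
  - apply: subspP.
      split=> [i|]; [exact: (subsp0 (fam_sub k i)) | by exists 0%N].
    move=> a u v [fu [n hn]] [fv [m hm]]; split.
      by move=> i; exact: (subspZD (fam_sub k i)).
    exists (maxn n m) => i; rewrite geq_max => /andP[ni mi].
    by rewrite addE scaleE hn // hm // scaler0 addr0.
  - apply: opsE => [|l] f [ff [n hn]]; (split; last first);
      try (by exists n.+1 => -[//|i] /= ni; rewrite hn // ?raddf0).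
    + by case=> [|i] /=; [exact: (subsp0 (fam_sub k 0)) | case: (fam_step (ff i))].
    + by case=> [|i] /=; [exact: (subsp0 (fam_sub k 0)) | case: (fam_step (ff i)) => _; apply].
  - move=> f [ff [n hn]].
    have -> : f = \sum_(i < n) delta_fun i (f i).
      apply/funext => j; rewrite fct_sumE /delta_fun.
      have [nj|jn] := leqP n j.
        rewrite hn // big1 // => i _; case: eqP => // e.
        by move: (ltn_ord i); rewrite -e ltnNge nj.
      rewrite (bigD1 (Ordinal jn)) //= eqxx big1 ?addr0 // => i ij.
      by case: eqP => // e; case/eqP: ij; apply: ord_inj.
    apply: (subsp_sum hW) => i _; apply: deltaW.
    by case: (fam_J (ff i)).
  - by move=> f [ff fin]; split=> // i; exact: famS.
exists n0 => i ni v [Jv Fv].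
(* Placed in degree [i.+1], the vector belongs to [N i.+1], hence to [N n0], whose component in a
   degree above [n0] is generated by the component just below. *)
have : N i.+1 (delta_fun i.+1 v).
  split=> [j|]; last first.
    by exists i.+2 => j ij; rewrite /delta_fun gtn_eqF.
  rewrite /delta_fun; case: eqP => [->|_]; last exact: (subsp0 (fam_sub _ _)).
  by rewrite famE.
move/(hn0 i.+1 (leq_trans ni (leqnSn i))) => [/(_ i.+1) + _].
rewrite /delta_fun eqxx /= ifN -?ltnNge //; apply: span_mono.
by move=> u [/fam_J|[l [u' [/fam_J h ->]]]]; [left | right; exists l, u'].
Qed.

End Rees.

(** * Graded algebras and deep parts *)

Section Grading.
Variables (K : fieldType) (A : algType K) (G : int -> set A).
Hypothesis hG : is_grading G.

Lemma G_sub m : subsp (G m). Proof. exact: grading_submod hG m. Qed.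

Lemma components_exist a : exists (x : int -> A) (s : seq int),
  [/\ forall m, G m (x m), uniq s, forall m, m \notin s -> x m = 0 &
      a = \sum_(m <- s) x m].
Proof.
have [s [x [us _ Gx ea]]] : sum_of predT G a by rewrite grading_total.
exists (fun m => if m \in s then x m else 0), s; split=> //.
- by move=> m; case: ifP => // _; exact: (subsp0 (G_sub m)).
- by move=> m /negbTE ->.
- by rewrite ea big_seq [RHS]big_seq; apply: eq_bigr => m ->.
Qed.

Lemma components_unique (x y : int -> A) (s t : seq int) :
  (forall m, G m (x m)) -> (forall m, G m (y m)) -> uniq s -> uniq t ->
  (forall m, m \notin s -> x m = 0) -> (forall m, m \notin t -> y m = 0) ->
  \sum_(m <- s) x m = \sum_(m <- t) y m -> x =1 y.
Proof.
move=> Gx Gy us ut xs yt e m.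
have ext (q : seq int) (z : int -> A) : uniq q -> {subset q <= s ++ t} ->
    (forall m, m \notin q -> z m = 0) ->
    \sum_(m <- q) z m = \sum_(m <- undup (s ++ t)) z m.
  move=> uq qs zq; rewrite [RHS](bigID (mem q)) /=.
  rewrite [X in _ + X]big1 ?addr0 // -[RHS]big_filter; apply: perm_big.
  apply: uniq_perm => //; first by rewrite filter_uniq // undup_uniq.
  move=> k; rewrite mem_filter mem_undup; case: (boolP (k \in q)) => //= kq.
  by rewrite qs.
have h : \sum_(m <- undup (s ++ t)) (x m - y m) = 0.
  rewrite sumrB -(ext s x) // -?(ext t y) ?e ?subrr // => k kin;
    by rewrite mem_cat kin ?orbT.
have [mst|] := boolP (m \in undup (s ++ t)).
  apply/eqP; rewrite -subr_eq0; apply/eqP.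
  apply: (grading_direct hG (undup_uniq _) _ h mst) => k.
  exact: (subspB (G_sub k)).
rewrite mem_undup mem_cat negb_or => /andP[ms mt].
by rewrite xs // yt.
Qed.

Definition comps a := projT1 (cid (components_exist a)).

Definition pr (m : int) (a : A) : A := comps a m.

Lemma prP a : exists s, [/\ forall m, G m (pr m a), uniq s,
  forall m, m \notin s -> pr m a = 0 & a = \sum_(m <- s) pr m a].
Proof. by rewrite /pr /comps; case: cid => x [s h]; exists s. Qed.

Lemma pr_G m a : G m (pr m a). Proof. by have [s [h _ _ _]] := prP a. Qed.

Lemma pr_unique a (y : int -> A) t : (forall m, G m (y m)) -> uniq t ->
  (forall m, m \notin t -> y m = 0) -> a = \sum_(m <- t) y m ->
  forall m, pr m a = y m.
Proof.
move=> Gy ut yt e m; have [s [Gx us xs ea]] := prP a.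
by apply: (components_unique Gx Gy us ut xs yt); rewrite -ea.
Qed.

Lemma pr_linear m : linear (pr m).
Proof.
move=> c u v; have [s [Gu us su eu]] := prP u; have [t [Gv ut tv ev]] := prP v.
apply: (@pr_unique _ (fun m => c *: pr m u + pr m v) (undup (s ++ t))).
- by move=> k; exact: (subspZD (G_sub k)).
- exact: undup_uniq.
- move=> k; rewrite mem_undup mem_cat negb_or => /andP[ks kt].
  by rewrite su // tv // scaler0 addr0.
have ext (q : seq int) (z : int -> A) : uniq q -> {subset q <= s ++ t} ->
    (forall m, m \notin q -> z m = 0) ->
    \sum_(m <- q) z m = \sum_(m <- undup (s ++ t)) z m.
  move=> uq qs zq; rewrite [RHS](bigID (mem q)) /=.
  rewrite [X in _ + X]big1 ?addr0 // -[RHS]big_filter; apply: perm_big.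
  apply: uniq_perm => //; first by rewrite filter_uniq // undup_uniq.
  move=> k; rewrite mem_filter mem_undup; case: (boolP (k \in q)) => //= kq.
  by rewrite qs.
rewrite big_split -scaler_sumr /= -(ext s (pr^~ u)) // -?(ext t (pr^~ v)) -?eu -?ev // => k kin;
  by rewrite mem_cat kin ?orbT.
Qed.

HB.instance Definition _ m := GRing.isLinear.Build K A A _ (pr m) (pr_linear m).

Lemma pr_eq m n a : G n a -> pr m a = if m == n then a else 0.
Proof.
move=> Ga; apply: (@pr_unique _ (fun m => if m == n then a else 0) [:: n]) => //.
- by move=> k; case: eqP => [->//|_]; exact: (subsp0 (G_sub k)).
- by move=> k; rewrite inE => /negbTE ->.
- by rewrite big_seq1 eqxx.
Qed.

Lemma homog_span (S : set A) m a : (forall x, S x -> exists n, G n x) ->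
  lin_span S a -> lin_span (S `&` G m) (pr m a).
Proof.
move=> hS; move: a; apply: span_min.
  exact: (subsp_preim _ (subsp_span _)).
move=> x Sx /=; have [n Gx] := hS x Sx; rewrite (pr_eq m Gx).
case: eqP => [e|_]; last exact: (subsp0 (subsp_span _)).
by apply: span_sub; split=> //; rewrite e.
Qed.

Lemma G1 : G 0 1. Proof. exact: grading_one. Qed.

Lemma GM m n a b : G m a -> G n b -> G (m + n) (a * b).
Proof. exact: grading_mul. Qed.

End Grading.

Section Bimodule.
Variables (K : numFieldType) (A : algType K).

Definition bimul (b c : A) (v : A) : A := b * v * c.

Lemma bimul_linear b c : linear (bimul b c).
Proof. by move=> a u v; rewrite /bimul mulrDr mulrDl -scalerAr -scalerAl. Qed.

HB.instance Definition _ b c := GRing.isLinear.Build K A A _ (bimul b c) (bimul_linear b c).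

Lemma ideal_subsp (I : set A) : two_sided_ideal I -> subsp I.
Proof.
move=> hI; apply: subspP; first exact: Defs.ideal0.
move=> a u v Iu Iv; apply: Defs.idealD => //; rewrite -[u]mul1r scalerAl.
exact: Defs.idealMl.
Qed.

Variable delta : A.

Definition sumop (v : A) : A := delta * v + v * delta.

Lemma sumop_linear : linear sumop.
Proof.
move=> a u v; rewrite /sumop mulrDr mulrDl -scalerAr -scalerAl scalerDr.
by rewrite addrACA.
Qed.

HB.instance Definition _ := GRing.isLinear.Build K A A _ sumop sumop_linear.

Definition lmulop (v : A) : A := delta * v.
Lemma lmulop_linear : linear lmulop.
Proof. by move=> a u v; rewrite /lmulop mulrDr -scalerAr. Qed.
HB.instance Definition _ := GRing.isLinear.Build K A A _ lmulop lmulop_linear.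

Definition rmulop (v : A) : A := v * delta.
Lemma rmulop_linear : linear rmulop.
Proof. by move=> a u v; rewrite /rmulop mulrDl -scalerAl. Qed.
HB.instance Definition _ := GRing.isLinear.Build K A A _ rmulop rmulop_linear.

Variable G : int -> set A.
Hypothesis hG : is_grading G.
Hypothesis T1 : forall (m : int) a, G m a -> delta * a - a * delta = a *~ m.

(** Moving [delta] inwards past [b] from the left adds [m1], and past [c], of degree [- m2], from
    the right adds [m2]. The sum of the two multiplications, rather than their commutator, is taken
    so that both shifts are positive. *)
Lemma sumop_bimul (m1 m2 : nat) b c v : G m1 b -> G (- m2%:Z) c ->
  sumop (bimul b c v) = bimul b c (sumop v + (m1 + m2)%:R *: v).
Proof.
move=> /T1 hb /T1 hc; rewrite /sumop /bimul.
have -> : delta * (b * v * c) = b * delta * v * c + (b * v * c) *+ m1.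
  rewrite !mulrA -[delta * b](subrK (b * delta)) hb -pmulrn.
  by rewrite !mulrDl addrC -!mulrnAl.
have -> : b * v * c * delta = b * v * delta * c + (b * v * c) *+ m2.
  rewrite -!mulrA -[c * delta](subKr (delta * c)) hc mulrNz -pmulrn opprK.
  by rewrite !mulrDr -!mulrnAr !mulrA.
rewrite addrACA -mulrnDr !mulrDr !mulrDl -scalerAr -scalerAl scaler_nat.
by rewrite !mulrA.
Qed.

(** The components of [delta] are eigenvectors of the commutator with [delta], and their sum
    commutes with itself; in characteristic zero only degree zero survives. *)
Lemma delta_G0 : G 0 delta.
Proof.
have [s [Gd us sd e]] := prP hG delta.
have h : \sum_(m <- s) (pr hG m delta) *~ m = 0.
  have : delta * delta - delta * delta = 0 by rewrite subrr.
  rewrite {2 3}e mulr_sumr mulr_suml -sumrB => h; rewrite -[RHS]h.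
  by apply: eq_bigr => m _; rewrite (T1 (Gd m)).
have Gz m : G m (pr hG m delta *~ m) by rewrite -scaler_int; exact: (subspZ (G_sub hG m)).
have h0 m : m \in s -> pr hG m delta *~ m = 0.
  exact: (grading_direct hG us Gz h).
rewrite e; apply: (subsp_sum_seq (G_sub hG 0)) => m ms.
have [->|m0] := eqVneq m 0; first exact: Gd.
have := h0 m ms; rewrite -scaler_int => /eqP; rewrite scaler_eq0 intr_eq0 (negbTE m0) /=.
by move/eqP => ->; exact: (subsp0 (G_sub hG 0)).
Qed.

End Bimodule.

Section Depth.
Variables (K : numFieldType) (A : algType K) (G : int -> set A) (delta : A).
Hypothesis hG : is_grading G.
Hypothesis T1 : forall (m : int) a, G m a -> delta * a - a * delta = a *~ m.

(** The outer factors range over all homogeneous elements of [A], not only over the two subalgebras;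
    so depth does not refer to a choice of letters. *)
Definition deep_part (M : nat) : set A := lin_span [set x |
  exists (m1 m2 : nat) (b v c : A),
    [/\ G m1 b, G (- m2%:Z) c, (M <= m1 + m2)%N & x = bimul b c v]].

Lemma deep_sub M : subsp (deep_part M). Proof. exact: subsp_span. Qed.

Lemma deep_mono M N : (M <= N)%N -> deep_part N `<=` deep_part M.
Proof.
move=> MN; apply: span_mono => x [m1 [m2 [b [v [c [? ? ? ?]]]]]].
by exists m1, m2, b, v, c; split=> //; exact: leq_trans MN _.
Qed.

Lemma deep_bimul (m1 m2 : nat) b c M v : G m1 b -> G (- m2%:Z) c ->
  deep_part M v -> deep_part (m1 + m2 + M) (bimul b c v).
Proof.
move=> Gb Gc; move: v; apply: span_min; first exact: (subsp_preim _ (deep_sub _)).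
move=> _ [n1 [n2 [b' [v [c' [Gb' Gc' Mn ->]]]]]] /=; apply: span_sub.
exists (m1 + n1)%N, (n2 + m2)%N, (b * b'), v, (c' * c); split.
- by rewrite PoszD; exact: (GM hG).
- by rewrite PoszD opprD; exact: (GM hG).
- by move: Mn; lia.
- by rewrite /bimul !mulrA.
Qed.

Lemma deep_sumop M v : deep_part M v -> deep_part M (sumop delta v).
Proof.
move: v; apply: span_min; first exact: (subsp_preim _ (deep_sub _)).
move=> _ [m1 [m2 [b [v [c [Gb Gc Mn ->]]]]]] /=; apply: span_sub.
exists m1, m2, b, (sumop delta v + (m1 + m2)%:R *: v), c; split=> //.
exact: (sumop_bimul T1).
Qed.

End Depth.

Section Separation.
Variables (R : realType) (A : algType R[i]) (G : int -> set A) (delta : A).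
Hypothesis T1 : forall (m : int) a, G m a -> delta * a - a * delta = a *~ m.
Variables (L : finType) (b c : L -> A) (d1 d2 : L -> nat) (cst : L -> L -> L -> R[i]).
Hypothesis Gb : forall l, G (d1 l) (b l).
Hypothesis Gc : forall l, G (- (d2 l)%:Z) (c l).
Let d l := (d1 l + d2 l)%N.
Hypothesis d_gt0 : forall l, (0 < d l)%N.
Let X l : {linear A -> A} := bimul (b l) (c l).
Hypothesis Xcomm : forall i j v,
  X i (X j v) = X j (X i v) + \sum_k cst i j k *: X k v.
Hypothesis c_d : forall i j k, cst i j k != 0 -> d k = (d i + d j)%N.
Hypothesis deep_words : forall M, exists M', deep_part G M' `<=`
  lin_span [set v | exists ga u, (M <= tot d ga)%N /\ v = wact X ga u].
Variables (F : nat -> set A) (i0 : nat).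
Hypothesis F_sub : forall i, subsp (F i).
Hypothesis F_fin : forall i, fin_dim (F i).
Hypothesis F_S : forall i, F i `<=` F i.+1.
Hypothesis F_all : forall v, exists i, F i v.
Hypothesis XF : forall l i v, F i v -> F i.+1 (X l v).
Hypothesis F_gen : forall i v, (i0 <= i)%N -> F i.+1 v ->
  lin_span (F i `|` [set v | exists l u, F i u /\ v = X l u]) v.
Hypothesis EF : forall i v, F i v -> F i.+1 (sumop delta v).

Lemma order1_list (Z U : set A) (s : seq A) : subsp Z ->
  (forall v, v \in s -> lin_span (U `|` [set v | exists l u, U u /\ v = X l u])
     (sumop delta v)) ->
  U `<=` lin_span [set` s] ->
  order1 X (sumop delta) Z (fun k : 'I_(size s) => s`_k).
Proof.
move=> hZ hs Us k; set W := lin_span _.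
have hW : subsp W by exact: subsp_span.
have sW v : v \in s -> W v.
  move=> vs; apply: span_sub; right; left.
  have iv : (index v s < size s)%N by rewrite index_mem.
  by exists (Ordinal iv) => //=; rewrite nth_index.
have sXW l v : v \in s -> W (X l v).
  move=> vs; apply: span_sub; right; right.
  have iv : (index v s < size s)%N by rewrite index_mem.
  by exists l, (Ordinal iv) => //=; rewrite nth_index.
have := hs _ (mem_nth 0 (ltn_ord k)); apply: span_min => //.
move=> v [/Us|[l [u [/Us + ->]]]].
  by apply: span_min.
move: u; apply: span_min; first exact: (subsp_preim _ hW).
by move=> u /= us; exact: sXW.
Qed.

(** [joseph_nakayama] with [Z = I], the generators being bases of [F i] for [A] and of [J]&[F i] for
    [J]. That [E] appends at most one letter to the latter is the Artin-Rees lemma, since [E] maps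
    [J]&[F i] into [J]&[F i.+1]. *)
Theorem deep_separation (I J : set A) : two_sided_ideal I -> two_sided_ideal J ->
  I `<=` J -> (forall M, J `<=` addsp I (deep_part G M)) -> J `<=` I.
Proof.
move=> idI idJ IJ JI x Jx.
have hI := ideal_subsp idI; have hJ := ideal_subsp idJ.
have XI l z : I z -> I (X l z).
  move=> Iz; change (I (b l * z * c l)).
  by apply: (Defs.idealMr idI); exact: (Defs.idealMl idI).
have XJ l z : J z -> J (X l z).
  move=> Jz; change (J (b l * z * c l)).
  by apply: (Defs.idealMr idJ); exact: (Defs.idealMl idJ).
have EI z : I z -> I (sumop delta z).
  move=> Iz; change (I (delta * z + z * delta)).
  by apply: (Defs.idealD idI); [exact: (Defs.idealMl idI) | exact: (Defs.idealMr idI)].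
have EJ z : J z -> J (sumop delta z).
  move=> Jz; change (J (delta * z + z * delta)).
  by apply: (Defs.idealD idJ); [exact: (Defs.idealMl idJ) | exact: (Defs.idealMr idJ)].
have c_key i j k : cst i j k != 0 -> (d i < d k)%N.
  by move/c_d => ->; rewrite -[X in (X < _)%N]addn0 ltn_add2l.
have [n0 hn0] := rees_artin Xcomm c_key F_sub F_fin F_S XF F_gen hJ XJ.
have F_mono := fun i j => @chain_mono _ _ F i j F_S.
have [a Fa] := F_all x; pose i := maxn a (maxn n0 i0).
have n0i : (n0 <= i)%N by rewrite !leq_max leqnn orbT.
have i0i : (i0 <= i)%N by rewrite !leq_max leqnn !orbT.
have [s [sJ Js]] := fin_dim_basis (subspI hJ (F_sub i)) (fin_dim_sub (F_fin i) (@subIsetr _ _ _)).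
have [t [tF Ft]] := fin_dim_basis (F_sub i) (F_fin i).
have hs : order1 X (sumop delta) I (fun k : 'I_(size s) => s`_k).
  apply: (order1_list hI _ Js) => v /sJ[Jv Fv].
  by apply: hn0 => //; split; [exact: EJ | exact: EF].
have ht : order1 X (sumop delta) I (fun k : 'I_(size t) => t`_k).
  by apply: (order1_list hI _ Ft) => v /tF Fv; apply: F_gen => //; exact: EF.
pose W := lin_span (I `|` [set v | exists ga (k : 'I_(size t)), v = wact X ga t`_k]).
have hW : subsp W by exact: subsp_span.
have WX l v : W v -> W (X l v).
  move: v; apply: span_min; first exact: (subsp_preim _ hW).
  move=> v [Iv|[ga [k ->]]]; apply: span_sub; first by left; exact: XI.
  by right; exists (l :: ga), k.
have FW j v : F j v -> W v.
  elim: j v => [|j IH] v Fv.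
    have := Ft _ (F_mono 0%N i isT _ Fv); apply: span_min => // u /= ut.
    apply: span_sub; right; have iu : (index u t < size t)%N by rewrite index_mem.
    by exists [::], (Ordinal iu); rewrite /= nth_index.
  have [ji|ij] := leqP j.+1 i.
    have := Ft _ (F_mono _ _ ji _ Fv); apply: span_min => // u /= ut.
    apply: span_sub; right; have iu : (index u t < size t)%N by rewrite index_mem.
    by exists [::], (Ordinal iu); rewrite /= nth_index.
  have := F_gen (leq_trans i0i ij) Fv; apply: span_min => //.
  by move=> u [/IH//|[l [u' [/IH Wu' ->]]]]; exact: WX.
have Wspan v : W v by have [j Fj] := F_all v; exact: FW Fj.
have EX l v : sumop delta (X l v) = X l (sumop delta v + (d l)%:R *: v).
  exact: (sumop_bimul T1).
have udeep M (k : 'I_(size s)) : lin_span (I `|` [set v | exists ga v',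
    (M <= tot d ga)%N /\ v = wact X ga v']) s`_k.
  have [M' hM'] := deep_words M.
  have [Jk _] := sJ _ (mem_nth 0 (ltn_ord k)).
  have [y [z [Iy Dz ->]]] := JI M' _ Jk.
  apply: (subspD (subsp_span _)); first by apply: span_sub; left.
  by move: (hM' z Dz); apply: span_mono => v h; right.
have main := joseph_nakayama d_gt0 Xcomm c_d EX hI XI EI Wspan ht hs udeep.
have : lin_span [set` s] x.
  by apply: Js; split=> //; apply: (F_mono a i) => //; rewrite leq_max leqnn.
apply: span_min => // v /= vs.
have iv : (index v s < size s)%N by rewrite index_mem.
by have := main (Ordinal iv); rewrite /= nth_index.
Qed.

End Separation.

(** * Triangular structures *)

Section Words.
Variables (K : fieldType) (A : algType K).

Definition words (P : seq A) : set A :=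
  [set x | exists2 w : seq A, all (mem P) w & x = \prod_(y <- w) y].

Lemma subalgP (B : set A) : B 1 -> subsp B -> (forall x y, B x -> B y -> B (x * y)) ->
  subalg_closed [in B].
Proof.
move=> B1 hB BM; split; first by rewrite inE.
  by move=> a u v; rewrite !inE; exact: subspZD.
by move=> u v; rewrite !inE; exact: BM.
Qed.

Lemma subalg_1 (B : set A) : subalg_closed [in B] -> B 1.
Proof. by case; rewrite inE. Qed.

Lemma subalg_M (B : set A) : subalg_closed [in B] ->
  forall x y, B x -> B y -> B (x * y).
Proof. by case=> _ _ h x y Bx By; have := h x y; rewrite !inE => /(_ Bx By). Qed.

Lemma subalg_subsp (B : set A) : subalg_closed [in B] -> subsp B.
Proof.
case; rewrite !inE => B1 BZ BM; apply: subspP.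
  have := BZ (-1) 1 1; rewrite !inE => /(_ B1 B1).
  by rewrite scaleN1r addNr.
by move=> a u v Bu Bv; have := BZ a u v; rewrite !inE => /(_ Bu Bv).
Qed.

Lemma words_subalg P : subalg_closed [in lin_span (words P)].
Proof.
have h := subsp_span (words P); apply: subalgP => //.
  by apply: span_sub; exists [::]; rewrite ?big_nil.
move=> x y Sx Sy; move: x Sx; apply: span_min.
  apply: subspP => [|a u v]; first by rewrite mul0r; exact: (subsp0 h).
  by rewrite mulrDl -scalerAl; exact: (subspZD h).
move=> x [w Pw ->]; move: y Sy; apply: span_min.
  apply: subspP => [|a u v]; first by rewrite mulr0; exact: (subsp0 h).
  by rewrite mulrDr -scalerAr; exact: (subspZD h).
move=> y [w' Pw' ->]; apply: span_sub; exists (w ++ w').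
  by rewrite all_cat Pw.
by rewrite big_cat.
Qed.

Lemma gen_subalg_min (S B : set A) : subalg_closed [in B] -> S `<=` B ->
  gen_subalg S `<=` B.
Proof. by move=> hB SB x; apply; split. Qed.

Lemma gen_subalg_sub (S : set A) : S `<=` gen_subalg S.
Proof. by move=> x Sx B [_]; exact. Qed.

End Words.

Section GradedLetters.
Variables (K : numFieldType) (A : algType K) (G : int -> set A).
Hypothesis hG : is_grading G.
Variables (B : set A) (sg : nat -> int).
Hypothesis hB : graded_subalg G B.
Hypothesis Bsg : forall m a, B a -> G m a -> a != 0 ->
  (exists k : K, a = k%:A) \/ exists2 n, (0 < n)%N & m = sg n.

Lemma graded_pr a m : B a -> B (pr hG m a).
Proof.
case: hB => sB e; rewrite -{1}e => -[s [x [us _ Bx ->]]]; rewrite raddf_sum.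
apply: (subsp_sum_seq (subalg_subsp sB)) => k ks.
have [Bk Gk] := Bx k; rewrite /= (pr_eq hG m Gk); case: eqP => // _.
exact: (subsp0 (subalg_subsp sB)).
Qed.

(** The homogeneous components of the generators serve as letters. Scalar components are dropped,
    the empty word accounting for them, so that all letters have nonzero degree. *)
Lemma graded_letters (s : seq A) : (forall x, x \in s -> B x) -> exists P : seq A,
  (forall x, x \in P -> B x /\ exists2 n, (0 < n)%N & G (sg n) x) /\
  forall x, x \in s -> lin_span (words P) x.
Proof.
move=> sB; elim: s sB => [|x s IH] sB; first by exists [::].
have [P [hP1 hP2]] := IH (fun y ys => sB y (mem_behead (s := x :: s) ys)).
have Bx := sB x (mem_head _ _).
have [t [Gx ut xt ex]] := prP hG x.
pose Q := [seq y <- [seq pr hG m x | m <- t] |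
   `[< exists2 n, (0 < n)%N & G (sg n) y >]].
exists (Q ++ P); split=> y.
  rewrite mem_cat => /orP[|/hP1//]; rewrite mem_filter => /andP[/asboolP h].
  by case/mapP => m _ e; split; [rewrite e; exact: graded_pr | exact: h].
have mono z : lin_span (words P) z -> lin_span (words (Q ++ P)) z.
  apply: span_mono => u [w Pw ->]; exists w => //.
  by apply: sub_all Pw => v /=; rewrite mem_cat orbC => ->.
rewrite inE => /orP[/eqP->|/hP2/mono//]; rewrite ex.
have h := subsp_span (words (Q ++ P)).
apply: (subsp_sum_seq h) => m mt.
have [->|p0] := eqVneq (pr hG m x) 0; first exact: (subsp0 h).
have [[k ->]|[n n0 e]] := Bsg (graded_pr m Bx) (Gx m) p0.
  apply: (subspZ h); exact: (subalg_1 (words_subalg _)).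
apply: span_sub; exists [:: pr hG m x]; last by rewrite big_seq1.
rewrite /= andbT mem_cat mem_filter; apply/orP; left; apply/andP; split.
  by apply/asboolP; exists n => //; rewrite -e.
exact: map_f.
Qed.

End GradedLetters.

Section Triangular.
Variables (K : numFieldType) (A : algType K) (G : int -> set A) (Ap Am : set A) (delta : A).
Hypothesis hG : is_grading G.
Hypothesis tri : triangular G Ap Am delta.

Let hAp := tri_Ap tri.
Let hAm := tri_Am tri.

Lemma Ap_sub : subsp Ap. Proof. by case: hAp => /subalg_subsp. Qed.
Lemma Am_sub : subsp Am. Proof. by case: hAm => /subalg_subsp. Qed.

Lemma Ap_sign m a : Ap a -> G m a -> a != 0 ->
  (exists k : K, a = k%:A) \/ exists2 n, (0 < n)%N & m = Posz n.
Proof.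
move=> Ba Ga a0; have [m0|m0|e] := ltgtP m 0.
- have : homog G Ap m a by [].
  by rewrite (tri_T2_pos tri m0) => e; rewrite e eqxx in a0.
- by right; case: m m0 Ga => // n n0 _; exists n.
- left; have : homog G Ap 0 a by split=> //; rewrite -e.
  by rewrite (tri_T2_zero tri).1 => -[k _ <-]; exists k.
Qed.

Lemma Am_sign m a : Am a -> G m a -> a != 0 ->
  (exists k : K, a = k%:A) \/ exists2 n, (0 < n)%N & m = - n%:Z.
Proof.
move=> Ba Ga a0; have [m0|m0|e] := ltgtP m 0; last first.
- left; have : homog G Am 0 a by split=> //; rewrite -e.
  by rewrite (tri_T2_zero tri).2 => -[k _ <-]; exists k.
- have : homog G Am m a by [].
  by rewrite (tri_T2_neg tri m0) => e; rewrite e eqxx in a0.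
- by right; exists `|m|%N; [rewrite absz_gt0 lt_eqF | rewrite ltz0_abs // opprK].
Qed.

Lemma Ap_nat a m : Ap a -> exists n : nat, G n (pr hG m a) /\ Ap (pr hG m a).
Proof.
move=> Ba; have Bp := graded_pr hG hAp m Ba.
have [e|p0] := eqVneq (pr hG m a) 0.
  by exists 0%N; rewrite e; split; [exact: (subsp0 (G_sub hG 0)) | exact: (subsp0 Ap_sub)].
have [[k e]|[n _ e]] := Ap_sign Bp (pr_G hG m a) p0.
  by exists 0%N; split=> //; rewrite e; apply: (subspZ (G_sub hG 0)); exact: (G1 hG).
by exists n; split=> //; rewrite -e; exact: pr_G.
Qed.

Lemma Am_nat a m : Am a -> exists n : nat, G (- n%:Z) (pr hG m a) /\ Am (pr hG m a).
Proof.
move=> Ba; have Bp := graded_pr hG hAm m Ba.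
have [e|p0] := eqVneq (pr hG m a) 0.
  by exists 0%N; rewrite e; split; [exact: (subsp0 (G_sub hG _)) | exact: (subsp0 Am_sub)].
have [[k e]|[n _ e]] := Am_sign Bp (pr_G hG m a) p0.
  by exists 0%N; split=> //; rewrite e; apply: (subspZ (G_sub hG 0)); exact: (G1 hG).
by exists n; split=> //; rewrite -e; exact: pr_G.
Qed.

Definition homog_products (S : set A) : set A := [set x |
  exists (m1 m2 : nat) (b c g : A),
    [/\ Ap b /\ G m1 b, Am c /\ G (- m2%:Z) c, S g & x = bimul b c g]].

Lemma products_homog (S : set A) b c g : Ap b -> Am c -> S g ->
  lin_span (homog_products S) (bimul b c g).
Proof.
move=> Bb Bc Sg; have h := subsp_span (homog_products S).
have [s [_ _ _ eb]] := prP hG b; have [t [_ _ _ ec]] := prP hG c.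
have -> : bimul b c g = \sum_(m <- s) \sum_(n <- t) bimul (pr hG m b) (pr hG n c) g.
  rewrite /bimul {1}eb {1}ec !mulr_suml; apply: eq_bigr => m _.
  by rewrite mulr_sumr.
apply: (subsp_sum h) => m _; apply: (subsp_sum h) => n _.
have [m1 [? ?]] := Ap_nat m Bb; have [m2 [? ?]] := Am_nat n Bc.
by apply: span_sub; exists m1, m2, (pr hG m b), (pr hG n c), g.
Qed.

Lemma homogeneous_generators : exists gs : seq A,
  (forall g, g \in gs -> exists e, G e g) /\
  forall v, lin_span (homog_products [set` gs]) v.
Proof.
have [s hs] := tri_T0 tri.
have /choice[t ht] : forall g, exists t : seq int, g = \sum_(m <- t) pr hG m g.
  by move=> g; have [t [_ _ _ e]] := prP hG g; exists t.
exists (flatten [seq [seq pr hG m g | m <- t g] | g <- s]); split.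
  move=> g /flattenP[_ /mapP[h _ ->] /mapP[m _ ->]]; exists m; exact: pr_G.
set gs := flatten _ => v; have h := subsp_span (homog_products [set` gs]).
have [n [b [g [c [Bb gsin Bc ->]]]]] := hs v.
apply: (subsp_sum h) => i _.
have -> : b i * g i * c i = \sum_(m <- t (g i)) bimul (b i) (c i) (pr hG m (g i)).
  by rewrite -linear_sum -ht.
apply: (subsp_sum_seq h) => m mt; apply: products_homog => //=.
apply/flattenP; exists [seq pr hG m g' | g' <- [:: g i], m <- t g'].
  by apply/mapP; exists (g i); rewrite //= cats0.
by rewrite /= cats0; exact: map_f.
Qed.

Section FullLetters.
Variables (L : finType) (b c : L -> A) (d1 d2 : L -> nat).
Let d l := (d1 l + d2 l)%N.
Hypothesis d_gt0 : forall l, (0 < d l)%N.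
Let X l : {linear A -> A} := bimul (b l) (c l).

(** The degree of the words is exactly [m1 + m2], not merely bounded by it; thus depth in [A]
    translates into degree of words. *)
Definition full_letters : Prop := forall (m1 m2 : nat) b0 c0 v,
  Ap b0 -> G m1 b0 -> Am c0 -> G (- m2%:Z) c0 ->
  lin_span [set x | exists ga, tot d ga = (m1 + m2)%N /\ x = wact X ga v] (bimul b0 c0 v).

Hypothesis full : full_letters.

Lemma degree_eq m n a : G m a -> G n a -> a = 0 \/ m = n.
Proof.
move=> Gm Gn; have := pr_eq hG m Gn; rewrite (pr_eq hG m Gm) eqxx.
by case: eqP => [->|_]; [right | left].
Qed.

(** The outer factors in [deep_part] are arbitrary, so the one of large degree is expanded through
    the bimodule generators. These have degrees bounded by [e1], hence the factor from [Ap] or [Am]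
    still has degree at least [M], and the rest is moved into the middle. *)
Lemma full_deep_words M : exists M', deep_part G M' `<=`
  lin_span [set v | exists ga u, (M <= tot d ga)%N /\ v = wact X ga u].
Proof.
have [gs [Ggs Agen]] := homogeneous_generators.
have /choice[e he] : forall g, exists e, g \in gs -> G e g.
  move=> g; have [/Ggs[e Ge]|_] := boolP (g \in gs); first by exists e.
  by exists 0.
(* Twice [M + e1], so that one of the two outer degrees is at least [M + e1]. *)
pose e1 := (\max_(g <- gs) `|e g|)%N; exists (M + e1 + (M + e1))%N.
set W := lin_span _; have hW : subsp W by exact: subsp_span.
apply: span_min => // _ [m1 [m2 [b0 [v [c0 [Gb0 Gc0 Mm ->]]]]]].
have hom x : homog_products [set` gs] x -> exists n, G n x.
  move=> [n1 [n2 [b1 [c1 [g [[_ Gb1] [_ Gc1] gin ->]]]]]].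
  by exists (n1%:Z + e g - n2%:Z); apply: (GM hG); [apply: (GM hG) => //; exact: he |].
have ebound g : g \in gs -> (`|e g| <= e1)%N.
  by move=> gin; apply: (bigop.bigmaxn_sup_seq _ gin).
have tot_W ga u : (M <= tot d ga)%N -> W (wact X ga u).
  by move=> h; apply: span_sub; exists ga, u.
have prod_W (n1 n2 : nat) b1 c1 u : Ap b1 -> G n1 b1 -> Am c1 -> G (- n2%:Z) c1 ->
    (M <= n1 + n2)%N -> W (bimul b1 c1 u).
  move=> Bb1 Gb1 Bc1 Gc1 Mn; have := @full n1 n2 b1 c1 u Bb1 Gb1 Bc1 Gc1.
  by apply: span_min => // _ [ga [eg ->]]; apply: tot_W; rewrite eg.
have Ap1 : Ap 1 by case: hAp => /subalg_1.
have Am1 : Am 1 by case: hAm => /subalg_1.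
have G1' : G (- 0%:Z) 1 by exact: (G1 hG).
have [m1M|m1M] := leqP (M + e1) m1.
  have hL : subsp (fun x => W (bimul x c0 v)).
    apply: subspP; first by rewrite /bimul !mul0r; exact: (subsp0 hW).
    move=> a x y Wx Wy; have -> : bimul (a *: x + y) c0 v = a *: bimul x c0 v + bimul y c0 v.
      by rewrite /bimul !mulrDl -!scalerAl.
    exact: (subspZD hW).
  have := @homog_span _ _ _ hG _ m1 _ hom (Agen b0); rewrite (pr_eq hG m1 Gb0) eqxx.
  apply: (span_min hL) => x [[n1 [n2 [b1 [c1 [g [[Bb1 Gb1] [Bc1 Gc1] gin ->]]]]]] Gx].
  have Gx' : G (n1%:Z + e g - n2%:Z) (bimul b1 c1 g).
    by apply: (GM hG); [apply: (GM hG) => //; exact: he |].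
  have [->|em] := degree_eq Gx Gx'; first by rewrite /bimul !mul0r; exact: (subsp0 hW).
  have -> : bimul (bimul b1 c1 g) c0 v = bimul b1 1 (g * c1 * v * c0).
    by rewrite /bimul mulr1 !mulrA.
  apply: (prod_W n1 0%N) => //; rewrite addn0.
  by have := ebound g gin; lia.
have m2M : (M + e1 <= m2)%N by lia.
have hL : subsp (fun x => W (bimul b0 x v)).
  apply: subspP; first by rewrite /bimul !mulr0; exact: (subsp0 hW).
  move=> a x y Wx Wy; have -> : bimul b0 (a *: x + y) v = a *: bimul b0 x v + bimul b0 y v.
    by rewrite /bimul !mulrDr -!scalerAr.
  exact: (subspZD hW).
have := @homog_span _ _ _ hG _ (- m2%:Z) _ hom (Agen c0); rewrite (pr_eq hG _ Gc0) eqxx.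
apply: (span_min hL) => x [[n1 [n2 [b1 [c1 [g [[Bb1 Gb1] [Bc1 Gc1] gin ->]]]]]] Gx].
have Gx' : G (n1%:Z + e g - n2%:Z) (bimul b1 c1 g).
  by apply: (GM hG); [apply: (GM hG) => //; exact: he |].
have [->|em] := degree_eq Gx Gx'; first by rewrite /bimul !mulr0; exact: (subsp0 hW).
have -> : bimul b0 (bimul b1 c1 g) v = bimul 1 c1 (b0 * v * b1 * g).
  by rewrite /bimul mul1r !mulrA.
apply: (prod_W 0%N n2) => //; rewrite add0n.
by have := ebound g gin; lia.
Qed.

Fixpoint short_words n : seq (seq L) :=
  if n is n'.+1 then [::] :: [seq l :: w | l <- enum L, w <- short_words n']
  else [:: [::]].

Lemma mem_short_words n (w : seq L) : (size w <= n)%N -> w \in short_words n.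
Proof.
elim: n w => [|n IH] [|l w] //= wn; rewrite inE; apply/orP; right.
by apply/allpairsP; exists (l, w); rewrite mem_enum IH.
Qed.

(** Products of degree below [M] are spanned by words of length below [M], as letters have positive
    degree, and there are finitely many of those. *)
Lemma full_cofinite M (S : set A) (gs : seq A) : subsp S ->
  (forall v, lin_span (homog_products [set` gs]) v) ->
  (forall (m1 m2 : nat) b0 c0 g, Ap b0 -> G m1 b0 -> Am c0 -> G (- m2%:Z) c0 -> g \in gs ->
     (M <= m1 + m2)%N -> S (bimul b0 c0 g)) ->
  exists s : seq A, forall v, addsp S (lin_span [set` s]) v.
Proof.
move=> hS Agen SM.
pose s := [seq wact X ga g | ga <- short_words M, g <- gs].
exists s => v; have hA := subsp_add hS (subsp_span [set` s]).
move: v (Agen v); apply: span_min => //.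
move=> _ [m1 [m2 [b0 [c0 [g [[Bb Gb0] [Bc Gc0] gin ->]]]]]].
have [Mm|mM] := leqP M (m1 + m2).
  by apply: (addspl (subsp_span _)); exact: (SM m1 m2).
apply: (addspr hS); move: (@full m1 m2 b0 c0 g Bb Gb0 Bc Gc0); apply: span_mono.
move=> _ [ga [e ->]] /=; apply/allpairsP; exists (ga, g); split=> //=.
apply: mem_short_words; apply: leq_trans (size_tot ga d_gt0) _.
by rewrite e ltnW.
Qed.

End FullLetters.

End Triangular.

Section ListLetters.
Variables (K : numFieldType) (A : algType K) (G : int -> set A) (Ap Am : set A).
Hypothesis hG : is_grading G.
Variables (P Q : seq A).
Hypothesis hP : forall x, x \in P -> exists2 n : nat, (0 < n)%N & G n x.
Hypothesis hQ : forall x, x \in Q -> exists2 n : nat, (0 < n)%N & G (- n%:Z) x.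
Hypothesis PA : forall a, Ap a -> lin_span (words P) a.
Hypothesis QA : forall a, Am a -> lin_span (words Q) a.

Definition letter : finType := ('I_(size P) + 'I_(size Q))%type.
Definition lletter (l : letter) : A := if l is inl i then P`_i else 1.
Definition rletter (l : letter) : A := if l is inr j then Q`_j else 1.
Let X l : {linear A -> A} := bimul (lletter l) (rletter l).

Lemma indices (T : seq A) w : all (mem T) w ->
  exists ga : seq 'I_(size T), w = [seq T`_(i : 'I_(size T)) | i <- ga].
Proof.
elim: w => [|x w IH] /=; first by exists [::].
move=> /andP[xT /IH[ga ->]]; have i : (index x T < size T)%N by rewrite index_mem.
by exists (Ordinal i :: ga); rewrite /= nth_index.
Qed.

Lemma wact_inl (ga : seq 'I_(size P)) v :
  wact X [seq inl i | i <- ga] v = (\prod_(i <- ga) P`_i) * v.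
Proof.
elim: ga => [|i ga IH]; first by rewrite big_nil mul1r.
by rewrite big_cons /= IH /bimul mulr1 mulrA.
Qed.

Lemma wact_inr (ga : seq 'I_(size Q)) v :
  wact X [seq inr i | i <- rev ga] v = v * \prod_(i <- ga) Q`_i.
Proof.
elim/last_ind: ga => [|ga i IH]; first by rewrite big_nil mulr1.
by rewrite rev_rcons /= IH -cats1 big_cat big_seq1 /bimul /= mul1r -mulrA.
Qed.

Lemma list_letters : exists d1 d2 : letter -> nat,
  [/\ forall l, G (d1 l) (lletter l), forall l, G (- (d2 l)%:Z) (rletter l),
      forall l, (0 < d1 l + d2 l)%N & full_letters G Ap Am lletter rletter d1 d2].
Proof.
have /choice[dP hdP] : forall i : 'I_(size P), exists n : nat, (0 < n)%N /\ G n P`_i.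
  by move=> i; have [n n0 Gn] := hP (mem_nth 0 (ltn_ord i)); exists n.
have /choice[dQ hdQ] : forall i : 'I_(size Q), exists n : nat, (0 < n)%N /\ G (- n%:Z) Q`_i.
  by move=> i; have [n n0 Gn] := hQ (mem_nth 0 (ltn_ord i)); exists n.
pose d1 (l : letter) := if l is inl i then dP i else 0%N.
pose d2 (l : letter) := if l is inr i then dQ i else 0%N.
exists d1, d2; split=> [[i|i]|[i|i]|[i|i]|] /=; try exact: (G1 hG).
- by case: (hdP i).
- by case: (hdQ i).
- by rewrite addn0; case: (hdP i).
- by case: (hdQ i).
have GP (ga : seq 'I_(size P)) : G (tot dP ga) (\prod_(i <- ga) P`_i).
  elim: ga => [|i ga IH]; first by rewrite big_nil; exact: (G1 hG).
  by rewrite big_cons tot_cons PoszD; apply: (GM hG) => //; case: (hdP i).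
have GQ (ga : seq 'I_(size Q)) : G (- (tot dQ ga)%:Z) (\prod_(i <- ga) Q`_i).
  elim: ga => [|i ga IH]; first by rewrite big_nil; exact: (G1 hG).
  by rewrite big_cons tot_cons PoszD opprD; apply: (GM hG) => //; case: (hdQ i).
have homP x : words P x -> exists n, G n x.
  by move=> [w /indices[ga ->] ->]; rewrite big_map; exists (Posz (tot dP ga)).
have homQ x : words Q x -> exists n, G n x.
  by move=> [w /indices[ga ->] ->]; rewrite big_map; exists (- (tot dQ ga)%:Z).
move=> m1 m2 b0 c0 v Bb Gb Bc Gc.
set W := lin_span _; have hW : subsp W by exact: subsp_span.
have := @homog_span _ _ _ hG _ m1 _ homP (PA Bb); rewrite (pr_eq hG _ Gb) eqxx.
have hL c : subsp (fun x => W (bimul x c v)).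
  apply: subspP; first by rewrite /bimul !mul0r; exact: (subsp0 hW).
  move=> a x y Wx Wy; have -> : bimul (a *: x + y) c v = a *: bimul x c v + bimul y c v.
    by rewrite /bimul !mulrDl -!scalerAl.
  exact: (subspZD hW).
apply: (span_min (hL c0)) => x [[w /indices[ga ->] ->]]; rewrite big_map => Gx.
set x0 := \prod_(i <- ga) _ in Gx *.
have := @homog_span _ _ _ hG _ (- m2%:Z) _ homQ (QA Bc); rewrite (pr_eq hG _ Gc) eqxx.
have hR : subsp (fun y => W (bimul x0 y v)).
  apply: subspP; first by rewrite /bimul !mulr0; exact: (subsp0 hW).
  move=> a y z Wx Wy; have -> : bimul x0 (a *: y + z) v = a *: bimul x0 y v + bimul x0 z v.
    by rewrite /bimul !mulrDr -!scalerAr.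
  exact: (subspZD hW).
apply: (span_min hR) => y [[w' /indices[ga' ->] ->]]; rewrite big_map => Gy.
set y0 := \prod_(i <- ga') _ in Gy *.
have [e|e1] := degree_eq hG Gx (GP ga).
  by rewrite /bimul e !mul0r; exact: (subsp0 hW).
have [e|e2] := degree_eq hG Gy (GQ ga').
  by rewrite /bimul e !mulr0; exact: (subsp0 hW).
apply: span_sub; exists ([seq inl i | i <- ga] ++ [seq inr i | i <- rev ga']).
split; last by rewrite wact_cat wact_inl wact_inr /bimul mulrA.
have -> : m1 = tot dP ga by case: e1.
have -> : m2 = tot dQ ga' by move/oppr_inj: e2 => [].
rewrite tot_cat; congr (_ + _)%N.
  by elim: (ga) => //= i s IH; rewrite tot_cons IH /= addn0.
by rewrite /tot -map_comp map_rev sumn_rev.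
Qed.

End ListLetters.

Section GeneratorLetters.
Variables (K : numFieldType) (A : algType K) (G : int -> set A) (Ap Am : set A) (delta : A).
Hypothesis hG : is_grading G.
Hypothesis tri : triangular G Ap Am delta.

Lemma generator_lists : exists P Q : seq A,
  [/\ forall x, x \in P -> Ap x /\ exists2 n : nat, (0 < n)%N & G n x,
      forall x, x \in Q -> Am x /\ exists2 n : nat, (0 < n)%N & G (- n%:Z) x,
      forall a, Ap a -> lin_span (words P) a & forall a, Am a -> lin_span (words Q) a].
Proof.
have [[s es] [t et]] := tri_T2_fg tri.
have [P [hP1 hP2]] := @graded_letters _ _ _ hG Ap Posz (tri_Ap tri) (Ap_sign tri) s
  (fun x xs => ltac:(rewrite es; exact: gen_subalg_sub)).
have [Q [hQ1 hQ2]] := @graded_letters _ _ _ hG Am (fun n => - n%:Z) (tri_Am tri) (Am_sign tri) t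
  (fun x xs => ltac:(rewrite et; exact: gen_subalg_sub)).
exists P, Q; split=> // a; [rewrite es | rewrite et]; apply: gen_subalg_min => //;
  exact: words_subalg.
Qed.

End GeneratorLetters.

(** * Separation in the commutative case *)

Section Directed.
Variables (K : fieldType) (V : lmodType K).

Lemma span_directed (S : nat -> set V) : (forall n, S n `<=` S n.+1) ->
  forall v, lin_span (fun x => exists n, S n x) v -> exists n, lin_span (S n) v.
Proof.
move=> hS; have mono i j : (i <= j)%N -> lin_span (S i) `<=` lin_span (S j).
  by move=> ij; apply: span_mono; elim: j ij => [|j IH]; [rewrite leqn0 => /eqP-> u |
    rewrite leq_eqVlt => /orP[/eqP-> u //|/IH ij u /ij]; exact: hS].
apply: span_min; last by move=> x [n Sx]; exists n; exact: span_sub.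
apply: subspP; first by exists 0%N; exact: (subsp0 (subsp_span _)).
move=> a u v [n hu] [m hv]; exists (maxn n m); apply: (subspZD (subsp_span _)).
  by apply: mono hu; exact: leq_maxl.
by apply: mono hv; exact: leq_maxr.
Qed.

End Directed.

Section Commutative.
Variables (R : realType) (A : algType R[i]) (G : int -> set A) (Ap Am : set A) (delta : A).
Hypothesis hG : is_grading G.
Hypothesis ctri : commutative_triangular G Ap Am delta.

(** No filtration is given, and [E] may send a generator to long words. All words of length at most
    [p] are therefore taken as letters, with [p] so large that [E] maps the generators into the span
    of such words; the filtration counts length in units of [p]. Words commute with each other, so
    the structure constants are zero. *)
Theorem commutative_separation (I J : set A) : two_sided_ideal I -> two_sided_ideal J ->
  I `<=` J -> (forall M, J `<=` addsp I (deep_part G M)) -> J `<=` I.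
Proof.
have tri := ctri_triangular ctri; have T1 := tri_T1 tri.
have [P [Q [hP hQ PA QA]]] := generator_lists hG tri.
have [d1 [d2 [Gb0 Gc0 d0 full]]] := @list_letters _ _ _ Ap Am hG P Q
  (fun x xP => (hP x xP).2) (fun x xQ => (hQ x xQ).2) PA QA.
pose L0 := letter P Q; pose d (l : L0) := (d1 l + d2 l)%N.
pose X0 (l : L0) : {linear A -> A} := bimul (lletter l) (rletter l).
have Apl (l : L0) : Ap (lletter l).
  case: l => [i|j] /=; last by case: (tri_Ap tri) => /subalg_1.
  by case: (hP _ (mem_nth 0 (ltn_ord i))).
have Aml (l : L0) : Am (rletter l).
  case: l => [i|j] /=; first by case: (tri_Am tri) => /subalg_1.
  by case: (hQ _ (mem_nth 0 (ltn_ord j))).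
have X0comm l l' v : X0 l (X0 l' v) = X0 l' (X0 l v).
  rewrite /X0 /= /bimul !mulrA (ctri_Ap ctri (Apl l) (Apl l')) -!mulrA.
  by rewrite (ctri_Am ctri (Aml l') (Aml l)).
have wcomm1 l w v : X0 l (wact X0 w v) = wact X0 w (X0 l v).
  elim: w => [//|l' w IH].
  by change (X0 l (X0 l' (wact X0 w v)) = X0 l' (wact X0 w (X0 l v))); rewrite X0comm IH.
have wcomm w w' v : wact X0 w (wact X0 w' v) = wact X0 w' (wact X0 w v).
  elim: w => [//|l w IH].
  by change (X0 l (wact X0 w (wact X0 w' v)) = wact X0 w' (X0 l (wact X0 w v)));
    rewrite IH wcomm1.
have EX0 l v : sumop delta (X0 l v) = X0 l (sumop delta v + (d l)%:R *: v).
  exact: (sumop_bimul T1).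
have Ew w v : sumop delta (wact X0 w v) = wact X0 w (sumop delta v + (tot d w)%:R *: v).
  elim: w => [|l w IH]; first by rewrite scale0r addr0.
  change (sumop delta (X0 l (wact X0 w v)) =
    X0 l (wact X0 w (sumop delta v + (tot d (l :: w))%:R *: v))).
  rewrite EX0 IH tot_cons addnC natrD scalerDl addrA; congr (X0 l _).
  by rewrite -linearZ -linearD.
have [gs [_ Agen]] := homogeneous_generators hG tri.
pose S n : set A := [set x | exists w g, [/\ (size w <= n)%N, g \in gs & x = wact X0 w g]].
have S_mono n m : (n <= m)%N -> S n `<=` S m.
  by move=> nm x [w [g [wn gin ->]]]; exists w, g; split=> //; exact: leq_trans nm.
have Sall v : exists n, lin_span (S n) v.
  apply: span_directed; first by move=> n; exact: S_mono.
  have := Agen v; apply: span_min; first exact: subsp_span.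
  move=> _ [m1 [m2 [b [c [g [[Bb Gb] [Bc Gc] gin ->]]]]]].
  have := full m1 m2 b c g Bb Gb Bc Gc; apply: span_mono => _ [w [_ ->]].
  by exists (size w), w, g.
have [p [p0 Ep]] : exists p, (0 < p)%N /\ forall g, g \in gs -> lin_span (S p) (sumop delta g).
  elim: (gs) => [|g s [p [p0 IH]]]; first by exists 1%N.
  have [n hn] := Sall (sumop delta g); exists (maxn p n); split.
    by rewrite leq_max p0.
  move=> h; rewrite inE => /orP[/eqP->|/IH].
    by move: hn; apply: span_mono; apply: S_mono; exact: leq_maxr.
  by apply: span_mono; apply: S_mono; exact: leq_maxl.
(* The empty word is excluded to keep the degrees of letters positive. *)
pose ws := [seq w <- @short_words L0 p | (0 < size w)%N].
pose L : finType := 'I_(size ws).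
pose wd (l : L) := nth [::] ws l.
have wdP (l : L) : (0 < size (wd l))%N.
  by have := mem_nth [::] (ltn_ord l); rewrite mem_filter => /andP[].
have size_short n (w : seq L0) : w \in short_words L0 n -> (size w <= n)%N.
  elim: n w => [|n IH] w /=; first by rewrite inE => /eqP->.
  by rewrite inE => /orP[/eqP->//|/allpairsP[[l w'] [_ /IH h ->]]].
have wdS (l : L) : (size (wd l) <= p)%N.
  by apply: size_short; have := mem_nth [::] (ltn_ord l); rewrite mem_filter => /andP[].
have wd_ex (w : seq L0) : (0 < size w)%N -> (size w <= p)%N -> exists l : L, wd l = w.
  move=> w0 wp; have wi : w \in ws by rewrite mem_filter w0 mem_short_words.
  have i : (index w ws < size ws)%N by rewrite index_mem.
  by exists (Ordinal i); rewrite /wd /= nth_index.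
pose bw (w : seq L0) := \prod_(l <- w) lletter l.
pose cw (w : seq L0) := \prod_(l <- rev w) rletter l.
have wactE w v : wact X0 w v = bimul (bw w) (cw w) v.
  elim: w => [|l w IH]; first by rewrite /bimul /bw /cw !big_nil mul1r mulr1.
  rewrite /= IH /bimul /bw /cw big_cons rev_cons -cats1 big_cat big_seq1.
  by rewrite !mulrA.
have Gbw w : G (tot d1 w) (bw w).
  rewrite /bw; elim: w => [|l w IH]; first by rewrite big_nil; exact: (G1 hG).
  by rewrite big_cons tot_cons PoszD; exact: (GM hG).
have Gcw w : G (- (tot d2 w)%:Z) (cw w).
  rewrite /cw; elim: w => [|l w IH]; first by rewrite big_nil; exact: (G1 hG).
  rewrite rev_cons -cats1 big_cat big_seq1 tot_cons addnC PoszD opprD.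
  exact: (GM hG).
have totD w : (tot d1 w + tot d2 w = tot d w)%N.
  by elim: w => // l w; rewrite !tot_cons => <-; rewrite /d; lia.
pose b (l : L) := bw (wd l); pose c (l : L) := cw (wd l).
pose X l : {linear A -> A} := bimul (b l) (c l).
have XE l v : X l v = wact X0 (wd l) v by rewrite wactE.
pose F i := lin_span (S (p * i)%N).
have F_sub i : subsp (F i) by exact: subsp_span.
move=> idI idJ IJ JI.
apply: (@deep_separation R A G delta T1 L b c (fun l => tot d1 (wd l))
  (fun l => tot d2 (wd l)) (fun _ _ _ => 0) (fun l => Gbw (wd l)) (fun l => Gcw (wd l))
  _ _ _ _ F 0%N F_sub _ _ _ _ _ _ I J idI idJ IJ JI) => //.
- move=> l; rewrite totD; apply: leq_trans (wdP l) _; exact: size_tot.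
- move=> i j v; rewrite big1 ?addr0; last by move=> k _; rewrite scale0r.
  by rewrite -/(X i) -/(X j) !XE wcomm.
- by move=> i j k; rewrite eqxx.
- move=> M; have [M' hM'] := full_deep_words hG tri full M.
  exists M' => v /hM'; apply: span_mono => _ [ga [u [Mga ->]]].
  have /choice[f hf] : forall l, exists l', wd l' = [:: l] by move=> l; exact: wd_ex.
  exists [seq f l | l <- ga], u; split.
    apply: leq_trans Mga _; elim: (ga) => // l s IH.
    by rewrite /= !tot_cons; apply: leq_add IH; rewrite totD hf tot_cons /= addn0.
  elim: (ga) => //= l s ->.
  by rewrite -/(X (f l)) XE hf.
- move=> i; exists [seq wact X0 ga g | ga <- short_words L0 (p * i), g <- gs].
  apply: span_mono => _ [w [g [wn gin ->]]] /=; apply/allpairsP; exists (w, g).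
  by split=> //=; exact: mem_short_words.
- by move=> i; apply: span_mono; apply: S_mono; rewrite leq_mul2l leqnSn orbT.
- move=> v; have [n hn] := Sall v; exists n; move: hn; apply: span_mono.
  by apply: S_mono; rewrite leq_pmull.
- move=> l i v; rewrite -/(X l); move: v; apply: span_min.
    exact: (subsp_preim _ (F_sub _)).
  move=> _ [w [g [wn gin ->]]]; apply: span_sub; exists (wd l ++ w), g; split=> //.
    by rewrite size_cat mulnS leq_add.
  by rewrite wact_cat -XE.
- move=> i v _; move: v; apply: span_min; first exact: subsp_span.
  move=> _ [w [g [wn gin ->]]]; have [wi|iw] := leqP (size w) (p * i).
    by apply: span_sub; left; apply: span_sub; exists w, g.
  (* The first [k] letters, between 1 and [p] in number, are cut off as one new letter, and exactly
     [p * i] letters remain. *)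
  apply: span_sub; right; set k := (size w - p * i)%N.
  have kw : (k <= size w)%N by exact: leq_subr.
  have [|| l hl] := wd_ex (take k w).
  + by rewrite size_takel // subn_gt0.
  + by rewrite size_takel // /k leq_subLR addnC -mulnS.
  exists l, (wact X0 (drop k w) g); split.
    apply: span_sub; exists (drop k w), g; split=> //.
    by rewrite size_drop /k subKn // ltnW.
  by rewrite -/(X l) XE hl -wact_cat cat_take_drop.
- move=> i v; move: v; apply: span_min; first exact: (subsp_preim _ (F_sub _)).
  move=> _ [w [g [wn gin ->]]] /=; rewrite Ew linearD linearZ /=.
  have wF (w' : seq L0) : (size w' <= p)%N -> forall g', g' \in gs ->
      F i.+1 (wact X0 (w ++ w') g').
    move=> w'p g' g'in; apply: span_sub; exists (w ++ w'), g'; split=> //.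
    by rewrite size_cat mulnS addnC leq_add.
  apply: (subspD (F_sub _)); last first.
    by apply: (subspZ (F_sub _)); have := wF [::] isT g gin; rewrite cats0.
  have := Ep g gin; move: (sumop delta g); apply: span_min.
    exact: (subsp_preim _ (F_sub _)).
  by move=> _ [w' [g' [w'p g'in ->]]] /=; rewrite -wact_cat; exact: wF.
Qed.

End Commutative.

(** * Separation in the noncommutative case *)

Section Eigen.
Variables (K : fieldType) (V : lmodType K) (T : {linear V -> V}).

Lemma pev_eigen (c : K) v p : T v = c *: v -> pev T p v = p.[c] *: v.
Proof.
move=> Tv; rewrite horner_coef /pev scaler_suml; apply: eq_bigr => i _.
rewrite -scalerA; congr (_ *: _); elim: (i : nat) => [|n IH]; first by rewrite scale1r.
by rewrite iterS IH linearZ_LR Tv scalerA exprSr.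
Qed.

End Eigen.

Section Commutator.
Variables (K : numFieldType) (A : algType K) (G : int -> set A) (delta : A).
Hypothesis hG : is_grading G.
Hypothesis T1 : forall (m : int) a, G m a -> delta * a - a * delta = a *~ m.

Definition adop (v : A) : A := delta * v - v * delta.
Lemma adop_linear : linear adop.
Proof. exact: (linearP (lmulop delta \- rmulop delta)). Qed.
HB.instance Definition _ := GRing.isLinear.Build K A A _ adop adop_linear.

(** The components of [v] are eigenvectors of the commutator with [delta] for distinct eigenvalues,
    so a polynomial vanishing at the other degrees of the support isolates one of them. Applied to a
    filtration, it yields graded pieces. *)
Lemma adop_stable_pr (W : set A) : subsp W -> (forall v, W v -> W (adop v)) ->
  forall m v, W v -> W (pr hG m v).
Proof.
move=> hW Wad m v Wv; have [s [Gs us sv ev]] := prP hG v.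
have [ms|/sv->] := boolP (m \in s); last exact: (subsp0 hW).
pose p : {poly K} := \prod_(k <- rem m s) ('X - (k%:~R)%:P).
have pm : p.[m%:~R] != 0.
  rewrite -[_ == 0]/(root p _) /p -(big_map (fun k : int => k%:~R) xpredT (fun c : K => 'X - c%:P)).
  rewrite root_prod_XsubC; apply/mapP => -[k kr] /intr_inj e.
  by rewrite -e mem_rem_uniq // inE eqxx in kr.
have : W (pev adop p v) by exact: pev_stable.
have -> : pev adop p v = p.[m%:~R] *: pr hG m v.
  rewrite {1}ev linear_sum (bigD1_seq m) //= big_seq_cond big1 ?addr0.
    by apply: pev_eigen; rewrite /= /adop (T1 (Gs m)) scaler_int.
  move=> k /andP[ks km]; rewrite (@pev_eigen _ _ _ k%:~R); last first.
    by rewrite /= /adop (T1 (Gs k)) scaler_int.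
  suff -> : p.[k%:~R] = 0 by rewrite scale0r.
  apply/eqP; rewrite -[_ == 0]/(root p _) /p.
  rewrite -(big_map (fun k : int => k%:~R) xpredT (fun c : K => 'X - c%:P)).
  by rewrite root_prod_XsubC map_f // mem_rem_uniq // inE km.
by move/(subspZ hW (p.[m%:~R])^-1); rewrite scalerA mulVf // scale1r.
Qed.

End Commutator.

Section Filtration.
Variables (K : numFieldType) (A : algType K) (F : filtration A).

Lemma fil_sub i : subsp (F i). Proof. exact: fil_submod. Qed.

Lemma fil_ex a : exists i, F i a.
Proof.
have : (\bigcup_i F i) a by rewrite fil_exhaustive.
by case=> i _ Fa; exists i.
Qed.

Lemma fil_mul1l i a b : F 1%N a -> F i b -> F i.+1 (a * b).
Proof. exact: (@fil_mul _ _ F 1 i). Qed.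

Lemma fil_mul1r i a b : F i a -> F 1%N b -> F i.+1 (a * b).
Proof. by move=> Fa Fb; rewrite -(addn1 i); exact: fil_mul. Qed.

Lemma symb0 i : symb F i 0 = 0.
Proof.
rewrite /symb scale0r (_ : insubd _ _ = 0) ?/gr_pi ?raddf0 //.
by apply: val_inj; rewrite val_insubd raddf0; case: ifP.
Qed.

Lemma symb_linear i c a b : F i a -> F i b -> symb F i (c *: a + b) = c *: symb F i a + symb F i b.
Proof.
move=> Fa Fb; have Fab : F i (c *: a + b) by exact: (subspZD (fil_sub i)).
rewrite -[c *: symb F i a]/(gr_scale c (gr_pi _)) -gr_piZ -gr_piD.
congr gr_pi; apply: val_inj; rewrite symb_rees // rmorphD /= !symb_rees //.
by rewrite scalerDl scalerA mulr_algl.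
Qed.

(** The commutator lies in [F i.+1] at first sight, and commuting symbols make it drop by one step.
    This serves both for [delta], whose symbol is central, and for the subalgebras, whose graded
    algebras are commutative. *)
Lemma fil_commutator i a b : F 1%N a -> F i b ->
  symb F 1 a * symb F i b = symb F i b * symb F 1 a -> F i (a * b - b * a).
Proof.
move=> Fa Fb; rewrite !symbM // addnC => /symb_eq; rewrite addn1; apply.
  exact: fil_mul1l.
exact: fil_mul1r.
Qed.

Section Subalgebra.
Variable B : set A.
Hypothesis hB : subalg_closed [in B].
Hypothesis T3 : commutative_on (gr_sub F B).
Hypothesis T4 : gr_sub F B = gen_subalg (gr_sub_comp F B 0 `|` gr_sub_comp F B 1).
Hypothesis T4_dim : forall i, fin_dim (gr_sub_comp F B i).
Let BF i : set A := B `&` F i.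
Let Bs := subalg_subsp hB.

Lemma BF_sub i : subsp (BF i). Proof. exact: subspI Bs (fil_sub i). Qed.

Lemma symb_gr_sub i a : BF i a -> gr_sub F B (symb F i a).
Proof.
move=> [Ba Fa]; exists (insubd (0 : rees F) (a *: 'X^i)); split=> // j.
rewrite symb_rees // coefZ coefXn; case: eqP => _; rewrite ?mulr1 // mulr0.
exact: (subsp0 Bs).
Qed.

Lemma BF_commutator i a b : BF 1%N a -> BF i b -> BF i (a * b - b * a).
Proof.
move=> [Ba Fa] [Bb Fb]; split.
  by apply: (subspB Bs); exact: (subalg_M hB).
by apply: fil_commutator => //; apply: T3; exact: symb_gr_sub.
Qed.

Lemma BF_fin_dim i : fin_dim (BF i).
Proof.
have prev_fd j : fin_dim (B `&` fil_prev F j) -> fin_dim (BF j).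
  move: j => {}i [t ht]; have hc : subsp (gr_sub_comp F B i).
    apply: subspP; first by exists 0; [exact: (subsp0 (BF_sub i)) |
      exact: symb0].
    move=> c _ _ [a Ba <-] [b Bb <-]; exists (c *: a + b); first exact: (subspZD (BF_sub i)).
    by case: Ba Bb => _ Fa [_ Fb]; exact: symb_linear.
  have [s [sB Bs']] := fin_dim_basis hc (T4_dim i).
  have /choice[f hf] : forall x, exists a, x \in s -> BF i a /\ symb F i a = x.
    move=> x; have [/sB[a Ba e]|_] := boolP (x \in s); first by exists a.
    by exists 0.
  exists ([seq f x | x <- s] ++ t) => a [Ba Fa].
  set W := lin_span _; have hW : subsp W by exact: subsp_span.
  have tW : lin_span [set` t] `<=` W by apply: span_mono => x /= xt; rewrite mem_cat xt orbT.
  have : lin_span [set` s] (symb F i a) by apply: Bs'; exists a.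
  suff h x : lin_span [set` s] x -> exists e, [/\ W e, BF i e & symb F i e = x].
    move=> /h [e [We [Be Fe] /esym/symb_eq-/(_ Fa Fe) ae]].
    rewrite -[a](subrK e); apply: (subspD hW) => //; apply: tW; apply: ht.
    by split=> //; exact: (subspB Bs).
  move: x; apply: span_min; last first.
    move=> x xs; have [Bfx e] := hf x xs; exists (f x); split=> //.
    by apply: span_sub; rewrite /= mem_cat map_f.
  apply: subspP; first exists 0; first split; first exact: (subsp0 hW).
  - exact: (subsp0 (BF_sub i)).
  - exact: symb0.
  move=> c x y [e [We Be <-]] [e' [We' Be' <-]]; exists (c *: e + e'); split.
  - exact: (subspZD hW).
  - exact: (subspZD (BF_sub i)).
  - by case: Be Be' => _ Fe [_ Fe']; exact: symb_linear.
elim: i => [|i IH]; apply: prev_fd; last exact: IH.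
by exists [::] => x [_ ->]; exact: (subsp0 (subsp_span _)).
Qed.

(** A lift to [B] of the degree [i] part of the algebra generated by degrees 0 and 1 of the graded
    algebra. *)
Fixpoint powers i : set A := if i is j.+1 then
  lin_span [set x | exists q y, [/\ BF 1%N q, powers j y & x = q * y]] else BF 0%N.

Lemma powers_sub i : subsp (powers i).
Proof. by case: i => [|i]; [exact: BF_sub | exact: subsp_span]. Qed.

Lemma BF1 : BF 0%N 1. Proof. by split; [exact: (subalg_1 hB) | exact: fil_one]. Qed.

Lemma BFM i j a b : BF i a -> BF j b -> BF (i + j)%N (a * b).
Proof. by move=> [? ?] [? ?]; split; [exact: (subalg_M hB) | exact: fil_mul]. Qed.

Lemma powers_BF i : powers i `<=` BF i.
Proof.
elim: i => [//|i IH]; apply: span_min; first exact: BF_sub.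
by move=> _ [q [y [Bq /IH By ->]]]; rewrite -add1n; exact: BFM.
Qed.

Lemma powersM i j a b : powers i a -> powers j b -> powers (i + j)%N (a * b).
Proof.
elim: i a => [|i IH] a.
  move=> Ba; rewrite add0n; case: j => [|j]; first exact: (@BFM 0 0).
  have hS := powers_sub j.+1; move: b; apply: span_min.
    apply: subspP => [|c u v]; first by rewrite mulr0; exact: (subsp0 hS).
    by rewrite mulrDr -scalerAr; exact: (subspZD hS).
  move=> _ [q [y [Bq Py ->]]]; apply: span_sub; exists (a * q), y; split=> //.
    exact: (@BFM 0 1).
  by rewrite mulrA.
move=> Pa Pb; move: a Pa; have hS := powers_sub (i + j).+1; apply: span_min.
  apply: subspP => [|c u v]; first by rewrite mul0r; exact: (subsp0 hS).
  by rewrite mulrDl -scalerAl; exact: (subspZD hS).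
move=> _ [q [y [Bq Py ->]]]; apply: span_sub; exists q, (y * b); split=> //.
  exact: IH.
by rewrite mulrA.
Qed.

Lemma gr_sub_powers x : gr_sub F B x ->
  exists p : rees F, (forall i, powers i (val p)`_i) /\ x = gr_pi p.
Proof.
rewrite T4; move: x; apply: gen_subalg_min; last first.
  move=> _ [[a [Ba Fa] <-]|[a [Ba Fa] <-]].
    exists (insubd (0 : rees F) (a *: 'X^0)); split=> // i.
    rewrite symb_rees // coefZ coefXn; case: i => [|i] /=; first by rewrite mulr1.
    by rewrite mulr0; exact: (subsp0 (subsp_span _)).
  exists (insubd (0 : rees F) (a *: 'X^1)); split=> // i.
  rewrite symb_rees // coefZ coefXn; case: eqP => [->|_] /=; last first.
    by rewrite mulr0; exact: (subsp0 (powers_sub _)).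
  by rewrite mulr1; apply: span_sub; exists a, 1; rewrite mulr1; split=> //; exact: BF1.
apply: subalgP.
- exists 1; split=> // i; rewrite rmorph1 coef1; case: i => [|i] /=; first exact: BF1.
  exact: (subsp0 (subsp_span _)).
- apply: subspP.
    exists 0; split; last by rewrite /gr_pi raddf0.
    by move=> i; rewrite raddf0 coef0; exact: (subsp0 (powers_sub _)).
  move=> c _ _ [p [Pp ->]] [q [Pq ->]]; exists (rees_scale c p + q); split; last first.
    by rewrite gr_piD gr_piZ.
  move=> i; rewrite raddfD coefD /= coefZ mulr_algl.
  exact: (subspZD (powers_sub _)).
- move=> _ _ [p [Pp ->]] [q [Pq ->]]; exists (p * q); split; last by rewrite gr_piM.
  move=> i; rewrite rmorphM coefM; apply: (subsp_sum (powers_sub _)) => k _.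
  by rewrite -{1}(subnKC (ltn_ord k : (k <= i)%N)); exact: powersM.
Qed.

Lemma BF_gen_left i : BF i.+1 `<=`
  addsp (lin_span [set x | exists q y, [/\ BF 1%N q, BF i y & x = q * y]]) (BF i).
Proof.
move=> a Ba; have [p [Pp]] := gr_sub_powers (symb_gr_sub Ba).
move/gr_pi_eq => /(_ i.+1); case: Ba => Ba Fa; rewrite symb_rees // coefZ coefXn eqxx mulr1 => Fap.
exists (val p)`_i.+1, (a - (val p)`_i.+1); split; last by rewrite addrC subrK.
  have := Pp i.+1; apply: span_mono => _ [q [y [Bq Py ->]]]; exists q, y; split=> //.
  exact: powers_BF.
split=> //; apply: (subspB Bs) => //.
by have /powers_BF[] := Pp i.+1.
Qed.

(** The two factors may be exchanged at the cost of a commutator, which lies in [BF i]. *)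
Lemma BF_gen_right i : BF i.+1 `<=`
  addsp (lin_span [set x | exists q y, [/\ BF 1%N q, BF i y & x = y * q]]) (BF i).
Proof.
set W := lin_span _; have hW : subsp W by exact: subsp_span.
have hA := subsp_add hW (BF_sub i).
apply: subset_trans (@BF_gen_left i) _; apply: addsp_min => //; last exact: addspr.
apply: span_min => // _ [q [y [Bq By ->]]].
exists (y * q), (q * y - y * q); split; last by rewrite addrC subrK.
  by apply: span_sub; exists q, y.
exact: BF_commutator.
Qed.

End Subalgebra.

End Filtration.

Lemma span_coord_set (K : fieldType) (V : lmodType K) (T : finType) (S : T -> Prop) (e : T -> V) v :
  lin_span [set x | exists k, S k /\ x = e k] v ->
  exists c : T -> K, v = \sum_k c k *: e k /\ forall k, c k != 0 -> S k.
Proof.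
move: v; apply: span_min.
  apply: subspP.
    exists (fun=> 0); split=> [|k]; last by rewrite eqxx.
    by rewrite big1 // => i _; rewrite scale0r.
  move=> a u v [c [-> cS]] [c' [-> cS']]; exists (fun i => a * c i + c' i); split.
    rewrite scaler_sumr -big_split; apply: eq_bigr => i _ /=.
    by rewrite scalerDl scalerA.
  move=> k; have [->|/cS//] := eqVneq (c k) 0.
  by rewrite mulr0 add0r; exact: cS'.
move=> _ [k [Sk ->]]; exists (fun i => (i == k)%:R); split.
  rewrite (bigD1 k) //= eqxx scale1r big1 ?addr0 //.
  by move=> i /negbTE ->; rewrite scale0r.
by move=> i; case: (i =P k) => [->//|_]; rewrite eqxx.
Qed.

Section SubalgebraLetters.
Variables (K : numFieldType) (A : algType K) (G : int -> set A) (F : filtration A).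
Hypothesis hG : is_grading G.
Hypothesis Fpr : forall i m v, F i v -> F i (pr hG m v).
Variables (B : set A) (sg : nat -> int).
Hypothesis hB : graded_subalg G B.
Hypothesis Bsg : forall m a, B a -> G m a -> a != 0 ->
  (exists k : K, a = k%:A) \/ exists2 n, (0 < n)%N & m = sg n.
Hypothesis sg_neq0 : forall m n, (0 < m)%N -> sg m + sg n != 0.
Hypothesis T3 : commutative_on (gr_sub F B).
Hypothesis T4 : gr_sub F B = gen_subalg (gr_sub_comp F B 0 `|` gr_sub_comp F B 1).
Hypothesis T4_dim : forall i, fin_dim (gr_sub_comp F B i).
Let BF i : set A := B `&` F i.
Let sB : subalg_closed [in B] := hB.1.

(** The components of a basis of [BF 1] stay in it by [Fpr]. Those of degree zero are scalars and
    are replaced by the single element 1. *)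
Lemma degree_one_letters : exists P : seq A,
  [/\ forall x, x \in P -> [/\ BF 1%N x, x != 0 & exists2 n, (0 < n)%N & G (sg n) x],
      BF 1%N `<=` lin_span [set` 1 :: P] & forall a, B a -> lin_span (words P) a].
Proof.
have [s [sBF BFs]] := fin_dim_basis (BF_sub F sB 1) (BF_fin_dim sB T4_dim 1).
have /choice[t ht] : forall g, exists t : seq int, g = \sum_(m <- t) pr hG m g.
  by move=> g; have [t [_ _ _ e]] := prP hG g; exists t.
pose comps := flatten [seq [seq pr hG m g | m <- t g] | g <- s].
have compsP x : x \in comps -> exists m, BF 1%N x /\ G m x.
  move=> /flattenP[_ /mapP[h hs ->] /mapP[m _ ->]]; exists m; split; last exact: pr_G.
  by have [Bh Fh] := sBF h hs; split; [exact: (graded_pr hG hB) | exact: Fpr].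
pose P := [seq x <- comps | (x != 0) && `[< exists2 n, (0 < n)%N & G (sg n) x >]].
have Pspan : BF 1%N `<=` lin_span [set` 1 :: P].
  apply: subset_trans BFs _; have h := subsp_span [set` 1 :: P].
  apply: span_min => // x xs; rewrite (ht x); apply: (subsp_sum_seq h) => m mt.
  have pc : pr hG m x \in comps.
    apply/flattenP; exists [seq pr hG k x | k <- t x]; last exact: map_f.
    by apply/mapP; exists x.
  have [->|p0] := eqVneq (pr hG m x) 0; first exact: (subsp0 h).
  have [k [[Bp _] _]] := compsP _ pc.
  have [[c ->]|[n n0 e]] := Bsg Bp (pr_G hG m x) p0.
    by apply: (subspZ h); apply: span_sub; rewrite /= mem_head.
  apply: span_sub; rewrite /= inE mem_filter p0 pc; apply/orP; right.
  by rewrite andbT; apply/asboolP; exists n => //; rewrite -e; exact: pr_G.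
exists P; split=> //.
  move=> x; rewrite mem_filter => /andP[/andP[x0 /asboolP h] /compsP[m [Bx _]]].
  by split.
move=> a Ba; have [i Fa] := fil_ex F a.
have hW := subsp_span (words P); have sW := words_subalg P.
have BF1W : BF 1%N `<=` lin_span (words P).
  apply: subset_trans Pspan _; apply: span_min => // x /=.
  rewrite inE => /orP[/eqP->|xP]; first exact: (subalg_1 sW).
  by apply: span_sub; exists [:: x]; rewrite ?big_seq1 //= andbT.
elim: i a Ba Fa => [|i IH] a Ba Fa; first by apply: BF1W; split=> //; exact: fil_subset.
have := BF_gen_left sB T4 (conj Ba Fa); apply: addsp_min => //; last by move=> x [? ?]; exact: IH.
apply: span_min => // _ [q [y [Bq [By Fy] ->]]]; apply: (subalg_M sW); last exact: IH.
exact: BF1W.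
Qed.

(** Commutators of letters remain in [BF 1], so they are linear in the letters and 1; since two
    degrees of the same sign do not cancel, the homogeneous part of the right degree does not
    involve 1. *)
Lemma structure_constants (P : seq A) :
  (forall x, x \in P -> [/\ BF 1%N x, x != 0 & exists2 n, (0 < n)%N & G (sg n) x]) ->
  BF 1%N `<=` lin_span [set` 1 :: P] ->
  exists c : 'I_(size P) -> 'I_(size P) -> 'I_(size P) -> K,
    (forall i j : 'I_(size P), P`_i * P`_j = P`_j * P`_i + \sum_k c i j k *: P`_k) /\
    forall (i j k : 'I_(size P)) m n, c i j k != 0 -> G m P`_i -> G n P`_j -> G (m + n) P`_k.
Proof.
move=> hP Pspan.
suff h (i j : 'I_(size P)) : exists c : 'I_(size P) -> K,
    P`_i * P`_j - P`_j * P`_i = \sum_k c k *: P`_k /\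
    forall k : 'I_(size P), c k != 0 -> forall m n, G m P`_i -> G n P`_j -> G (m + n) P`_k.
  have /choice[c hc] := fun ij : 'I_(size P) * 'I_(size P) => h ij.1 ij.2.
  exists (fun i j => c (i, j)); split=> [i j|i j k m n ck Gi Gj].
    by have [<- _] := hc (i, j); rewrite addrC subrK.
  by have [_ /(_ k ck)] := hc (i, j); apply.
have [Bi i0 [m m0 Gi]] := hP _ (mem_nth 0 (ltn_ord i)).
have [Bj j0 [n n0 Gj]] := hP _ (mem_nth 0 (ltn_ord j)).
have Bx := BF_commutator sB T3 Bi Bj; set x := _ - _ in Bx *.
have Gx : G (sg m + sg n) x.
  apply: (subspB (G_sub hG _)); first exact: (GM hG).
  by rewrite addrC; exact: (GM hG).
have hom y : [set` 1 :: P] y -> exists n, G n y.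
  rewrite /= inE => /orP[/eqP->|/hP[_ _ [n' _ ?]]]; first by exists 0; exact: (G1 hG).
  by exists (sg n').
have := @homog_span _ _ _ hG _ (sg m + sg n) _ hom (Pspan _ Bx).
rewrite (pr_eq hG _ Gx) eqxx => hx.
have : lin_span [set y | exists k : 'I_(size P), G (sg m + sg n) P`_k /\ y = P`_k] x.
  move: hx; apply: span_min; first exact: subsp_span.
  move=> y [/=]; rewrite inE => /orP[/eqP->|yP] Gy.
    have [/eqP|e] := degree_eq hG Gy (G1 hG); first by rewrite oner_eq0.
    by have := sg_neq0 n m0; rewrite e eqxx.
  apply: span_sub; have iy : (index y P < size P)%N by rewrite index_mem.
  by exists (Ordinal iy); rewrite /= nth_index.
move/span_coord_set => [c [e hc]]; exists c; split=> // k /hc Gk m' n' Gi' Gj'.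
have [/eqP|<-] := degree_eq hG Gi Gi'; first by rewrite (negbTE i0).
by have [/eqP|<-] := degree_eq hG Gj Gj'; first by rewrite (negbTE j0).
Qed.

End SubalgebraLetters.

Section Bifiltration.
Variables (K : numFieldType) (A : algType K) (F : filtration A) (Ap Am : set A).
Hypothesis hAp : subalg_closed [in Ap].
Hypothesis hAm : subalg_closed [in Am].
Hypothesis T0' : fg_bimodule (gr_sub F Ap) (gr_sub F Am).

Lemma gr_pi_sum (I : Type) (r : seq I) (f : I -> rees F) :
  gr_pi (\sum_(i <- r) f i) = \sum_(i <- r) gr_pi (f i).
Proof. by apply: (big_morph _ (@gr_piD _ _ F)); rewrite /gr_pi raddf0. Qed.

(** Lifts of the bimodule generators are split into their coefficients, each stored with its degree;
    extracting the coefficient of degree [i] in a product then makes the three degrees add up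
    exactly. *)
Lemma fil_generated : exists ys : seq (nat * A),
  (forall y, y \in ys -> F y.1 y.2) /\
  forall i a, F i a -> exists2 e, fil_prev F i (a - e) &
    lin_span [set x | exists r t b c (y : nat * A), [/\ y \in ys, (r + y.1 + t = i)%N,
      (Ap `&` F r) b, (Am `&` F t) c & x = b * y.2 * c]] e.
Proof.
have [s hs] := T0'.
have /choice[f hf] : forall x : gr F, exists p, x = gr_pi p by exact: gr_piK.
pose ys := flatten [seq [seq (k, (val (f g))`_k) | k <- iota 0 (size (val (f g)))] | g <- s].
exists ys; split.
  by move=> _ /flattenP[_ /mapP[g _ ->] /mapP[k _ ->]]; exact: rees_coef.
move=> i a Fa; have [n [b [g [c [Bb gs Bc e]]]]] := hs (symb F i a).
have /choice[be hbe] : forall l : 'I_n, exists p : rees F, (forall i, Ap (val p)`_i) /\ b l = gr_pi p.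
  by move=> l; exact: Bb.
have /choice[ga hga] : forall l : 'I_n, exists p : rees F, (forall i, Am (val p)`_i) /\ c l = gr_pi p.
  by move=> l; exact: Bc.
have : symb F i a = gr_pi (\sum_l be l * f (g l) * ga l).
  rewrite e gr_pi_sum; apply: eq_bigr => l _.
  by rewrite !gr_piM (hbe l).2 (hga l).2 -hf.
move/gr_pi_eq => /(_ i); rewrite symb_rees // coefZ coefXn eqxx mulr1 => h.
exists ((val (\sum_l be l * f (g l) * ga l))`_i) => //.
set W := lin_span _; have hW : subsp W by exact: subsp_span.
rewrite rmorph_sum coef_sum; apply: (subsp_sum hW) => l _.
rewrite !rmorphM !coefM; apply: (subsp_sum hW) => k _.
rewrite coefM mulr_suml; apply: (subsp_sum hW) => j _.
have [sz|sz] := leqP (size (val (f (g l)))) (k - j).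
  by rewrite [(val (f (g l)))`_(k - j)]nth_default // mulr0 mul0r; exact: (subsp0 hW).
apply: span_sub; exists (j : nat), (i - k)%N, (val (be l))`_j, (val (ga l))`_(i - k),
  ((k - j)%N, (val (f (g l)))`_(k - j)); split=> //=.
- apply/flattenP; exists [seq (k, (val (f (g l)))`_k) | k <- iota 0 (size (val (f (g l))))].
    by apply/mapP; exists (g l).
  by apply/mapP; exists (k - j)%N; rewrite // mem_iota.
- by rewrite subnKC ?subnKC // -ltnS.
- by split; [exact: (hbe l).1 | exact: rees_coef].
- by split; [exact: (hga l).1 | exact: rees_coef].
Qed.

End Bifiltration.

Section Noncommutative.
Variables (R : realType) (A : algType R[i]) (G : int -> set A) (Ap Am : set A) (delta : A).
Variable F : filtration A.
Hypothesis hG : is_grading G.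
Hypothesis nc : noncommutative_triangular G Ap Am delta F.

Let tri := nctri_triangular nc.
Let hAp : subalg_closed [in Ap] := (tri_Ap tri).1.
Let hAm : subalg_closed [in Am] := (tri_Am tri).1.
Let Bp i : set A := Ap `&` F i.
Let Bm i : set A := Am `&` F i.

Lemma nc_fil_fin_dim i : fin_dim (F i).
Proof.
have [ys [_ hys]] := fil_generated (nctri_T0' nc).
have prev_fd j : fin_dim (fil_prev F j) -> fin_dim (F j).
  move: j => {}i [t ht].
  have [u hu] := BF_fin_dim hAp (fun i => (nctri_T4_dim nc i).1) i.
  have [w hw] := BF_fin_dim hAm (fun i => (nctri_T4_dim nc i).2) i.
  pose bc := [seq (b, c) | b <- u, c <- w].
  exists ([seq p.1 * y.2 * p.2 | p <- bc, y : nat * A <- ys] ++ t) => a /hys[e /ht ae he].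
  set W := lin_span _; have hW : subsp W by exact: subsp_span.
  rewrite -[a](subrK e); apply: (subspD hW).
    by apply: span_mono ae => x /= xt; rewrite mem_cat xt orbT.
  move: he; apply: span_min => // _ [r [t' [b [c [y [yin ri [Bb Fb] [Bc Fc] ->]]]]]].
  have := hu b (conj Bb (fil_le (_ : r <= i)%N Fb)); rewrite -ri -addnA leq_addr => /(_ isT).
  have := hw c (conj Bc (fil_le (_ : t' <= i)%N Fc)); rewrite -ri leq_addl => /(_ isT).
  move=> hc hb; move: b hb {Bb Fb}; apply: span_min.
    apply: subspP => [|k x z]; first by rewrite !mul0r; exact: (subsp0 hW).
    by rewrite !mulrDl -!scalerAl; exact: (subspZD hW).
  move=> b /= bu; move: c hc {Bc Fc}; apply: span_min.
    apply: subspP => [|k x z]; first by rewrite !mulr0; exact: (subsp0 hW).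
    by rewrite !mulrDr -!scalerAr; exact: (subspZD hW).
  move=> c /= cw; apply: span_sub; rewrite /= mem_cat; apply/orP; left.
  apply/allpairsP; exists ((b, c), y); split=> //=.
  by apply/allpairsP; exists (b, c).
elim: i => [|i IH]; apply: prev_fd; last exact: IH.
by exists [::] => x ->; exact: (subsp0 (subsp_span _)).
Qed.

Lemma nc_fil_generated (P Q : seq A) :
  Bp 1%N `<=` lin_span [set` 1 :: P] -> Bm 1%N `<=` lin_span [set` 1 :: Q] ->
  exists i0, forall i v, (i0 <= i)%N -> F i.+1 v ->
    lin_span (F i `|` [set v | exists (l : letter P Q) u,
      F i u /\ v = bimul (lletter l) (rletter l) u]) v.
Proof.
move=> Pspan Qspan; have [ys [Fys hys]] := fil_generated (nctri_T0' nc).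
exists (\max_(y <- ys) y.1)%N => i v i0i Fv.
set W := lin_span _; have hW : subsp W by exact: subsp_span.
have FW u : F i u -> W u by move=> Fu; apply: span_sub; left.
have PW q u : Bp 1%N q -> F i u -> W (q * u).
  move=> /Pspan + Fu; move: q; apply: span_min.
    apply: subspP => [|k x z]; first by rewrite mul0r; exact: (subsp0 hW).
    by rewrite mulrDl -scalerAl; exact: (subspZD hW).
  move=> q /=; rewrite inE => /orP[/eqP->|qP]; first by rewrite mul1r; exact: FW.
  have iq : (index q P < size P)%N by rewrite index_mem.
  apply: span_sub; right; exists (inl (Ordinal iq)), u; split=> //.
  by rewrite /bimul /= nth_index // mulr1.
have QW q u : Bm 1%N q -> F i u -> W (u * q).
  move=> /Qspan + Fu; move: q; apply: span_min.
    apply: subspP => [|k x z]; first by rewrite mulr0; exact: (subsp0 hW).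
    by rewrite mulrDr -scalerAr; exact: (subspZD hW).
  move=> q /=; rewrite inE => /orP[/eqP->|qP]; first by rewrite mulr1; exact: FW.
  have iq : (index q Q < size Q)%N by rewrite index_mem.
  apply: span_sub; right; exists (inr (Ordinal iq)), u; split=> //.
  by rewrite /bimul /= nth_index // mul1r.
have [e ve he] := hys _ _ Fv; rewrite -[v](subrK e).
apply: (subspD hW); first exact: FW.
move: he; apply: span_min => // _ [r [t [b [c [y [yin ri Bb Bc ->]]]]]].
have Fy := Fys y yin; have yi : (y.1 <= i)%N.
  by apply: leq_trans i0i; apply: (bigop.bigmaxn_sup_seq _ yin).
(* As [y.1 <= i < r + y.1 + t], one of [r] and [t] is positive, and a factor of degree one can be
   split off on that side. *)
case: r ri Bb => [|r] ri Bb.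
  case: t ri Bc => [|t] ri Bc; first by move: ri yi; rewrite add0n addn0 => ->; rewrite ltnn.
  have ht : (0 + y.1 + t)%N = i by move: ri; rewrite addnS => -[].
  move: c Bc; apply: subset_trans (BF_gen_right hAm (nctri_T3 nc).2 (nctri_T4_gen nc).2 (i := t)) _.
  have hpre : subsp (fun c => W (b * y.2 * c)).
    apply: subspP => [|k x z]; first by rewrite mulr0; exact: (subsp0 hW).
    by rewrite mulrDr -scalerAr; exact: (subspZD hW).
  have Fb x : F t x -> F i (b * y.2 * x).
    by move=> Fx; rewrite -ht; apply: fil_mul => //; apply: fil_mul => //; case: Bb.
  apply: (addsp_min hpre); last by move=> x [_ Fx]; apply: FW; exact: Fb.
  apply: span_min => // _ [q [x [Bq [_ Fx] ->]]]; rewrite mulrA.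
  by apply: QW => //; exact: Fb.
have hr : (r + y.1 + t)%N = i by move: ri; rewrite !addSn => -[].
rewrite -mulrA; move: b Bb.
apply: subset_trans (BF_gen_left hAp (nctri_T4_gen nc).1 (i := r)) _.
have hpre : subsp (fun b => W (b * (y.2 * c))).
  apply: subspP => [|k x z]; first by rewrite mul0r; exact: (subsp0 hW).
  by rewrite mulrDl -scalerAl; exact: (subspZD hW).
have Fb x : F r x -> F i (x * (y.2 * c)).
  move=> Fx; rewrite -hr -addnA; apply: fil_mul => //; apply: fil_mul => //.
  by case: Bc.
apply: (addsp_min hpre); last by move=> x [_ Fx]; apply: FW; exact: Fb.
apply: span_min => // _ [q [x [Bq [_ Fx] ->]]]; rewrite -mulrA.
by apply: PW => //; exact: Fb.
Qed.

Theorem noncommutative_separation (I J : set A) : two_sided_ideal I -> two_sided_ideal J ->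
  I `<=` J -> (forall M, J `<=` addsp I (deep_part G M)) -> J `<=` I.
Proof.
have T1 := tri_T1 tri; have [Fdelta T1'] := nctri_T1' nc.
have Fad i v : F i v -> F i (adop delta v).
  by move=> Fv; apply: fil_commutator.
have Fpr i m v : F i v -> F i (pr hG m v).
  by apply: (adop_stable_pr hG T1 (fil_sub F i)) => u; exact: Fad.
have sgp (m n : nat) : (0 < m)%N -> m%:Z + n%:Z != 0 by lia.
have sgm (m n : nat) : (0 < m)%N -> - m%:Z + - n%:Z != 0 by lia.
have [P [hP Pspan PA]] := degree_one_letters Fpr (tri_Ap tri)
  (Ap_sign tri) (nctri_T4_gen nc).1 (fun i => (nctri_T4_dim nc i).1).
have [Q [hQ Qspan QA]] := degree_one_letters Fpr (tri_Am tri)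
  (sg := fun n => - n%:Z) (Am_sign tri) (nctri_T4_gen nc).2 (fun i => (nctri_T4_dim nc i).2).
have [cP [ecP dcP]] := structure_constants hG (tri_Ap tri) sgp (nctri_T3 nc).1 hP Pspan.
have [cQ [ecQ dcQ]] := structure_constants hG (tri_Am tri) (sg := fun n => - n%:Z)
  sgm (nctri_T3 nc).2 hQ Qspan.
have [d1 [d2 [Gb Gc d0 full]]] := @list_letters _ _ _ Ap Am hG P Q
  (fun x xP => let: And3 _ _ h := hP x xP in h)
  (fun x xQ => let: And3 _ _ h := hQ x xQ in h) PA QA.
(* Right multiplications compose in reverse order, whence the sign of [cQ]; a left and a right
   multiplication commute. *)
pose cst (l1 l2 l3 : letter P Q) : R[i] :=
  match l1, l2, l3 with
  | inl i, inl j, inl k => cP i j k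
  | inr i, inr j, inr k => - cQ i j k
  | _, _, _ => 0 end.
have [i0 hi0] := nc_fil_generated Pspan Qspan.
have one_deg (n : nat) : G n 1 -> n = 0%N.
  by move=> Gn; have [/eqP|[]//] := degree_eq hG Gn (G1 hG); rewrite oner_eq0.
have one_degN (n : nat) : G (- n%:Z) 1 -> n = 0%N.
  move=> Gn; have [/eqP|/eqP] := degree_eq hG Gn (G1 hG); first by rewrite oner_eq0.
  by rewrite oppr_eq0 => /eqP[].
have d2l i : d2 (inl i) = 0%N by apply: one_degN; exact: (Gc (inl i)).
have d1r i : d1 (inr i) = 0%N by apply: one_deg; exact: (Gb (inr i)).
move=> idI idJ IJ JI.
apply: (@deep_separation R A G delta T1 (letter P Q) (@lletter _ _ P Q) (@rletter _ _ P Q)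
  d1 d2 cst Gb Gc d0 _ _ _ (fil F) i0 (fil_sub F) nc_fil_fin_dim (@fil_subset _ _ F) (fil_ex F) _ hi0 _
  I J idI idJ IJ JI).
- move=> [i|i] [j|j] v; rewrite big_sumType /= /bimul ?mul1r ?mulr1.
  + rewrite [X in _ + (_ + X)]big1 ?addr0; last by move=> k _; rewrite scale0r.
    rewrite mulrA ecP mulrDl mulrA mulr_suml; congr (_ + _); apply: eq_bigr => k _.
    by rewrite mulr1 scalerAl.
  + by rewrite !big1 ?addr0 ?mulrA // => k _; rewrite scale0r.
  + by rewrite !big1 ?addr0 ?mulrA // => k _; rewrite scale0r.
  + rewrite [X in _ + (X + _)]big1 ?add0r; last by move=> k _; rewrite scale0r.
    rewrite -[v * _ * _]mulrA -[v * Q`_i * _]mulrA (ecQ i j) mulrDr -addrA.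
    rewrite [X in _ + X](_ : _ = 0) ?addr0 // mulr_sumr -big_split big1 //= => k _.
    by rewrite scaleNr scalerAr addrN.
- move=> [i|i] [j|j] [k|k] /=; rewrite ?eqxx //.
  + move=> /dcP /(_ (Gb (inl i)) (Gb (inl j))) Gk; rewrite !d2l !addn0.
    have [e|] := degree_eq hG (Gb (inl k)) Gk; last by rewrite -PoszD => -[].
    by have [_ /eqP] := hP _ (mem_nth 0 (ltn_ord k)).
  + rewrite oppr_eq0 => /dcQ /(_ (Gc (inr i)) (Gc (inr j))) Gk; rewrite !d1r !add0n.
    have [e|] := degree_eq hG (Gc (inr k)) Gk.
      by have [_ /eqP] := hQ _ (mem_nth 0 (ltn_ord k)).
    by rewrite -opprD => /oppr_inj; rewrite -PoszD => -[].
- exact: (full_deep_words hG tri full).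
- move=> [k|k] i v Fv; rewrite /= /bimul ?mulr1 ?mul1r.
    by apply: fil_mul1l => //; have [[]] := hP _ (mem_nth 0 (ltn_ord k)).
  by apply: fil_mul1r => //; have [[]] := hQ _ (mem_nth 0 (ltn_ord k)).
- move=> i v Fv; apply: filD; first exact: fil_mul1l.
  exact: fil_mul1r.
Qed.

End Noncommutative.

(** * Weights of the distinguished element *)

Section PolynomialShift.
Variable K : fieldType.
Implicit Types (p q : {poly K}) (c : K).

Definition shiftp p c : {poly K} := p \Po ('X - c%:P).

Lemma shiftp_neq0 p c : p != 0 -> shiftp p c != 0.
Proof. by rewrite -!size_poly_eq0 size_comp_poly2 // size_XsubC. Qed.

Lemma root_shiftp p c x : root (shiftp p c) x = root p (x - c).
Proof. by rewrite /root horner_comp !hornerE. Qed.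

Lemma shiftpK p c d : shiftp (shiftp p c) d = shiftp p (c + d).
Proof.
rewrite /shiftp -comp_polyA comp_polyB comp_polyX comp_polyC; congr (_ \Po _).
by rewrite -addrA -opprD -polyCD [d + c]addrC.
Qed.

Lemma shiftp0 p : shiftp p 0 = p.
Proof. by rewrite /shiftp subr0 comp_polyXr. Qed.

Lemma shiftpMXD p a c : shiftp (p * 'X + a%:P) c = shiftp p c * ('X - c%:P) + a%:P.
Proof. by rewrite /shiftp comp_polyD comp_polyM comp_polyX comp_polyC. Qed.

Lemma pev_shift (V V' : lmodType K) (T : {linear V -> V}) (T' : {linear V' -> V'})
    (f : {linear V' -> V}) c : (forall v, T (f v) = f (T' v) + c *: f v) ->
  forall p v, pev T (shiftp p c) (f v) = f (pev T' p v).
Proof.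
move=> Tf; elim/poly_ind => [|p a IH] v; first by rewrite /shiftp comp_poly0 !pev0 raddf0.
rewrite shiftpMXD !pevD !pevC pevMX mulrC pevM IH pevD pevX -polyCN pevC.
by rewrite Tf scaleNr addrK linearD linearZ_LR.
Qed.

End PolynomialShift.

Section RootSeparation.
Variable K : numClosedFieldType.
Implicit Types p q : {poly K}.

Lemma poly_roots p : p != 0 -> exists rs : seq K, forall x, root p x = (x \in rs).
Proof.
move=> p0; have [rs e] := closed_field_poly_normal p; exists rs => x.
by rewrite e rootZ ?lead_coef_eq0 // root_prod_XsubC.
Qed.

Lemma nat_avoid (ds : seq K) : exists M, forall j, (M <= j)%N -> j%:R \notin ds.
Proof.
elim: ds => [|d ds [M hM]]; first by exists 0%N.
have [[j0 ej]|nj] := pselect (exists j : nat, j%:R = d).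
  exists (maxn M j0.+1) => j; rewrite geq_max => /andP[/hM Mj j0j].
  rewrite inE negb_or Mj andbT -ej eqr_nat; by rewrite gtn_eqF.
exists M => j /hM Mj; rewrite inE negb_or Mj andbT.
by apply/eqP => e; apply: nj; exists j.
Qed.

(** Only finitely many naturals occur among the differences of a root of [p] and a root of [q]. *)
Lemma coprime_shift p q : p != 0 -> q != 0 ->
  exists M, forall j, (M <= j)%N -> coprimep p (shiftp q j%:R).
Proof.
move=> /poly_roots[rs hr] /poly_roots[ss hs].
have [M hM] := nat_avoid [seq r - s | r <- rs, s <- ss].
exists M => j /hM jn; apply/Pdiv.ClosedField.coprimepP => x; rewrite hr => xr; rewrite -/(root _ x) root_shiftp hs.
apply: contra jn => xs; apply/allpairsP; exists (x, x - j%:R).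
by split=> //=; rewrite opprB addrC subrK.
Qed.

End RootSeparation.

Section BezoutStep.
Variables (K : fieldType) (V : lmodType K) (T : {linear V -> V}).

(** If [N'] lies in [N + D n], then both [p(T)] and [b(T - e n)] send it into [N + D n.+1], the
    first through [Y]; a Bezout relation between the two polynomials gives [N'] itself. It serves
    twice: for two-sided ideals with [E], and for left ideals with left multiplication by
    [delta]. *)
Lemma coprime_induction (D : nat -> set V) (b p : {poly K}) (e : nat -> K) (M0 : nat)
    (N N' Y : set V) :
  (forall j, subsp (D j)) -> (forall j v, D j v -> D j (T v)) ->
  (forall j v, D j.+1 v -> D j v) ->
  (forall j v, D j v -> D j.+1 (pev T (shiftp b (e j)) v)) ->
  (forall j, (M0 <= j)%N -> coprimep p (shiftp b (e j))) ->
  subsp N -> (forall v, N v -> N (T v)) ->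
  (forall v, N' v -> Y (pev T p v)) ->
  (forall n, N' `<=` addsp N (D n) -> Y `<=` addsp N (D n.+1)) ->
  N' `<=` addsp N (D M0) -> forall n, N' `<=` addsp N (D n).
Proof.
move=> hD TD DS bD cop hN TN pY YD N'D.
have key n : (M0 <= n)%N -> N' `<=` addsp N (D n).
  elim: n => [|n IH]; first by rewrite leqn0 => /eqP<-.
  rewrite leq_eqVlt => /orP[/eqP<-//|Mn] v N'v.
  have {}IH := IH Mn; have hA := subsp_add hN (hD n.+1).
  have TA u : addsp N (D n.+1) u -> addsp N (D n.+1) (T u).
    move=> [y [z [Ny Dz ->]]]; exists (T y), (T z); rewrite linearD.
    by split=> //; [exact: TN | exact: TD].
  have /Bezout_eq1_coprimepP[[u w] /= e1] := cop n Mn.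
  rewrite -[v](pev1 T) -e1 pevD !pevM; apply: (subspD hA); apply: (pev_stable _ hA TA).
    by apply: YD; [exact: IH | exact: pY].
  have [y [z [Ny Dz ->]]] := IH v N'v; rewrite raddfD /=.
  exists (pev T (shiftp b (e n)) y), (pev T (shiftp b (e n)) z); split=> //.
    exact: (pev_stable _ hN TN).
  exact: bD.
move=> n v N'v; have [y [z [Ny Dz ->]]] := key (maxn M0 n) (leq_maxl _ _) v N'v.
exists y, z; split=> //; move: Dz; have := leq_maxr M0 n; elim: (maxn M0 n) => [|k IH].
  by rewrite leqn0 => /eqP->.
by rewrite leq_eqVlt => /orP[/eqP->//|/IH h] /DS.
Qed.

(* If T' = T + D with D commuting with T, then q(T') and q(T) agree on v modulo
   every subspace that contains D v and is stable under T and T'. *)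
Lemma pev_congr (T' : {linear V -> V}) (Z : set V) v q : subsp Z ->
  (forall u, Z u -> Z (T u)) -> (forall u, Z u -> Z (T' u)) ->
  (forall u, T (T' u) = T' (T u)) -> Z (T' v - T v) ->
  Z (pev T' q v - pev T q v).
Proof.
move=> hZ TZ TZ' com Dv.
have Dq p : Z (T' (pev T p v) - T (pev T p v)).
  have -> : T' (pev T p v) - T (pev T p v) = pev T p (T' v - T v).
    rewrite raddfB /=; congr (_ - _); last by rewrite -pevMX pevM pevX.
    elim/poly_ind: p => [|p a IH]; first by rewrite !pev0 raddf0.
    by rewrite !pevD !pevC !pevMX linearD linearZ_LR -com IH.
  exact: (pev_stable _ hZ TZ).
elim/poly_ind: q => [|q a IH]; first by rewrite !pev0 subrr; exact: (subsp0 hZ).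
rewrite !pevD !pevC !pevMX opprD addrACA subrr addr0.
have -> : T' (pev T' q v) - T (pev T q v) =
  T' (pev T' q v - pev T q v) + (T' (pev T q v) - T (pev T q v)).
  by rewrite raddfB /= addrA subrK.
by apply: (subspD hZ); [exact: TZ' | exact: Dq].
Qed.

End BezoutStep.

Section Annihilators.
Variables (K : fieldType) (V : lmodType K) (T : {linear V -> V}).

Lemma annihilating_poly (U : set V) (s : seq V) g : subsp U ->
  (forall i, addsp U (lin_span [set` s]) (iter i T g)) ->
  exists2 p : {poly K}, p != 0 & U (pev T p g).
Proof.
move=> hU hs; have [c [[i ci] Uc]] := dependence hU (ltnSn (size s)) hs.
exists (\poly_(k < (size s).+1) c (inord k)).
  by apply/eqP => /polyP /(_ i); rewrite coef_poly ltn_ord coef0 inord_val => /eqP; rewrite (negbTE ci).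
rewrite (@pev_wide _ _ _ (size s).+1) ?size_poly //; move: Uc; congr (U _).
by apply: eq_bigr => k _; rewrite coef_poly ltn_ord inord_val.
Qed.

Lemma cofinite_annihilating_poly (U : set V) (s : seq V) : subsp U ->
  (forall v, U v -> U (T v)) -> (forall v, addsp U (lin_span [set` s]) v) ->
  exists2 p : {poly K}, p != 0 & forall v, U (pev T p v).
Proof.
move=> hU TU hs.
suff [p p0 hp] : exists2 p : {poly K}, p != 0 & forall g, g \in s -> U (pev T p g).
  exists p => // v; have [u [w [Uu sw ->]]] := hs v; rewrite raddfD /=.
  apply: (subspD hU); first exact: (pev_stable _ hU TU).
  by move: w sw; apply: span_min => //; exact: (subsp_preim (pev T p) hU).
elim: (s) => [|g t [p p0 hp]]; first by exists 1; rewrite ?oner_eq0.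
have [q q0 hq] := annihilating_poly hU (fun i => hs (iter i T g)).
exists (p * q); first by rewrite mulf_neq0.
move=> h; rewrite inE => /orP[/eqP->|ht].
  by rewrite pevM; exact: (pev_stable _ hU TU).
by rewrite mulrC pevM; apply: (pev_stable _ hU TU); exact: hp.
Qed.

End Annihilators.

Section ShiftedOperator.
Variables (K : fieldType) (V : lmodType K) (T : {linear V -> V}) (a : K).

Definition shiftop (v : V) : V := T v - a *: v.

Lemma shiftop_linear : linear shiftop.
Proof.
move=> c u v; rewrite /shiftop linearP scalerDr scalerBr opprD addrACA.
by rewrite !scalerA mulrC.
Qed.

HB.instance Definition _ := GRing.isLinear.Build K V V _ shiftop shiftop_linear.

Lemma pev_shiftop p v : pev T (shiftp p a) v = pev shiftop p v.
Proof. by apply: (@pev_shift _ _ _ T shiftop idfun) => u; rewrite /= /shiftop subrK. Qed.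

Lemma pev_commute (S : {linear V -> V}) p : (forall u, T (S u) = S (T u)) ->
  forall u, pev T p (S u) = S (pev T p u).
Proof.
move=> com u; rewrite -{1}[p]shiftp0; apply: (pev_shift (f := S)) => w.
by rewrite scale0r addr0.
Qed.

End ShiftedOperator.

Section Gamma.
Variables (K : numClosedFieldType) (A : algType K) (G : int -> set A) (Ap Am : set A) (delta : A).
Hypothesis hG : is_grading G.
Hypothesis tri : triangular G Ap Am delta.
Let T1 := tri_T1 tri.
Let ev (p : {poly K}) : A := horner_alg delta p.

Lemma pev_lmul p v : pev (lmulop delta) p v = ev p * v.
Proof.
rewrite /ev; elim/poly_ind: p v => [|p a IH] v; first by rewrite pev0 raddf0 mul0r.
rewrite pevD pevC pevMX IH rmorphD mulrC rmorphM /= horner_algX horner_algC mulrDl.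
by rewrite /lmulop mulrA mulr_algl.
Qed.

Lemma pev_rmul p v : pev (rmulop delta) p v = v * ev p.
Proof.
rewrite /ev; elim/poly_ind: p v => [|p a IH] v; first by rewrite pev0 raddf0 mulr0.
rewrite pevD pevC pevMX IH rmorphD rmorphM /= horner_algX horner_algC mulrDr.
by rewrite /rmulop mulrA mulr_algr.
Qed.

Lemma ev_commute (m : int) c p : G m c -> ev (shiftp p m%:~R) * c = c * ev p.
Proof.
move=> /T1 Gc; rewrite -pev_lmul -[c in LHS]mulr1 -[ev p]mulr1 -pev_lmul.
apply: (@pev_shift _ _ _ (lmulop delta) (lmulop delta) (lmulop c)) => v.
by rewrite /= /lmulop !mulrA -[delta * c](subrK (c * delta)) Gc mulrDl addrC -scaler_int scalerAl.
Qed.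

Definition negright k : set A := lin_span [set x |
  exists (m : nat) a c, [/\ (k <= m)%N, G (- m%:Z) c & x = a * c]].
Definition posleft : set A := lin_span [set x |
  exists (m : nat) b a, [/\ (0 < m)%N, G m b & x = b * a]].

(** In a product b g c of total degree zero, a nonzero degree of b or of c suffices for both claims:
    if b has degree 0 and c degree -m2, then b g has degree m2, and symmetrically. If both degrees
    are zero, b and c are scalars. *)
Lemma degree_zero (gs : seq A) : (forall g, g \in gs -> exists e, G e g) ->
  (forall v, lin_span (homog_products G Ap Am [set` gs]) v) -> forall x, G 0 x ->
  addsp (negright 1) (lin_span [set` gs]) x /\ addsp posleft (lin_span [set` gs]) x.
Proof.
move=> Ggs Agen x Gx.
have hn : subsp (negright 1) by exact: subsp_span.
have hp : subsp posleft by exact: subsp_span.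
have hs : subsp (lin_span [set` gs]) by exact: subsp_span.
have hN := subsp_add hn hs; have hP := subsp_add hp hs.
have hom y : homog_products G Ap Am [set` gs] y -> exists n, G n y.
  move=> [m1 [m2 [b [c [g [[_ Gb] [_ Gc] gin ->]]]]]]; have [e Ge] := Ggs g gin.
  by exists (m1%:Z + e - m2%:Z); apply: (GM hG) => //; exact: (GM hG).
have := @homog_span _ _ _ hG _ 0 _ hom (Agen x); rewrite (pr_eq hG _ Gx) eqxx.
suff : homog_products G Ap Am [set` gs] `&` G 0 `<=`
    addsp (negright 1) (lin_span [set` gs]) `&` addsp posleft (lin_span [set` gs]).
  by move=> h; exact: (span_min (subspI hN hP) h).
move=> y [[m1 [m2 [b [c [g [[Bb Gb] [Bc Gc] gin ->]]]]]] Gy].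
have [e Ge] := Ggs g gin.
have Gy' : G (m1%:Z + e - m2%:Z) (bimul b c g) by apply: (GM hG) => //; exact: (GM hG).
have [->|em] := degree_eq hG Gy Gy'.
  by split; [exact: (subsp0 hN) | exact: (subsp0 hP)].
have Gbg : G (m1%:Z + e) (b * g) by exact: (GM hG).
have Ggc : G (e - m2%:Z) (g * c) by exact: (GM hG).
case: m1 => [|m1] in Gb Gy' em Gbg.
  case: m2 => [|m2] in Gc Gy' em Gbg Ggc.
    have [k ->] : exists k : K, b = k%:A.
      have [->|b0] := eqVneq b 0; first by exists 0; rewrite scale0r.
      by have [//|[n n0 /eqP]] := Ap_sign tri Bb Gb b0; rewrite eqz_nat => /eqP e0; rewrite -e0 in n0.
    have [k' ->] : exists k : K, c = k%:A.
      have [->|b0] := eqVneq c 0; first by exists 0; rewrite scale0r.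
      by have [//|[n n0 /eqP]] := Am_sign tri Bc Gc b0; rewrite eqr_opp eqz_nat => /eqP e0; rewrite -e0 in n0.
    have hg : lin_span [set` gs] (bimul k%:A k'%:A g).
      by rewrite /bimul mulr_algl mulr_algr; do !apply: (subspZ hs); exact: span_sub.
    by split; [exact: (addspr hn) | exact: (addspr hp)].
  split; [apply: (addspl hs) | apply: (addspl hs)]; apply: span_sub.
    by exists m2.+1, (b * g), c.
  exists m2.+1, (b * g), c; split=> //; move: Gbg; congr (G _ _); lia.
split; apply: (addspl hs); apply: span_sub; last by exists m1.+1, b, (g * c); rewrite mulrA.
exists m1.+1, b, (g * c); rewrite mulrA; split=> //; move: Ggc; congr (G _ _); lia.
Qed.

(** The powers of [delta] have degree zero, and [A(0)] is finite dimensional modulo each of the two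
    subspaces. *)
Lemma weight_polys : exists pL pR : {poly K},
  [/\ pL != 0, pR != 0, posleft (ev pL) & negright 1 (ev pR)].
Proof.
have [gs [Ggs Agen]] := homogeneous_generators hG tri.
have Gd i : G 0 (iter i (lmulop delta) 1).
  elim: i => [|i IH]; first exact: (G1 hG).
  by rewrite iterS -[0]addr0; apply: (GM hG) => //; exact: (delta_G0 hG T1).
have [pL pL0 hL] := annihilating_poly (T := lmulop delta) (g := 1) (subsp_span _)
  (fun i => (degree_zero Ggs Agen (Gd i)).2).
have [pR pR0 hR] := annihilating_poly (T := lmulop delta) (g := 1) (subsp_span _)
  (fun i => (degree_zero Ggs Agen (Gd i)).1).
by exists pL, pR; rewrite !pev_lmul !mulr1 in hL hR.
Qed.

Definition outer (J : set A) : set A := lin_span [set x | exists (m : nat) v b,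
  [/\ (0 < m)%N, J v & (G m b /\ x = b * v) \/ (G (- m%:Z) b /\ x = v * b)]].

Lemma outer_lmul J v : two_sided_ideal J -> outer J v -> outer J (delta * v).
Proof.
move=> hJ; have h : subsp (outer J) by exact: subsp_span.
move: v; apply: span_min; first exact: (subsp_preim (lmulop delta) h).
move=> _ [m [v [b [m0 Jv [[Gb ->]|[Gb ->]]]]]] /=; apply: span_sub.
  exists m, (delta * v + m%:R *: v), b; split=> //; last left.
    apply: (subspD (ideal_subsp hJ)); first exact: (Defs.idealMl hJ).
    exact: (subspZ (ideal_subsp hJ)).
  split=> //; have := T1 Gb; rewrite /lmulop mulrDr -scalerAr !mulrA => e.
  by rewrite -[delta * b](subrK (b * delta)) e mulrDl addrC -pmulrn -scaler_nat scalerAl.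
exists m, (delta * v), b; split=> //; first exact: (Defs.idealMl hJ).
by right; rewrite /lmulop mulrA.
Qed.

Lemma outer_rmul J v : two_sided_ideal J -> outer J v -> outer J (v * delta).
Proof.
move=> hJ; have h : subsp (outer J) by exact: subsp_span.
move: v; apply: span_min; first exact: (subsp_preim (rmulop delta) h).
move=> _ [m [v [b [m0 Jv [[Gb ->]|[Gb ->]]]]]] /=; apply: span_sub.
  exists m, (v * delta), b; split=> //; first exact: (Defs.idealMr hJ).
  by left; rewrite /rmulop mulrA.
exists m, (v * delta + m%:R *: v), b; split=> //; last right.
  apply: (subspD (ideal_subsp hJ)); first exact: (Defs.idealMr hJ).
  exact: (subspZ (ideal_subsp hJ)).
split=> //; have := T1 Gb; rewrite /rmulop mulrDl -scalerAl -!mulrA mulrNz => e.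
rewrite -[b * delta](subrK (delta * b)) -opprB e opprK mulrDr addrC -pmulrn -scaler_nat.
by rewrite scalerAr.
Qed.

(** Modulo [outer J], left and right multiplication by [delta] are commuting operators on [J]
    annihilated by [pL] and [pR]. Their sum is then annihilated by the product of the [pR(X - a)]
    over the roots [a] of [pL]. The roots are peeled off one at a time, since [E - a] differs from
    right multiplication by left multiplication minus [a]. *)
Lemma outer_poly : exists2 p : {poly K}, p != 0 &
  forall J, two_sided_ideal J -> forall v, J v -> outer J (pev (sumop delta) p v).
Proof.
have [pL [pR [pL0 pR0 hL hR]]] := weight_polys.
have [al eal] := closed_field_poly_normal pL.
exists (\prod_(a <- al) shiftp pR a).
  by rewrite prodf_seq_neq0; apply/allP => a _ /=; exact: shiftp_neq0.
move=> J hJ v Jv; have hY : subsp (outer J) by exact: subsp_span.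
have sJ := ideal_subsp hJ.
pose E : {linear A -> A} := sumop delta.
have EY u : outer J u -> outer J (E u).
  by move=> Yu; apply: (subspD hY); [exact: outer_lmul | exact: outer_rmul].
have com_l u : E (lmulop delta u) = lmulop delta (E u).
  by rewrite /E /= /sumop /lmulop mulrDr !mulrA.
have com_r u : E (rmulop delta u) = rmulop delta (E u).
  by rewrite /E /= /sumop /rmulop mulrDl !mulrA.
have YL : outer J (pev (lmulop delta) (\prod_(a <- al) ('X - a%:P)) v).
  have -> : \prod_(a <- al) ('X - a%:P) = (lead_coef pL)^-1 *: pL.
    by rewrite {2}eal scalerA mulVf ?lead_coef_eq0 // scale1r.
  rewrite pevZ; apply: (subspZ hY); rewrite pev_lmul.
  have hpre := subsp_preim (rmulop v) hY.
  move: (ev pL) hL; apply: (span_min hpre) => _ [m [b [a [m0 Gb ->]]]]; apply: span_sub.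
  exists m, (a * v), b; split=> //; first exact: (Defs.idealMl hJ).
  by left; rewrite /rmulop mulrA.
elim: (al) v Jv YL => [|a s IH] v Jv YL; first by move: YL; rewrite !big_nil !pev1.
rewrite big_cons mulrC pevM; set P := \prod_(a <- s) shiftp pR a.
(* The part of [J] that the remaining factors send into [outer J]; by the induction hypothesis it
   contains [delta * v - a *: v]. *)
pose Z : set A := fun u => J u /\ outer J (pev E P u).
have hZ : subsp Z by exact: (subspI sJ (subsp_preim (pev E P) hY)).
have JL u : J u -> J (delta * u) by exact: (Defs.idealMl hJ).
have JR u : J u -> J (u * delta) by exact: (Defs.idealMr hJ).
have ZL u : Z u -> Z (lmulop delta u).
  move=> [Ju Yu]; split; first exact: JL.
  by rewrite (pev_commute _ com_l); exact: outer_lmul.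
have ZR u : Z u -> Z (rmulop delta u).
  move=> [Ju Yu]; split; first exact: JR.
  by rewrite (pev_commute _ com_r); exact: outer_rmul.
suff : Z (pev E (shiftp pR a) v) by case.
rewrite pev_shiftop.
have ZE u : Z u -> Z (shiftop E a u).
  by move=> Zu; apply: (subspB hZ); [apply: (subspD hZ); [exact: ZL | exact: ZR] | exact: (subspZ hZ)].
have Zw : Z (shiftop E a v - rmulop delta v).
  have -> : shiftop E a v - rmulop delta v = lmulop delta v - a *: v.
    by rewrite /shiftop /E /= /sumop /rmulop /lmulop addrAC addrK.
  have Jw : J (lmulop delta v - a *: v).
    by apply: (subspB sJ); [exact: JL | exact: (subspZ sJ)].
  split=> //; apply: IH => //; move: YL; rewrite big_cons mulrC pevM.
  by rewrite pevD pevX -polyCN pevC scaleNr.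
have comR u : rmulop delta (shiftop E a u) = shiftop E a (rmulop delta u).
  by rewrite /shiftop com_r linearB linearZ_LR.
have := pev_congr pR hZ ZR ZE comR Zw.
suff : Z (pev (rmulop delta) pR v).
  by move=> h1 h2; have := subspD hZ h2 h1; rewrite subrK.
have JRp : J (pev (rmulop delta) pR v) by rewrite pev_rmul; exact: (Defs.idealMr hJ).
split=> //; apply: (pev_stable _ hY EY); rewrite pev_rmul.
have hpre := subsp_preim (lmulop v) hY.
move: (ev pR) hR; apply: (span_min hpre) => _ [m [b [c [m0 Gc ->]]]]; apply: span_sub.
exists m, (v * b), c; split=> //; first exact: (Defs.idealMr hJ).
by right; rewrite /= /lmulop ?mulrA.
Qed.

Hypothesis lettersP : exists (L : finType) (b c : L -> A) (d1 d2 : L -> nat),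
  (forall l, 0 < d1 l + d2 l)%N /\ full_letters G Ap Am b c d1 d2.

Lemma deep_cofinite M : exists s : seq A, forall v, addsp (deep_part G M) (lin_span [set` s]) v.
Proof.
have [L [b [c [d1 [d2 [d0 full]]]]]] := lettersP.
have [gs [_ Agen]] := homogeneous_generators hG tri.
apply: (full_cofinite (M := M) d0 full (deep_sub G M) Agen) => m1 m2 b0 c0 g _ Gb _ Gc _ Mm.
by apply: span_sub; exists m1, m2, b0, g, c0.
Qed.

(** [deep_part G 1] has finite codimension and is stable under [E], so some [b(E)] maps all of [A]
    into it; shifted by [j], it deepens the middle factor of a product of exact depth [j]. The other
    half is that [outer J] lies one unit deeper than [J] modulo [I]. *)
Lemma depth_bound : exists M0, forall I J, two_sided_ideal I -> two_sided_ideal J ->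
  J `<=` addsp I (deep_part G M0) -> forall M, J `<=` addsp I (deep_part G M).
Proof.
have [p p0 hp] := outer_poly.
pose E : {linear A -> A} := sumop delta.
have ED j v : deep_part G j v -> deep_part G j (E v) by exact: (deep_sumop T1).
have [s hs] := deep_cofinite 1.
have [b b0 hb] := cofinite_annihilating_poly (deep_sub G 1) (ED 1%N) hs.
have [M0 hM0] := coprime_shift p0 b0; exists M0 => I J idI idJ.
apply: (@coprime_induction _ A E (deep_part G) b p (fun j => j%:R) M0 I J (outer J)) => //.
- exact: deep_sub.
- by move=> j; exact: deep_mono.
- move=> j; have hD := deep_sub G j.+1.
  apply: span_min; first exact: (subsp_preim (pev E _) hD).
  move=> _ [m1 [m2 [b1 [v [c1 [Gb Gc jm ->]]]]]] /=.
  have [e|jm'] := eqVneq j (m1 + m2)%N.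
    have -> : pev E (shiftp b j%:R) (bimul b1 c1 v) = bimul b1 c1 (pev E b v).
      apply: (@pev_shift _ _ _ E E (bimul b1 c1)) => u.
      by rewrite /E /= (sumop_bimul T1 u Gb Gc) linearD linearZ_LR e.
    by rewrite e -addn1; exact: (deep_bimul hG).
  apply: (pev_stable _ hD (ED j.+1)); apply: span_sub; exists m1, m2, b1, v, c1; split=> //.
  by rewrite ltn_neqAle jm'.
- exact: ideal_subsp.
- move=> v Iv; apply: (Defs.idealD idI); [exact: (Defs.idealMl idI) | exact: (Defs.idealMr idI)].
- by move=> v Jv; exact: hp.
- move=> n Jn; have hA := subsp_add (ideal_subsp idI) (deep_sub G n.+1).
  apply: (span_min hA) => _ [m [v [b1 [m0 /Jn[y [z [Iy Dz ->]]] [[Gb ->]|[Gb ->]]]]]].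
    exists (b1 * y), (b1 * z); rewrite mulrDr; split=> //; first exact: (Defs.idealMl idI).
    have -> : b1 * z = bimul b1 1 z by rewrite /bimul mulr1.
    apply: (@deep_mono _ _ _ n.+1 (m + 0 + n)%N); first by rewrite addn0 -[n.+1]add1n leq_add2r.
    by apply: (deep_bimul hG) => //; exact: (G1 hG).
  exists (y * b1), (z * b1); rewrite mulrDl; split=> //; first exact: (Defs.idealMr idI).
  have -> : z * b1 = bimul 1 b1 z by rewrite /bimul mul1r.
  apply: (@deep_mono _ _ _ n.+1 (0 + m + n)%N); first by rewrite add0n -[n.+1]add1n leq_add2r.
  by apply: (deep_bimul hG) => //; exact: (G1 hG).
Qed.

End Gamma.

Section LeftIdeals.
Variables (K : numClosedFieldType) (A : algType K) (G : int -> set A) (Ap Am : set A) (delta : A).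
Hypothesis hG : is_grading G.
Hypothesis tri : triangular G Ap Am delta.
Let T1 := tri_T1 tri.
Let ev (p : {poly K}) : A := horner_alg delta p.

Definition left_ideal (N : set A) : Prop := subsp N /\ forall a x, N x -> N (a * x).

Lemma negright_lmul k a x : negright G k x -> negright G k (a * x).
Proof.
have hN : subsp (negright G k) by exact: subsp_span.
move: x; apply: (span_min (subsp_preim (lmulop a) hN)) => _ [m [b [c [km Gc ->]]]].
by apply: span_sub; exists m, (a * b), c; split=> //=; rewrite /lmulop mulrA.
Qed.

(** Each further unit of depth takes one more factor: moved to the left past [c] of degree [- k],
    the polynomial [p(X - k)] in [delta] becomes [p], and [p(delta)] supplies another factor of
    negative degree in front of [c]. *)
Lemma deep_weight_poly k : exists2 q : {poly K}, q != 0 & negright G k (ev q).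
Proof.
have [_ [p [_ p0 _ hp]]] := weight_polys hG tri.
elim: k => [|k [q q0 hq]].
  exists 1; rewrite ?oner_eq0 //; apply: span_sub; exists 0%N, (ev 1), 1.
  by split=> //; [exact: (G1 hG) | rewrite mulr1].
exists (q * shiftp p k%:R); first by rewrite mulf_neq0 // shiftp_neq0.
have -> : ev (q * shiftp p k%:R) = ev q * ev (shiftp p k%:R) by rewrite /ev rmorphM.
have hN : subsp (negright G k.+1) by exact: subsp_span.
move: (ev q) hq; apply: (span_min (subsp_preim (rmulop (ev (shiftp p k%:R))) hN)).
move=> _ [m [a [c [km Gc ->]]]]; rewrite /= /rmulop -mulrA; apply: negright_lmul.
rewrite -(ev_commute tri _ Gc); move: km; rewrite leq_eqVlt => /orP[/eqP e|km]; last first.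
  by apply: span_sub; exists m, (ev (shiftp (shiftp p k%:R) (- m%:Z)%:~R)), c.
rewrite shiftpK rmorphN -e /= subrr shiftp0.
move: (horner_alg delta p) hp; apply: (span_min (subsp_preim (rmulop c) hN)).
move=> _ [m' [a' [c' [m0 Gc' ->]]]]; apply: span_sub; exists (m' + m)%N, a', (c' * c).
split; first by rewrite -add1n e leq_add.
  by rewrite PoszD opprD; exact: (GM hG).
by rewrite /= /rmulop mulrA.
Qed.

Definition tail (j : nat) : set A := lin_span [set x | exists2 m : int, (j%:Z <= m)%R & G m x].

Lemma tail_sub j : subsp (tail j). Proof. exact: subsp_span. Qed.

Lemma tail_delta j v : tail j v -> tail j (delta * v).
Proof.
move: v; apply: (span_min (subsp_preim (lmulop delta) (tail_sub j))) => v [m jm Gv].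
apply: span_sub; exists m => //; rewrite -[m]add0r; apply: (GM hG) => //.
exact: (delta_G0 hG T1).
Qed.

Lemma tail_mono i j : (i <= j)%N -> tail j `<=` tail i.
Proof.
by move=> ij; apply: span_mono => x [m jm Gx]; exists m => //; apply: le_trans jm; rewrite lez_nat.
Qed.

Lemma tail_support n v : tail n v -> exists s : seq int,
  (forall m, m \in s -> n%:Z <= m) /\ exists f : int -> A, (forall m, G m (f m)) /\ v = \sum_(m <- s) f m.
Proof.
move=> tv; have [s [Gs us sv ev']] := prP hG v.
exists [seq m <- s | n%:Z <= m]; split; first by move=> m; rewrite mem_filter => /andP[].
exists (fun m => pr hG m v); split; first exact: (fun m => pr_G hG m v).
rewrite {1}ev' (bigID (fun m => n%:Z <= m)) /= [X in _ + X]big1 ?addr0 ?big_filter //.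
move=> m nm; have : tail n v -> [set 0] (pr hG m v); last by move/(_ tv).
apply: (span_min (subsp_preim (pr hG m) (subsp1 _))) => x [k nk Gx] /=.
by rewrite (pr_eq hG m Gx); case: eqP nm => // ->; rewrite nk.
Qed.

Section AboveTail.
Variable L : set A.
Hypothesis hL : left_ideal L.
Variable q : {poly K}.
Hypothesis q_neq0 : q != 0.
Hypothesis Lq : L (ev q).

Lemma homog_killed (m : int) v : G m v -> L (pev (lmulop delta) (shiftp q m%:~R) v).
Proof. by move=> Gv; rewrite pev_lmul (ev_commute tri _ Gv); exact: hL.2. Qed.

Lemma support_killed (s : seq int) (f : int -> A) : (forall m, G m (f m)) ->
  L (pev (lmulop delta) (\prod_(m <- s) shiftp q m%:~R) (\sum_(m <- s) f m)).
Proof.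
move=> Gf; rewrite linear_sum; apply: (subsp_sum_seq hL.1) => m ms.
rewrite (big_rem m) //= mulrC pevM; apply: (pev_stable _ hL.1) => [u|].
  exact: hL.2.
exact: homog_killed.
Qed.

(** Two shifts of [q] whose distance is large have no common root, so the degrees in [s] can be
    separated from all sufficiently large ones. *)
Lemma coprime_support (s : seq int) : exists n : nat, forall t : seq int,
  (forall m, m \in t -> n%:Z <= m) ->
  coprimep (\prod_(m <- s) shiftp q m%:~R) (\prod_(m <- t) shiftp q m%:~R).
Proof.
have [n hn] : exists n : nat, forall m, m \in s -> forall m' : int, n%:Z <= m' ->
    coprimep (shiftp q m%:~R) (shiftp q m'%:~R).
  elim: s => [|m s [n hn]]; first by exists 0%N.
  have [M hM] := coprime_shift q_neq0 q_neq0.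
  exists (maxn n (M + `|m|)%N) => k' + m'; rewrite inE => /orP[/eqP->|/hn h] nm; last first.
    by apply: h; apply: le_trans nm; rewrite lez_nat leq_maxl.
  have Mm : (M + `|m|)%N%:Z <= m' by apply: le_trans nm; rewrite lez_nat leq_maxr.
  have := hM `|m' - m|%N; rewrite (_ : (M <= _)%N); last by lia.
  have e : (`|m' - m|%N)%:R = (m' - m)%:~R :> K.
    by rewrite pmulrn gez0_abs //; lia.
  rewrite e => /(_ isT); rewrite !coprimep_def => /eqP => h.
  apply/Pdiv.ClosedField.coprimepP => x.
  have /Pdiv.ClosedField.coprimepP/(_ (x - m%:~R)) : coprimep q (shiftp q (m' - m)%:~R).
    by rewrite coprimep_def h.
  rewrite -/(root _ x) -/(root _ (x - _)) !root_shiftp rmorphB /=.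
  by rewrite opprB addrA subrK.
exists n => t ht; rewrite big_seq; elim/big_ind: _ => [|x y hx hy|m ms].
- exact: coprime1p.
- by rewrite coprimepMl hx.
rewrite big_seq; elim/big_ind: _ => [|x y hx hy|m' mt]; first exact: coprimep1.
  by rewrite coprimepMr hx.
by apply: hn => //; exact: ht.
Qed.

Lemma left_separation : exists M1, forall N N', left_ideal N -> left_ideal N' ->
  L `<=` N -> N' `<=` addsp N (addsp (tail M1) L) -> N' `<=` N.
Proof.
have [p [_ [p0 _ hp _]]] := weight_polys hG tri.
have [M1 hM1] := coprime_shift p0 q_neq0.
exists M1 => N N' hN hN' LN NM v N'v.
have dN (X : set A) : left_ideal X -> forall u, X u -> X (lmulop delta u).
  by move=> hX u; exact: hX.2.
pose Y := lin_span [set x | exists (m : nat) b u, [/\ (0 < m)%N, G m b, N' u & x = b * u]].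
have hD n := subsp_add (tail_sub n) hL.1.
have TD n u : addsp (tail n) L u -> addsp (tail n) L (lmulop delta u).
  move=> [y [z [ty Lz ->]]]; exists (delta * y), (delta * z); rewrite linearD.
  by split=> //; [exact: tail_delta | exact: hL.2].
have all_tails n : N' `<=` addsp N (addsp (tail n) L).
  apply: (@coprime_induction _ A (lmulop delta) (fun n => addsp (tail n) L) q p
    (fun j => j%:R) M1 N N' Y) => //.
  - by move=> j u [y [z [ty Lz ->]]]; exists y, z; split=> //; exact: tail_mono ty.
  - move=> j _ [y [z [ty Lz ->]]]; rewrite linearD; apply: (subspD (hD j.+1)); last first.
      by apply: (addspr (tail_sub _)); apply: (pev_stable _ hL.1) => //; exact: dN.
    move: y ty; apply: (span_min (subsp_preim (pev (lmulop delta) _) (hD _))) => y [m jm Gy] /=.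
    have [e|jm'] := eqVneq j%:Z m.
      by apply: (addspr (tail_sub _)); rewrite pmulrn e; exact: homog_killed.
    apply: (pev_stable _ (hD _) (TD _)); apply: (addspl hL.1); apply: span_sub.
    by exists m => //; lia.
  - exact: hN.1.
  - exact: dN.
  - move=> u N'u; rewrite pev_lmul; have hY : subsp Y by exact: subsp_span.
    move: (horner_alg delta p) hp; apply: (span_min (subsp_preim (rmulop u) hY)).
    move=> _ [m [b [a [m0 Gb ->]]]]; apply: span_sub; exists m, b, (a * u).
    by split=> //; [exact: hN'.2 | rewrite /= /rmulop mulrA].
  - move=> j Nj; have hA := subsp_add hN.1 (hD j.+1).
    apply: (span_min hA) => _ [m [b [u [m0 Gb /Nj[x [_ [Nx [y [z [ty Lz ->]]] ->]]] ->]]]].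
    exists (b * x), (b * y + b * z); rewrite !mulrDr; split=> //; first exact: hN.2.
    exists (b * y), (b * z); split=> //; last exact: hL.2.
    move: y ty; apply: (span_min (subsp_preim (lmulop b) (tail_sub _))) => y [m' jm Gy].
    apply: span_sub; exists (m%:Z + m'); last exact: (GM hG).
    by move: m0 jm; lia.
(* The polynomial of the degrees of [v] kills [v] modulo [L], the polynomial of the high degrees
   kills its tail component, and the two are coprime. *)
have [s [Gs us sv ev']] := prP hG v.
have kv := support_killed s Gs; rewrite -ev' in kv.
have [n hn] := coprime_support s.
have [x [_ [Nx [y [z [ty Lz ->]]] exyz]]] := all_tails n v N'v.
have [t [tn [f [Gf ey]]]] := tail_support ty.
have ky := support_killed t Gf; rewrite -ey in ky.
have /Bezout_eq1_coprimepP[[u w] /= e1] := hn t tn.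
have Nd := dN N hN.
rewrite -[v](pev1 (lmulop delta)) -e1 pevD !pevM.
apply: (subspD hN.1); apply: (pev_stable _ hN.1 Nd); first exact: LN.
rewrite exyz !linearD; apply: (subspD hN.1); first exact: (pev_stable _ hN.1 Nd).
apply: (subspD hN.1); first exact: LN.
by apply: (pev_stable _ hN.1 Nd); exact: LN.
Qed.

End AboveTail.

Hypothesis lettersP : exists (L : finType) (b c : L -> A) (d1 d2 : L -> nat),
  (forall l, 0 < d1 l + d2 l)%N /\ full_letters G Ap Am b c d1 d2.

(** A product whose right factor has degree at most [- k] lies in [L]; otherwise large total depth
    forces the left factor, and with it the product, into high degree. *)
Lemma tail_cofinite (L : set A) k M1 : left_ideal L -> negright G k `<=` L ->
  exists s : seq A, forall v, addsp (addsp (tail M1) L) (lin_span [set` s]) v.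
Proof.
move=> hL Lk; have [X [b [c [d1 [d2 [d0 full]]]]]] := lettersP.
have [gs [Ggs Agen]] := homogeneous_generators hG tri.
have /choice[e he] : forall g, exists e, g \in gs -> G e g.
  move=> g; have [/Ggs[e Ge]|_] := boolP (g \in gs); first by exists e.
  by exists 0.
pose e1 := (\max_(g <- gs) `|e g|)%N.
apply: (full_cofinite (M := (M1 + e1 + k + k)%N) d0 full (subsp_add (tail_sub M1) hL.1) Agen).
move=> m1 m2 b0 c0 g _ Gb _ Gc gin Mm.
have ge1 : (`|e g| <= e1)%N by apply: (bigop.bigmaxn_sup_seq _ gin).
have [km|mk] := leqP k m2.
  by apply: (addspr (tail_sub _)); apply: Lk; apply: span_sub; exists m2, (b0 * g), c0.
apply: (addspl hL.1); apply: span_sub; exists (m1%:Z + e g - m2%:Z); last first.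
  by apply: (GM hG) => //; apply: (GM hG) => //; exact: he.
by move: ge1 mk Mm; lia.
Qed.

Lemma left_composition (L : set A) k : left_ideal L -> negright G k `<=` L ->
  exists n (N : nat -> set A), [/\ forall i, (i <= n)%N -> left_ideal (N i),
    N 0%N = L, N n = setT & forall i, (i < n)%N -> [/\ N i `<=` N i.+1, N i <> N i.+1 &
      forall W, left_ideal W -> N i `<=` W -> W `<=` N i.+1 -> W = N i \/ W = N i.+1]].
Proof.
move=> hL Lk; have [q q0 hq] := deep_weight_poly k.
have [M1 hM1] := left_separation hL q0 (Lk _ hq).
have [s hs] := tail_cofinite M1 hL Lk.
have hD := subsp_add (tail_sub M1) hL.1.
have [|||n N|n [N [hN N0 Nn max]]] := @maximal_chain A
  (fun W => left_ideal W /\ L `<=` W) L setT (size s).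
- by split.
- by split=> //; split=> //; exact: subspT.
- by [].
- move=> hN hS; apply: (chain_bound hD hs (fun i ni => (hN i ni).1.1)) => i ni.
  have [Ni neq] := hS i ni; split=> // NU; apply: neq; apply/seteqP; split=> //.
  by apply: hM1 NU; [exact: (hN i (ltnW ni)).1 | exact: (hN i.+1 ni).1 | exact: (hN i (ltnW ni)).2].
exists n, N; split=> // [i ni|i ni]; first exact: (hN i ni).1.
have [Ni neq mx] := max i ni; split=> // W hW NW WN; apply: mx => //; split=> //.
exact: subset_trans (hN i (ltnW ni)).2 NW.
Qed.

End LeftIdeals.

(** * Quotient modules *)

Section QuotientByLeftIdeal.
Variable A : nzRingType.

Record left_ideal_of := LeftIdealOf {
  lcarrier : set A;
  lcarrier0 : lcarrier 0;
  lcarrierB : forall x y, lcarrier x -> lcarrier y -> lcarrier (x - y);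
  lcarrierM : forall a x, lcarrier x -> lcarrier (a * x) }.

Variable P : left_ideal_of.

Definition lpred : {pred A} := fun a => `[< lcarrier P a >].

Lemma lpred_zmod : zmod_closed lpred.
Proof.
split; first by apply/asboolP; exact: lcarrier0.
by move=> x y /asboolP Px /asboolP Py; apply/asboolP; exact: lcarrierB.
Qed.

HB.instance Definition _ := GRing.isZmodClosed.Build A lpred lpred_zmod.

Definition lquot : Type := Quotient.quot lpred.
HB.instance Definition _ := GRing.Zmodule.on lquot.

Definition lpi (a : A) : lquot := \pi_(Quotient.quot lpred) a.

Lemma lpi_eq a b : lpi a = lpi b <-> lcarrier P (a - b).
Proof.
rewrite /lpi; split=> [/eqP|h]; first by rewrite -Quotient.idealrBE => /asboolP.
by apply/eqP; rewrite -Quotient.idealrBE; apply/asboolP.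
Qed.

Lemma lpiK y : exists a, y = lpi a.
Proof. by exists (repr y); rewrite /lpi reprK. Qed.

Lemma lpiD a b : lpi (a + b) = lpi a + lpi b.
Proof. by rewrite /lpi raddfD. Qed.

Definition lscale (a : A) (y : lquot) : lquot := lpi (a * repr y).

Lemma lscaleE a b : lscale a (lpi b) = lpi (a * b).
Proof.
apply/lpi_eq; rewrite -mulrBr; apply: lcarrierM; apply/lpi_eq.
by rewrite /lpi reprK.
Qed.

Lemma lscaleA a b y : lscale a (lscale b y) = lscale (a * b) y.
Proof. by case: (lpiK y) => c ->; rewrite !lscaleE mulrA. Qed.

Lemma lscale1 : left_id 1 lscale.
Proof. by move=> y; case: (lpiK y) => c ->; rewrite lscaleE mul1r. Qed.

Lemma lscaleDr : right_distributive lscale +%R.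
Proof.
move=> a y z; case: (lpiK y) (lpiK z) => b -> [c ->].
by rewrite -lpiD !lscaleE mulrDr lpiD.
Qed.

Lemma lscaleDl y : {morph lscale^~ y : a b / a + b}.
Proof. by move=> a b; case: (lpiK y) => c ->; rewrite !lscaleE mulrDl lpiD. Qed.

HB.instance Definition _ := GRing.Zmodule_isLmodule.Build A lquot
  lscaleA lscale1 lscaleDr lscaleDl.

Lemma lquot_cyclic : (forall y : lquot, exists a, y = a *: lpi 1) /\
  forall a, a *: lpi 1 = 0 <-> lcarrier P a.
Proof.
have sc a : a *: lpi 1 = lpi a by rewrite -[LHS]/(lscale a (lpi 1)) lscaleE mulr1.
split=> [y|a]; first by case: (lpiK y) => a ->; exists a; rewrite sc.
have e0 : lpi 0 = 0 by rewrite /lpi raddf0.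
rewrite sc -e0; split=> [/lpi_eq|h]; first by rewrite subr0.
by apply/lpi_eq; rewrite subr0.
Qed.

End QuotientByLeftIdeal.

Section CyclicModules.
Variable A : nzRingType.

Lemma quotient_module (P : set A) : P 0 -> (forall x y, P x -> P y -> P (x - y)) ->
  (forall a x, P x -> P (a * x)) -> exists (M : lmodType A) (x : M),
    (forall y : M, exists a, y = a *: x) /\ forall a, a *: x = 0 <-> P a.
Proof.
move=> P0 PB PM; pose Q := LeftIdealOf P0 PB PM.
by exists (lquot Q), (lpi Q 1); exact: (lquot_cyclic Q).
Qed.

Lemma cyclic_map (M M' : lmodType A) (x : M) (x' : M') :
  (forall y, exists a, y = a *: x) -> (forall a, a *: x = 0 -> a *: x' = 0) ->
  exists f : {linear M -> M'}, forall a, f (a *: x) = a *: x'.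
Proof.
move=> /choice[c hc] xx'; pose f y := c y *: x'.
have fE a : f (a *: x) = a *: x'.
  apply/eqP; rewrite -subr_eq0 -scalerBl; apply/eqP; apply: xx'.
  by rewrite scalerBl -hc subrr.
have f_lin : linear f.
  move=> a u v; rewrite (hc u) (hc v) scalerA -scalerDl !fE.
  by rewrite scalerDl scalerA.
pose F : {linear M -> M'} := HB.pack f (GRing.isLinear.Build _ _ _ _ f f_lin).
by exists F.
Qed.

Lemma cyclic_fg (M : lmodType A) (x : M) : (forall y, exists a, y = a *: x) -> fg_module M.
Proof.
move=> hx; exists [:: x] => y; have [a ->] := hx y.
by exists (fun=> a); rewrite big_ord1.
Qed.

Lemma submod_closedP (M : lmodType A) (W : set M) : W 0 ->
  (forall a u v, W u -> W v -> W (a *: u + v)) -> submod_closed [in W].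
Proof.
move=> W0 WD; split; first by rewrite inE.
by move=> a u v; rewrite !inE; exact: WD.
Qed.

Lemma primitive_prime (I : set A) : primitive_ideal I -> prime_two_sided_ideal I.
Proof.
move=> [pI [M [nz simp] eI]]; split=> // J1 J2 h1 h2 h12.
have [J2I|nJ] := pselect (J2 `<=` I); first by right.
left=> a J1a; have [b [J2b nb]] : exists b, J2 b /\ ~ I b.
  by apply: contrapT => h; apply: nJ => b Jb; apply: contrapT => nb; apply: h; exists b.
have [x nx] : exists x : M, b *: x <> 0.
  apply: contrapT => h; apply: nb; rewrite eI => x; apply: contrapT => nx.
  by apply: h; exists x.
pose W : set M := [set y | exists2 b', J2 b' & y = b' *: x].
have hW : submod_closed [in W].
  apply: submod_closedP; first by exists 0; [exact: Defs.ideal0 | rewrite scale0r].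
  move=> c _ _ [u Ju ->] [v Jv ->]; exists (c * u + v); last by rewrite scalerDl scalerA.
  by apply: (Defs.idealD h2) => //; exact: (Defs.idealMl h2).
have [W0|WT] := simp W hW.
  by case: nx; have : W (b *: x) by [exists b]; rewrite W0.
rewrite eI => y; have : W y by rewrite WT.
move=> [b' Jb' ->]; rewrite scalerA.
suff : I (a * b') by rewrite eI; exact.
apply: h12; exists 1%N, (fun=> a), (fun=> b'); split=> //.
by rewrite big_ord1.
Qed.

End CyclicModules.

Section SimpleObjects.
Variables (K : fieldType) (A : algType K) (G : int -> set A) (Am : set A).

(** An arbitrary submodule is not known to be an object, but the cyclic submodule generated by one
    of its nonzero elements is, and simplicity in the category makes that one everything. *)
Lemma simple_in_catO_simple (M : lmodType A) : simple_in_catO G Am M -> simple_module M.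
Proof.
move=> [[fgM nilM] nz simp]; split=> // W [W0 WZ].
have [h|/existsNP[x /not_implyP[Wx x0]]] := pselect (forall x, W x -> x = 0).
  left; apply/seteqP; split=> // x ->; by rewrite inE in W0.
right; apply/seteqP; split=> // y _.
have [N [n0 [ngen nann]]] := @quotient_module A [set a | a *: x = 0] (scale0r x)
  (fun a b (ha : a *: x = 0) (hb : b *: x = 0) =>
     ltac:(by rewrite /= scalerBl ha hb subrr))
  (fun a b (hb : b *: x = 0) => ltac:(by rewrite /= -scalerA hb scaler0)).
have [f fE] := cyclic_map ngen (fun a => (nann a).1).
have finj : injective f.
  move=> u v e; have [a ea] := ngen (u - v); apply/eqP; rewrite -subr_eq0; apply/eqP.
  by rewrite ea; apply/nann; rewrite /= -fE -ea linearB e subrr.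
have NO : in_catO G Am N.
  split; first exact: cyclic_fg ngen.
  move=> u; have [n n_gt0 hn] := nilM (f u); exists n => // a Ba; apply: finj.
  by rewrite linearZ_LR raddf0 hn.
have [zN|fsurj] := simp N f NO finj.
  by case: x0; rewrite -[x]scale1r -fE (zN (1 *: n0)) raddf0.
have [u <-] := fsurj y; have [a ->] := ngen u; rewrite fE.
by have := WZ a x 0; rewrite addr0 !inE in W0 * => /(_ Wx W0).
Qed.

End SimpleObjects.

(** * The main theorem *)

Section Duflo.
Variables (K : numClosedFieldType) (A : algType K) (G : int -> set A) (Ap Am : set A) (delta : A).
Hypothesis hG : is_grading G.
Hypothesis tri : triangular G Ap Am delta.
Hypothesis separation : forall I J : set A, two_sided_ideal I -> two_sided_ideal J ->
  I `<=` J -> (forall M, J `<=` addsp I (deep_part G M)) -> J `<=` I.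

Lemma triangular_letters : exists (L : finType) (b c : L -> A) (d1 d2 : L -> nat),
  (forall l, 0 < d1 l + d2 l)%N /\ full_letters G Ap Am b c d1 d2.
Proof.
have [P [Q [hP hQ PA QA]]] := generator_lists hG tri.
have [d1 [d2 [_ _ d0 full]]] := @list_letters _ _ _ Ap Am hG P Q
  (fun x xP => (hP x xP).2) (fun x xQ => (hQ x xQ).2) PA QA.
by exists (letter P Q), (@lletter _ _ P Q), (@rletter _ _ P Q), d1, d2.
Qed.

Lemma uniform_separation : exists M0, forall I J : set A, two_sided_ideal I ->
  two_sided_ideal J -> I `<=` J -> J `<=` addsp I (deep_part G M0) -> J `<=` I.
Proof.
have [M0 hM0] := depth_bound hG tri triangular_letters.
by exists M0 => I J idI idJ IJ h; apply: separation => //; exact: hM0.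
Qed.

Lemma bimodule_length : finite_bimodule_length A.
Proof.
have [M0 hM0] := uniform_separation.
have [s hs] := deep_cofinite hG tri triangular_letters M0.
have id0 : two_sided_ideal ([set 0] : set A).
  by split=> // [x y -> ->|a x ->|a x ->] /=; rewrite ?addr0 ?mulr0 ?mul0r.
have [||||n [N [hN N0 Nn max]]] := @maximal_chain A (@two_sided_ideal A) [set 0] setT (size s) => //.
- move=> n N hN hS; apply: (chain_bound (deep_sub G M0) hs (fun i ni => ideal_subsp (hN i ni))).
  move=> i ni; have [Ni neq] := hS i ni; split=> // NU; apply: neq; apply/seteqP; split=> //.
  by apply: hM0 => //; apply: hN => //; exact: ltnW.
by exists n, N.
Qed.

Definition low_degree (e : int) : set A := lin_span [set x | exists2 m : int, (m <= e)%R & G m x].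

Lemma low_degree_ex b : exists e : int, low_degree e b.
Proof.
have [s [Gs _ _ eb]] := prP hG b; exists (\max_(m <- s) `|m|)%N.
rewrite eb; apply: (subsp_sum_seq (subsp_span _)) => m ms; apply: span_sub; exists m => //.
have : (`|m| <= \max_(m <- s) `|m|)%N by apply: (bigop.bigmaxn_sup_seq _ ms).
lia.
Qed.

Lemma low_degree_Am e a v : Am_bar G Am a -> low_degree e v -> low_degree (e - 1) (a * v).
Proof.
move=> [s [x [us /allP sneg Bx ->]]]; have h : subsp (low_degree (e - 1)) by exact: subsp_span.
rewrite mulr_suml => lv; apply: (subsp_sum_seq h) => m ms; have m0 := sneg m ms.
move: v lv; apply: (span_min (subsp_preim (lmulop (x m)) h)) => v [m' m'e Gv].
apply: span_sub; exists (m + m'); first by lia.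
by apply: (GM hG) => //; case: (Bx m).
Qed.

Lemma low_degree_prod n (a : 'I_n -> A) e v : (forall i, Am_bar G Am (a i)) -> low_degree e v ->
  low_degree (e - n%:Z) ((\prod_(i < n) a i) * v).
Proof.
elim: n a => [|n IH] a Ba lv; first by rewrite big_ord0 mul1r subr0.
rewrite big_ord_recl -mulrA (_ : e - n.+1%:Z = e - n%:Z - 1); last by lia.
by apply: low_degree_Am => //; apply: IH => // i.
Qed.

Lemma low_degree_negright k (e : int) : (e <= - k%:Z)%R -> low_degree e `<=` negright G k.
Proof.
move=> ek; apply: (span_min (subsp_span _)) => x [m me Gx].
apply: span_sub; exists `|m|%N, 1, x; rewrite mul1r; split=> //; first by lia.
by rewrite (_ : - _ = m) //; lia.
Qed.

Lemma negright_deep k : negright G k `<=` deep_part G k.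
Proof.
apply: span_mono => _ [m [a [c [km Gc ->]]]]; exists 0%N, m, 1, a, c.
by split=> //; [exact: (G1 hG) | rewrite /bimul mul1r].
Qed.

Section SimpleSubquotient.
Variables (N N' : set A) (k : nat).
Hypothesis hN : left_ideal N.
Hypothesis hN' : left_ideal N'.
Hypothesis negN : negright G k `<=` N.
Hypothesis NN' : N `<=` N'.
Hypothesis neq : N <> N'.
Hypothesis max : forall W, left_ideal W -> N `<=` W -> W `<=` N' -> W = N \/ W = N'.

(** The quotient of [N'] by [N] is realised as the quotient of [A] by the left ideal of all [a] with
    [a * v] in [N], for any [v] in [N'] outside [N]. *)
Lemma simple_subquotient : exists2 M : lmodType A, simple_in_catO G Am M &
  annihilator M = [set a | forall x, N' x -> N (a * x)].
Proof.
have [v [N'v nNv]] : exists v, N' v /\ ~ N v.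
  apply: contrapT => h; apply: neq; apply/seteqP; split=> // v N'v.
  by apply: contrapT => nv; apply: h; exists v.
have sN := hN.1; have sN' := hN'.1.
have lZ (W : set A) : left_ideal W -> forall a x y, W x -> W y -> W (a * x + y).
  by move=> [sW WM] a x y Wx Wy; apply: (subspD sW) => //; exact: WM.
have [M [x [xgen xann]]] := @quotient_module A [set a | N (a * v)]
  ltac:(by rewrite /= mul0r; exact: (subsp0 sN))
  (fun a b (ha : N (a * v)) (hb : N (b * v)) =>
     ltac:(by rewrite /= mulrBl; exact: (subspB sN)))
  (fun a b (hb : N (b * v)) => ltac:(by rewrite /= -mulrA; exact: hN.2)).
have dich (W : set A) : left_ideal W -> forall v', W v' -> N' v' -> ~ N v' ->
    W `<=` N' -> N `<=` W -> W = N'.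
  by move=> hW v' Wv' _ nv' WN NW; case: (max hW NW WN) => // e; rewrite e in Wv'.
have N'gen z : N' z -> exists b y, N y /\ z = b * v + y.
  pose W : set A := [set z | exists b y, N y /\ z = b * v + y].
  suff -> : N' = W by [].
  apply/esym; apply: (dich W _ v) => //.
  - split.
      apply: subspP; first by exists 0, 0; rewrite mul0r addr0; split=> //; exact: (subsp0 sN).
      move=> c _ _ [b [y [Ny ->]]] [b' [y' [Ny' ->]]].
      exists (c *: b + b'), (c *: y + y'); split; first exact: (subspZD sN).
      by rewrite scalerDr mulrDl scalerAl addrACA.
    move=> a _ [b [y [Ny ->]]]; exists (a * b), (a * y).
    by rewrite mulrDr mulrA; split=> //; exact: hN.2.
  - by exists 1, 0; rewrite mul1r addr0; split=> //; exact: (subsp0 sN).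
  - by move=> _ [b [y [Ny ->]]]; apply: lZ => //; exact: NN'.
  - by move=> y Ny; exists 0, y; rewrite mul0r add0r.
have simp (W : set M) : submod_closed [in W] -> W = [set 0] \/ W = setT.
  move=> [W0 WZ]; have W0' : W 0 by rewrite inE in W0.
  have WZ' a u w : W u -> W w -> W (a *: u + w).
    by move=> Wu Ww; have := WZ a u w; rewrite !inE => /(_ Wu Ww).
  pose V : set A := [set z | exists b y, [/\ N y, W (b *: x) & z = b * v + y]].
  have hV : left_ideal V.
    split.
      apply: subspP.
        by exists 0, 0; rewrite mul0r addr0 scale0r; split=> //; exact: (subsp0 sN).
      move=> c _ _ [b [y [Ny Wb ->]]] [b' [y' [Ny' Wb' ->]]].
      exists (c *: b + b'), (c *: y + y'); split; first exact: (subspZD sN).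
        by rewrite scalerDl -[c *: b]mulr_algl -scalerA; exact: WZ'.
      by rewrite scalerDr mulrDl scalerAl addrACA.
    move=> a _ [b [y [Ny Wb ->]]]; exists (a * b), (a * y).
    rewrite mulrDr mulrA; split=> //; first exact: hN.2.
    by rewrite -scalerA -[_ *: _]addr0; exact: WZ'.
  have NV : N `<=` V by move=> y Ny; exists 0, y; rewrite mul0r add0r scale0r.
  have VN : V `<=` N' by move=> _ [b [y [Ny _ ->]]]; apply: lZ => //; exact: NN'.
  have [VE|VE] := max hV NV VN; [left | right]; apply/seteqP; split=> // y.
  - move=> Wy; have [b eb] := xgen y; rewrite eb; apply/xann => /=; rewrite -VE.
    by exists b, 0; rewrite addr0 -eb; split=> //; exact: (subsp0 sN).
  - by move=> ->.
  - move=> _; have : V v by rewrite VE.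
    move=> [b [z [Nz Wb ev]]]; have ex : x = b *: x.
      apply/eqP; rewrite -subr_eq0 -{1}[x]scale1r -scalerBl; apply/eqP/xann => /=.
      by rewrite mulrBl mul1r {1}ev addrC addKr.
    by have [a ->] := xgen y; rewrite ex -[_ *: _]addr0; exact: WZ'.
exists M; last first.
  apply/seteqP; split=> a /= ha.
    move=> z /N'gen[b [y [Ny ->]]]; rewrite mulrDr mulrA; apply: (subspD sN).
      by apply/xann; rewrite -scalerA.
    exact: hN.2.
  move=> y; have [b ->] := xgen y; rewrite scalerA; apply/xann; rewrite /= -mulrA.
  by apply: ha; exact: hN'.2.
split.
- split; first exact: cyclic_fg xgen.
  move=> y; have [b ->] := xgen y; have [e le] := low_degree_ex (b * v).
  (* Each factor lowers the degree by at least one, so this many factors bring [b * v] from degree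
     at most [e] to degree at most [- k]. *)
  exists (`|e| + k).+1 => // a Ba; rewrite scalerA; apply/xann => /=; apply: negN.
  rewrite -mulrA; have := low_degree_prod Ba le; apply: low_degree_negright; lia.
- by move=> z; apply: nNv; have := z x; rewrite -[x]scale1r => /xann; rewrite /= mul1r.
- move=> N1 f _ finj; pose W : set M := range f.
  have hW : submod_closed [in W].
    apply: submod_closedP; first by exists 0; rewrite ?raddf0.
    by move=> a _ _ [u _ <-] [w _ <-]; exists (a *: u + w); rewrite ?linearP.
  have [W0|WT] := simp W hW; [left=> y | right=> y].
    by apply: finj; rewrite raddf0; have : W (f y) by [exists y]; rewrite W0.
  by have : W y by [rewrite WT]; case=> u _ <-; exists u.
Qed.

End SimpleSubquotient.

Lemma prime_annihilator (I : set A) : prime_two_sided_ideal I ->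
  exists2 M : lmodType A, simple_in_catO G Am M & I = annihilator M.
Proof.
move=> [[idI properI] primeI]; have [M0 hM0] := uniform_separation.
pose L := addsp I (negright G M0).
have sI := ideal_subsp idI; have sn : subsp (negright G M0) by exact: subsp_span.
have hL : left_ideal L.
  split; first exact: subsp_add.
  move=> a _ [y [z [Iy nz ->]]]; exists (a * y), (a * z); rewrite mulrDr.
  by split=> //; [exact: (Defs.idealMl idI) | exact: negright_lmul].
have negL : negright G M0 `<=` L by exact: addspr.
have IL : I `<=` L by exact: addspl.
have [n [N [hN N0 Nn max]]] := left_composition hG tri triangular_letters hL negL.
have LN i : (i <= n)%N -> L `<=` N i.
  elim: i => [|i IH] ni; first by rewrite N0.
  by apply: subset_trans (IH (ltnW ni)) _; case: (max i ni).
(* [X i] annihilates [N i] modulo [L] and [Y i] annihilates [N i.+1] modulo [N i], so the product of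
   [X i] and [Y i] lies in [X i.+1]. *)
pose X i : set A := [set a | forall x, N i x -> L (a * x)].
pose Y i : set A := [set a | forall x, N i.+1 x -> N i (a * x)].
have idX (P Q : set A) : left_ideal P -> left_ideal Q ->
    two_sided_ideal [set a | forall x, P x -> Q (a * x)].
  move=> [sP PM] [sQ QM]; split=> [x _|a b ha hb x Px|a b hb x Px|a b hb x Px].
  - by rewrite mul0r; exact: (subsp0 sQ).
  - by rewrite mulrDl; apply: (subspD sQ); [exact: ha | exact: hb].
  - by rewrite -mulrA; apply: QM; exact: hb.
  - by rewrite -mulrA; apply: hb; exact: PM.
(* Since [N n] is all of [A], the ideal [X n] lies in [L], hence in [I + D_M0], and uniform
   separation applies. *)
have XnI : X n `<=` I.
  apply: hM0 => //; first by apply: idX => //; exact: hN.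
    by move=> a Ia x _; apply: IL; exact: (Defs.idealMr idI).
  move=> a Xa; have := Xa 1; rewrite Nn mulr1 => /(_ Logic.I).
  by move=> [y [z [Iy nz ->]]]; exists y, z; split=> //; exact: negright_deep.
(* Otherwise primeness would carry the inclusion in [I] from [X n] down to [X 0], which is all of
   [A]. *)
have [i [ni YI]] : exists i, (i < n)%N /\ Y i `<=` I.
  apply: contrapT => h.
  suff XI i : (i <= n)%N -> X (n - i)%N `<=` I.
    apply: properI; apply/seteqP; split=> // a _; apply: (XI n (leqnn n)).
    by rewrite subnn => x; rewrite N0; exact: hL.2.
  elim: i => [|i IH] ni; first by rewrite subn0.
  have e : (n - i = (n - i.+1).+1)%N by lia.
  have lt : (n - i.+1 < n)%N by lia.
  have h1 : two_sided_ideal (X (n - i.+1)%N) by apply: idX => //; apply: hN; lia.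
  have h2 : two_sided_ideal (Y (n - i.+1)%N) by apply: idX; apply: hN; lia.
  have h12 : ideal_mul (X (n - i.+1)%N) (Y (n - i.+1)%N) `<=` I.
    move=> x [m [a [b [Xa Yb ->]]]]; apply: (subsp_sum sI) => j _.
    apply: (IH (ltnW ni)); rewrite e => z Nz; rewrite -mulrA; apply: (Xa j).
    exact: (Yb j).
  have [//|YI] := primeI _ _ h1 h2 h12.
  by case: h; exists (n - i.+1)%N.
have [NN neq mx] := max i ni.
have [M simM annM] := simple_subquotient (hN i (ltnW ni)) (hN i.+1 ni)
  (subset_trans negL (LN i (ltnW ni))) NN neq mx.
exists M => //; rewrite annM; apply/seteqP; split=> // a Ia x _.
by apply: (LN i (ltnW ni)); apply: IL; exact: (Defs.idealMr idI).
Qed.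

Theorem duflo (I : set A) : proper_two_sided_ideal I ->
  (primitive_ideal I <-> prime_two_sided_ideal I) /\
  (prime_two_sided_ideal I <->
     exists2 M : lmodType A, simple_in_catO G Am M & I = annihilator M).
Proof.
move=> pI.
have iii_i : (exists2 M : lmodType A, simple_in_catO G Am M & I = annihilator M) ->
    primitive_ideal I.
  by move=> [M /simple_in_catO_simple sM eI]; split=> //; exists M.
split; split=> [|h]; try exact: primitive_prime.
- by apply: iii_i; exact: prime_annihilator.
- exact: prime_annihilator.
- by apply: primitive_prime; exact: iii_i.
Qed.

End Duflo.

Local Open Scope complex_scope.

Theorem theorem2p3p1 (R : realType) (A : algType R[i])
    (G : int -> set A) (Ap Am : set A) (delta : A)
    (hG : is_grading G)
    (htri : commutative_triangular G Ap Am delta \/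
            exists F : filtration A, noncommutative_triangular G Ap Am delta F) :
  (forall I : set A, proper_two_sided_ideal I ->
     (primitive_ideal I <-> prime_two_sided_ideal I) /\
     (prime_two_sided_ideal I <->
        exists2 M : lmodType A, simple_in_catO G Am M & I = annihilator M)) /\
  finite_bimodule_length A.
Proof.
have [tri sep] : triangular G Ap Am delta /\ forall I J : set A,
    two_sided_ideal I -> two_sided_ideal J -> I `<=` J ->
    (forall M, J `<=` addsp I (deep_part G M)) -> J `<=` I.
  case: htri => [c|[F nc]]; split.
  - exact: ctri_triangular c.
  - exact: (commutative_separation hG c).
  - exact: nctri_triangular nc.
  - exact: (noncommutative_separation hG nc).
by split; [exact: (duflo hG tri sep) | exact: (bimodule_length hG tri sep)].
Qed.
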